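(* The element $\tau=(\tau^{(1)},\tau^{(2)},\tau^{(3)})$ defined explicitly in the context, with $\tau^{(r)}\in\mathbb Q[[x_1,\dots,x_r]]$, is a (shuffle-regularised) solution to the full double shuffle equations in depths $\le3$. That is, $f^{(r)}=\tau^{(r)}$, together with $$f_\star^{(1)}=f^{(1)},\qquad f_\star^{(2)}=f^{(2)}+\tfrac1{48},\qquad f_\star^{(3)}(x_1,x_2,x_3)=f^{(3)}(x_1,x_2,x_3)-\tfrac1{96}\big(b(x_1)-\tfrac1{x_1}\big),$$ satisfies (writing $x_{ij}=x_i+x_j$, $x_{ijk}=x_i+x_j+x_k$) the shuffle equations $$f^{(2)}(x_1,x_{12})+f^{(2)}(x_2,x_{12})=f^{(1)}(x_1)f^{(1)}(x_2),$$ $$f^{(3)}(x_1,x_{12},x_{123})+f^{(3)}(x_2,x_{12},x_{123})+f^{(3)}(x_2,x_{23},x_{123})=f^{(1)}(x_1)f^{(2)}(x_2,x_{23}),$$ and the stuffle equations $$f_\star^{(2)}(x_1,x_2)+f_\star^{(2)}(x_2,x_1)=\frac{f_\star^{(1)}(x_1)-f_\star^{(1)}(x_2)}{x_2-x_1}+f_\star^{(1)}(x_1)f_\star^{(1)}(x_2),$$ $$f_\star^{(3)}(x_1,x_2,x_3)+f_\star^{(3)}(x_2,x_1,x_3)+f_\star^{(3)}(x_2,x_3,x_1)=\frac{f_\star^{(2)}(x_2,x_1)-f_\star^{(2)}(x_2,x_3)}{x_3-x_1}+\frac{f_\star^{(2)}(x_1,x_3)-f_\star^{(2)}(x_2,x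_3)}{x_2-x_1}+f_\star^{(1)}(x_1)f_\star^{(2)}(x_2,x_3).$$
   Context: **Operations.** For homogeneous rational functions $f(y_0,\dots,y_r)$, $g(y_0,\dots,y_s)$ put $$f\,\underline\circ\, g=\sum_{i=0}^s f(y_i,\dots,y_{i+r})\,g(y_0,\dots,y_i,y_{i+r+1},\dots,y_{r+s})+(-1)^{\deg f+r}\sum_{i=1}^s f(y_{i+r},\dots,y_i)\,g(y_0,\dots,y_{i-1},y_{i+r},\dots,y_{r+s}),$$ and $\{f,g\}=f\,\underline\circ\, g-g\,\underline\circ\, f$, extended bilinearly to (infinite) sums of homogeneous rational functions. A function $f(x_1,\dots,x_r)$ (depth $r$) is identified with the translation-invariant function $f(y_1-y_0,\dots,y_r-y_0)$, and one returns to the variables $x$ by $(y_0,\dots,y_r)\mapsto(0,x_1,\dots,x_r)$. **Definitions.** $B_k$ is the $k$-th Bernoulli number, $b_1(x)=b(x)=\frac1{e^x-1}+\frac12$ (odd Laurent series $x^{-1}+O(x)$), and $b_2(x_1,x_2)=\frac13\big(b_1(x_1)b_1(x_2)+b_1(x_2)b_1(x_1-x_2)\big)$. Put $$2\gamma^{(1)}=-b_1,\qquad 4\gamma^{(2)}=-b_2+\tfrac12\,b_1\,\underline\circ\, b_1,\qquad 8\gamma^{(3)}=b_2\,\underline\circ\, b_1-\tfrac16\,b_1\,\underline\circ\,(b_1\,\underline\circ\, b_1).$$ Let $s^{(1)}=\frac1{2x_1}$, $s^{(2)}=\frac1{12}\big(\frac1{x_1x_2}+\frac1{x_2(x_1-x_2)}\big)$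 and $$\Theta^{(1)}=\gamma^{(1)},\qquad\Theta^{(2)}=\gamma^{(2)}+s^{(1)}\,\underline\circ\,\gamma^{(1)},\qquad\Theta^{(3)}=\gamma^{(3)}+s^{(1)}\,\underline\circ\,\gamma^{(2)}+s^{(2)}\,\underline\circ\,\gamma^{(1)}+\tfrac12 s^{(1)}\,\underline\circ\,(s^{(1)}\,\underline\circ\,\gamma^{(1)}).$$ Each $\Theta^{(r)}$ is a sum of homogeneous rational functions of degrees $\ge -r$; let $p_r$ be its component of degree $-r$ and $\Phi^{(r)}=\Theta^{(r)}-p_r$. For $n\ge-1$ let $\xi^{(1)}_{2n+1}=x_1^{2n}$, $\xi^{(2)}_{2n+1}=\{s^{(1)},x_1^{2n}\}$; put $\underline\xi_{-1}=\frac1{12}\xi_{-1}$ and $\underline\xi_{2n+1}=\frac{B_{2n}}{(2n)!}\xi_{2n+1}$ for $n\ge0$. Let $C=\sum_{n\ge1}\frac1{2n}\{\underline\xi_{-1},\underline\xi_{2n+1}\}$, with depth components $$C^{(2)}=\sum_{n\ge1}\tfrac1{2n}\{\underline\xi_{-1}^{(1)},\underline\xi_{2n+1}^{(1)}\},\qquad C^{(3)}=\sum_{n\ge1}\tfrac1{2n}\big(\{\underline\xi_{-1}^{(1)},\underline\xi_{2n+1}^{(2)}\}+\{\underline\xi_{-1}^{(2)},\underline\xi_{2n+1}^{(1)}\}\big).$$ Finally $$\tau^{(1)}=\Phi^{(1)},\qquad\tau^{(2)}=\Phi^{(2)}+C^{(2)},\qquad\tau^{(3)}=\Phi^{(3)}+C^{(2)}\,\underline\circ\,\Phi^{(1)}+C^{(3)}.$$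 Via the correspondence taking a word $\mathsf x_1\mathsf x_0^{i_1}\cdots\mathsf x_1\mathsf x_0^{i_r}$ to $x_1^{i_1}\cdots x_r^{i_r}$, the $\tau^{(r)}$ encode an element $\tau\in\mathbb Q\langle\langle\mathsf x_0,\mathsf x_1\rangle\rangle$ modulo words with at least four $\mathsf x_1$'s. *)

(* Defs.v *)
From HB Require Import structures.
From mathcomp Require Import all_boot all_order all_algebra.
From mathcomp Require Import boolp classical_sets functions fsbigop.
From mathcomp Require Import mpoly.

Set Implicit Arguments.
Unset Strict Implicit.
Unset Printing Implicit Defensive.

Import GRing.Theory.
Local Open Scope ring_scope.
Local Open Scope quotient_scope.

Notation rfun n := {fraction {mpoly rat[n]}}.

Definition ratc n (c : rat) : rfun n := tofrac (mpolyC n c).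

HB.instance Definition _ n :=
  GRing.RMorphism.copy (@ratc n) (@FracField.tofrac _ \o @mpolyC n rat).

(* [xvar n i] is x_i for 1 <= i <= n.  The value at 0 is the coordinate y_0,
   normalised to 0, so that [xvar n] is the point (0, x_1, ..., x_n). *)
Definition xvar n (i : nat) : rfun n :=
  if i is j.+1 then
    if insub j is Some k then tofrac 'X_k else 0
  else 0.

(* Substitution f(v_0, ..., v_{r-1}).  It is computed on a chosen numerator and
   denominator of f; by [fsubst_frac] the choice is immaterial as soon as the
   v_j are algebraically independent, and below they are always linearly
   independent linear forms. *)
Definition psubst r n (v : 'I_r -> rfun n) (p : {mpoly rat[r]}) : rfun n :=
  mmap (@ratc n) v p.

Definition fsubst r n (f : rfun r) (v : 'I_r -> rfun n) : rfun n :=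
  psubst v (frac (repr f)).1 / psubst v (frac (repr f)).2.

Lemma frac_repr (R : idomainType) (x : {fraction R}) :
  x = tofrac (frac (repr x)).1 / tofrac (frac (repr x)).2.
Proof.
apply: (canRL (mulfK _)); first by rewrite tofrac_eq0 denom_ratioP.
rewrite -{1}[x]reprK; set u := repr x; rewrite !piE; apply/eqP.
rewrite FracField.equivf_def /FracField.mulf /=.
by rewrite !numden_Ratio ?mulf_neq0 ?oner_neq0 ?denom_ratioP // !mulr1 mulrC.
Qed.

Section Substitution.
Variables (r n : nat) (v : 'I_r -> rfun n).

Lemma psubstM : {morph psubst v : p q / p * q}.
Proof. exact: rmorphM. Qed.

Lemma fsubst_frac (p q : {mpoly rat[r]}) :
  (forall u, psubst v u = 0 -> u = 0) -> q != 0 ->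
  fsubst (tofrac p / tofrac q) v = psubst v p / psubst v q.
Proof.
move=> v_indep q0; rewrite /fsubst; set f := tofrac p / tofrac q.
have ev0 u : u != 0 -> psubst v u != 0 by apply: contra_neq; exact: v_indep.
have d0 : (frac (repr f)).2 != 0 by exact: denom_ratioP.
apply/eqP; rewrite eqr_div ?ev0 // -!psubstM; apply/eqP; congr psubst.
apply/eqP; rewrite -tofrac_eq !tofracM -eqr_div ?tofrac_eq0 //.
by rewrite -frac_repr.
Qed.

End Substitution.

(* Formal sums, over d : int, of homogeneous rational functions f d of degree d
   in n variables.  All the sums used below have degrees bounded from below. *)
Definition hsum (n : nat) : Type := int -> rfun n.

HB.instance Definition _ n := GRing.Zmodule.on (hsum n).

Section HsumLmodule.
Variable n : nat.
Definition hscale (c : rat) (f : hsum n) : hsum n := fun d => ratc n c * f d.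

Fact hscaleA a b f : hscale a (hscale b f) = hscale (a * b) f.
Proof. by apply/funext => d; rewrite /hscale /ratc !rmorphM mulrA. Qed.
Fact hscale1 : left_id 1 hscale.
Proof. by move=> f; apply/funext => d; rewrite /hscale /ratc !rmorph1 mul1r. Qed.
Fact hscaleDr : right_distributive hscale +%R.
Proof. by move=> a f g; apply/funext => d; rewrite /hscale /= mulrDr. Qed.
Fact hscaleDl f : {morph hscale^~ f : a b / a + b}.
Proof. by move=> a b; apply/funext => d; rewrite /hscale /ratc !rmorphD mulrDl. Qed.
End HsumLmodule.

HB.instance Definition _ n :=
  GRing.Zmodule_isLmodule.Build rat (hsum n)
    (@hscaleA n) (@hscale1 n) (@hscaleDr n) (@hscaleDl n).

(* A rational function f, homogeneous of degree d. *)
Definition hpure n (d : int) (f : rfun n) : hsum n :=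
  fun e => if e == d then f else 0.

(* [\sum_(e \in _)] is a sum with finite support: the terms vanish for all but
   finitely many e because both factors have degrees bounded from below.  The
   notation [*] must not be used on [hsum]: it is the pointwise product. *)
Definition hmul n (f g : hsum n) : hsum n :=
  fun d => \sum_(e \in [set: int]%classic) f e * g (d - e).

(* Substitution of linear forms, which preserves degrees. *)
Definition hsubst r n (f : hsum r) (v : seq (rfun n)) : hsum n :=
  fun d => fsubst (f d) (fun j => v`_j).

(* Division by a nonzero linear form. *)
Definition hdiv n (f : hsum n) (l : rfun n) : hsum n :=
  hmul f (hpure (-1) l^-1).

(* The value at (z_0, ..., z_r) of the translation-invariant function
   f(y_1 - y_0, ..., y_r - y_0). *)
Definition tinv r n (f : rfun r) (z : nat -> rfun n) : rfun n :=
  fsubst f (fun j => z j.+1 - z 0%N).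

(* The operation on a homogeneous f of degree d, restricted to y_0 = 0.  The
   number n of variables of the result is meant to be r + s; keeping it separate
   lets both terms of [bracket] live in the same type. *)
Definition circ_homog n r s (d : int) (f : rfun r) (g : rfun s) : rfun n :=
  let y := xvar n in
    \sum_(0 <= i < s.+1)
      tinv f (fun j => y (i + j)%N)
      * tinv g (fun j => if (j <= i)%N then y j else y (j + r)%N)
  + (-1) ^ (d + r%:Z) *
    \sum_(1 <= i < s.+1)
      tinv f (fun j => y (i + r - j)%N)
      * tinv g (fun j => if (j < i)%N then y j else y (j + r)%N).

Definition circ_in n r s (f : hsum r) (g : hsum s) : hsum n :=
  fun d => \sum_(e \in [set: int]%classic) circ_homog n e (f e) (g (d - e)).

Definition circ r s (f : hsum r) (g : hsum s) : hsum (r + s) :=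
  circ_in (r + s) f g.

Notation "f \circ g" := (circ f g) (at level 40, left associativity).

Definition bracket r s (f : hsum r) (g : hsum s) : hsum (r + s) :=
  circ_in (r + s) f g - circ_in (r + s) g f.

(* Coefficients of the inverse of the power series sum_k (a k) x^k, when a 0 is
   not 0; [psinv_seq a n] lists the first n of them. *)
Fixpoint psinv_seq (a : nat -> rat) (n : nat) : seq rat :=
  if n is m.+1 then
    let c := psinv_seq a m in
    rcons c (((m == 0)%N%:R - \sum_(k < m) c`_k * a (m - k)%N) / a 0%N)
  else [::].

Definition psinv (a : nat -> rat) (n : nat) : rat := (psinv_seq a n.+1)`_n.

Lemma size_psinv_seq a n : size (psinv_seq a n) = n.
Proof. by elim: n => //= n IHn; rewrite size_rcons IHn. Qed.

Lemma nth_psinv_seq a n k : (k < n)%N -> (psinv_seq a n)`_k = psinv a k.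
Proof.
elim: n => // n IHn; rewrite ltnS leq_eqVlt => /predU1P[-> //|lt_kn].
by rewrite /= nth_rcons size_psinv_seq lt_kn IHn.
Qed.

Lemma psinvP a n : a 0%N != 0 ->
  \sum_(k < n.+1) psinv a k * a (n - k)%N = (n == 0)%N%:R.
Proof.
move=> a0; rewrite big_ord_recr /= subnn {2}/psinv /= nth_rcons size_psinv_seq.
rewrite ltnn eqxx divfK // addrC -[RHS]addr0 -addrA; congr (_ + _).
apply/eqP; rewrite addrC subr_eq0; apply/eqP; apply: eq_bigr => k _.
by rewrite nth_psinv_seq.
Qed.

(* x / (e^x - 1) = sum_k (bcoef k) x^k *)
Definition bcoef : nat -> rat := psinv (fun k => (k.+1`!%:R)^-1).

Definition bernoulli (k : nat) : rat := k`!%:R * bcoef k.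

(* 1 / (e^x - 1) + 1/2 *)
Definition b1 : hsum 1 :=
  ((fun d => if d + 1 is Posz k then ratc 1 (bcoef k) * xvar 1 1 ^ d else 0)
     : hsum 1)
  + hpure 0 (ratc 1 2^-1).

Definition b2 : hsum 2 :=
  let x1 := xvar 2 1 in let x2 := xvar 2 2 in
  3^-1 *: (hmul (hsubst b1 [:: x1]) (hsubst b1 [:: x2])
           + hmul (hsubst b1 [:: x2]) (hsubst b1 [:: x1 - x2])).

Definition gamma1 : hsum 1 := 2^-1 *: - b1.
Definition gamma2 : hsum 2 := 4^-1 *: (- b2 + 2^-1 *: (b1 \circ b1)).
Definition gamma3 : hsum 3 :=
  8^-1 *: (b2 \circ b1 - 6^-1 *: (b1 \circ (b1 \circ b1))).

Definition s1 : hsum 1 := hpure (-1) (2 * xvar 1 1)^-1.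
Definition s2 : hsum 2 :=
  let x1 := xvar 2 1 in let x2 := xvar 2 2 in
  hpure (-2) (12^-1 * ((x1 * x2)^-1 + (x2 * (x1 - x2))^-1)).

Definition Theta1 : hsum 1 := gamma1.
Definition Theta2 : hsum 2 := gamma2 + s1 \circ gamma1.
Definition Theta3 : hsum 3 :=
  gamma3 + s1 \circ gamma2 + s2 \circ gamma1
  + 2^-1 *: (s1 \circ (s1 \circ gamma1)).

Definition drop_pole r (f : hsum r) : hsum r :=
  f - hpure (- r%:Z) (f (- r%:Z)).

Definition Phi1 : hsum 1 := drop_pole Theta1.
Definition Phi2 : hsum 2 := drop_pole Theta2.
Definition Phi3 : hsum 3 := drop_pole Theta3.

(* The subscript 2n+1 is represented by n, which ranges over n >= -1. *)
Definition xi1 (n : int) : hsum 1 := hpure (2 * n) (xvar 1 1 ^ (2 * n)).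
Definition xi2 (n : int) : hsum 2 := bracket s1 (xi1 n).

Definition xi_coef (n : int) : rat :=
  if n is Posz m then bernoulli (2 * m)%N / (2 * m)%N`!%:R else 12^-1.

Definition uxi1 (n : int) : hsum 1 := xi_coef n *: xi1 n.
Definition uxi2 (n : int) : hsum 2 := xi_coef n *: xi2 n.

(* The sums over n are finite in each degree d. *)
Definition C2 : hsum 2 := fun d =>
  \sum_(n \in [set n : nat | (1 <= n)%N]%classic)
    ((2 * n)%N%:R^-1 *: bracket (uxi1 (-1)) (uxi1 n)) d.

Definition C3 : hsum 3 := fun d =>
  \sum_(n \in [set n : nat | (1 <= n)%N]%classic)
    ((2 * n)%N%:R^-1 *: (bracket (uxi1 (-1)) (uxi2 n)
                       + bracket (uxi2 (-1)) (uxi1 n))) d.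

Definition tau1 : hsum 1 := Phi1.
Definition tau2 : hsum 2 := Phi2 + C2.
Definition tau3 : hsum 3 := Phi3 + C2 \circ Phi1 + C3.

(* f is a formal power series. *)
Definition is_pseries n (f : hsum n) : Prop :=
  forall d : int,
    if d is Posz k then
      exists2 p : {mpoly rat[n]}, p \is k.-homog & f d = tofrac p
    else f d = 0.

Definition shuffle2 (f1 : hsum 1) (f2 : hsum 2) : Prop :=
  let x1 := xvar 2 1 in let x2 := xvar 2 2 in
  hsubst f2 [:: x1; x1 + x2] + hsubst f2 [:: x2; x1 + x2]
  = hmul (hsubst f1 [:: x1]) (hsubst f1 [:: x2]).

Definition shuffle3 (f1 : hsum 1) (f2 : hsum 2) (f3 : hsum 3) : Prop :=
  let x1 := xvar 3 1 in let x2 := xvar 3 2 in let x3 := xvar 3 3 in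
  hsubst f3 [:: x1; x1 + x2; x1 + x2 + x3]
  + hsubst f3 [:: x2; x1 + x2; x1 + x2 + x3]
  + hsubst f3 [:: x2; x2 + x3; x1 + x2 + x3]
  = hmul (hsubst f1 [:: x1]) (hsubst f2 [:: x2; x2 + x3]).

Definition stuffle2 (f1 : hsum 1) (f2 : hsum 2) : Prop :=
  let x1 := xvar 2 1 in let x2 := xvar 2 2 in
  hsubst f2 [:: x1; x2] + hsubst f2 [:: x2; x1]
  = hdiv (hsubst f1 [:: x1] - hsubst f1 [:: x2]) (x2 - x1)
    + hmul (hsubst f1 [:: x1]) (hsubst f1 [:: x2]).

Definition stuffle3 (f1 : hsum 1) (f2 : hsum 2) (f3 : hsum 3) : Prop :=
  let x1 := xvar 3 1 in let x2 := xvar 3 2 in let x3 := xvar 3 3 in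
  hsubst f3 [:: x1; x2; x3] + hsubst f3 [:: x2; x1; x3]
  + hsubst f3 [:: x2; x3; x1]
  = hdiv (hsubst f2 [:: x2; x1] - hsubst f2 [:: x2; x3]) (x3 - x1)
    + hdiv (hsubst f2 [:: x1; x3] - hsubst f2 [:: x2; x3]) (x2 - x1)
    + hmul (hsubst f1 [:: x1]) (hsubst f2 [:: x2; x3]).

(* Main.v *)
Require Import Defs.
From HB Require Import structures.
From mathcomp Require Import all_boot all_order all_algebra.
From mathcomp Require Import boolp classical_sets functions fsbigop.
From mathcomp Require Import mpoly.
From mathcomp Require Import ring zify.

Set Implicit Arguments.
Unset Strict Implicit.
Unset Printing Implicit Defensive.
Import Order.TTheory GRing.Theory Num.Theory.
Local Open Scope ring_scope.

(** A formal sum of homogeneous functions of bounded below degree is a Laurent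
series in a degree parameter over the field Q(x_1, ..., x_n), and such series form a
field.  All functions of the statement are polynomials with rational coefficients
in the values of three series at the differences y_i - y_j: the odd series b, the
function i = 1/x, which is the polar part of b, and the even series
L = sum_(n >= 1) B_(2n) / (2n (2n)!) x^(2n), a primitive of b - i.  Indeed the sign
(-1)^deg in the insertion operation is a change of sign of the arguments; the
component that is removed from Theta is the same expression with i in place of b;
and the sum over n in C becomes the bracket of x^(-2) / 12 with L in depth two and,
by the Jacobi identity, the bracket of 1/(2x) with that in depth three.
[evaluates_circ], [evaluates_drop_pole] and [evaluates_fsum] express these three
facts, and lead to [evaluates_tau2] and [evaluates_tau3].

The shuffle equations ([sh2_tau], [sh3_tau]) then hold for arbitrary functions b, i
and L of the right parity.  The stuffle equations ([st2_tau], [st3_tau]) need one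
relation besides: both b and i satisfy the addition formula
  b(x) (b(y) + b(x-y)) = b(y) b(x-y) + kappa,
with kappa = 1/4 for b = (coth (x/2)) / 2 and kappa = 0 for i.  The constant enters
through kappa / 12 = 1/48 and kappa / 24 = 1/96, the corrections in depths two and
three.

It remains to see that the tau^(r) are power series.  Their homogeneous components
are rational functions whose denominators are products of the x_i and of the
x_i - x_j ([den_tau3]), so poles along these hyperplanes have to be excluded.
Along the last variable the pole is simple, and its residue, the limit at
x_r = 0 of x_r times the function, is 0: the residue of C, which involves the
derivative b - i of L, is the opposite of that of the rest ([res_tau2],
[res_tau3]).  All other hyperplanes are reached from this one through the double
shuffle equations: their right sides have smaller depth, and if all terms on the left but
one are regular along a hyperplane, so is the remaining one, which is tau^(r) after a
linear change of variables ([regular_all2], [regular_all3]).  Finally a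
component is a homogeneous polynomial because doubling the variables multiplies the
component of degree d by 2^d ([is_pseries_poly]). *)

(** * Insertion and the double shuffle identities, for unspecified functions *)
Section Insertion.
Variables (V : zmodType) (K : fieldType).
Implicit Types (b f g : V -> K) (F G : V -> V -> K).

(** The operation of the theorem in depths (1, 1), (1, 2) and (2, 1), in terms of
the differences x = y_1 - y_0, y = y_2 - y_0, z = y_3 - y_0.  For f homogeneous
of degree d the factor (-1)^d is the effect of replacing the arguments of f by
their opposites.  Hence the second sum of the definition runs over the same
values of f as the first one, only the sign (-1)^r of the depth survives, and the
result no longer refers to degrees. *)
Definition circ11 f g x y := f x * g y + f (y - x) * (g x - g y).
Definition circ12 f G x y z :=
  f x * G y z + f (y - x) * (G x z - G y z) + f (z - y) * (G x y - G x z).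
Definition circ21 F g x y z :=
  F x y * g z + F (y - x) (z - x) * g x + F (z - y) (z - x) * g z.

Definition brack11 f g x y := circ11 f g x y - circ11 g f x y.
Definition brack12 f G x y z := circ12 f G x y z - circ21 G f x y z.
Definition brack21 F g x y z := circ21 F g x y z - circ12 g F x y z.

(** The expressions defining gamma and Theta, with an arbitrary function b in
place of the Bernoulli series and i in place of 1/x.  The choice b := i gives the
component of lowest degree, because 1/x is the polar part of the series. *)
Definition b2_of b x y := 3^-1 * (b x * b y + b y * b (x - y)).
Definition gamma1_of b x := 2^-1 * - b x.
Definition gamma2_of b x y := 4^-1 * (- b2_of b x y + 2^-1 * circ11 b b x y).
Definition gamma3_of b x y z :=
  8^-1 * (circ21 (b2_of b) b x y z - 6^-1 * circ12 b (circ11 b b) x y z).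

Variable i : V -> K.
Definition s1_of x := 2^-1 * i x.
Definition s2_of x y := 12^-1 * (i x * i y + i y * i (x - y)).

Definition s1gamma1_of b x y := circ11 s1_of (gamma1_of b) x y.
Definition rest3_of b x y z :=
  circ21 s2_of (gamma1_of b) x y z + 2^-1 * circ12 s1_of (s1gamma1_of b) x y z.
Definition Theta2_of b x y := gamma2_of b x y + s1gamma1_of b x y.
Definition Theta3_of b x y z :=
  gamma3_of b x y z + circ12 s1_of (gamma2_of b) x y z + rest3_of b x y z.
End Insertion.

Section Tau.
Variables (V : zmodType) (K : fieldType).
Variables b i L : V -> K.

Definition uxi_neg1_of x := 12^-1 * (i x * i x).
(** With L = sum_(n >= 1) B_(2n) / (2n (2n)!) x^(2n) the sum over n that defines
the correction term C becomes one bracket in depth two and two in depth three. *)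
Definition C2_of x y := brack11 uxi_neg1_of L x y.
Definition C3_of x y z :=
  brack12 uxi_neg1_of (brack11 (s1_of i) L) x y z
  + brack21 (brack11 (s1_of i) uxi_neg1_of) L x y z.

Definition Phi1_of x := gamma1_of b x - gamma1_of i x.
Definition Phi2_of x y := Theta2_of i b x y - Theta2_of i i x y.
Definition Phi3_of x y z := Theta3_of i b x y z - Theta3_of i i x y z.

Definition tau1_of x := Phi1_of x.
Definition tau2_of x y := Phi2_of x y + C2_of x y.
Definition tau3_of x y z :=
  Phi3_of x y z + circ21 C2_of Phi1_of x y z + C3_of x y z.
End Tau.

Section Shuffle.
Variables (V : zmodType) (K : fieldType).
Hypothesis K0 : forall n, n.+1%:R != 0 :> K.

Definition sh2 (f : V -> V -> K) x y := f x (x + y) + f y (x + y).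
Definition sh3 (f : V -> V -> V -> K) x y z :=
  f x (x + y) (x + y + z) + f y (x + y) (x + y + z) + f y (y + z) (x + y + z).
Definition st2 (f : V -> V -> K) x y := f x y + f y x.
Definition st3 (f : V -> V -> V -> K) x y z :=
  f x y z + f y x z + f y z x.

(* The differences of the arguments that occur in the shuffle equations. *)
Lemma addKl (x y : V) : x + y - x = y. Proof. by rewrite addrC addKr. Qed.
Lemma subDl (x y : V) : x - (x + y) = - y.
Proof. by rewrite opprD addrA subrr add0r. Qed.
Lemma subDr (x y : V) : y - (x + y) = - x.
Proof. by rewrite (addrC x) subDl. Qed.
Lemma subDD (x y z : V) : x + y + z - (x + y) = z. Proof. exact: addKl. Qed.
Lemma subDDl (x y z : V) : x + y + z - x = y + z.
Proof. by rewrite -(addrA x) addKl. Qed.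
Lemma subDDm (x y z : V) : x + y + z - y = x + z.
Proof. by rewrite (addrC x) subDDl. Qed.
Lemma subDDr (x y z : V) : x + y + z - (y + z) = x.
Proof. by rewrite -(addrA x) addrK. Qed.
Lemma subBB (x y z : V) : x - y - (x - z) = z - y.
Proof. by rewrite opprB addrC addrA subrK addrC. Qed.
Lemma subBBr (x y z : V) : x - z - (y - z) = x - y.
Proof. by rewrite opprB addrA subrK. Qed.

Lemma subDDC x y z : x + y - (x + y + z) = - z :> V.
Proof. by rewrite -opprB subDD. Qed.
Lemma subDDlC x y z : x - (x + y + z) = - (y + z) :> V.
Proof. by rewrite -opprB subDDl. Qed.
Lemma subDDmC x y z : y - (x + y + z) = - (x + z) :> V.
Proof. by rewrite -opprB subDDm. Qed.
Lemma subDDrC x y z : y + z - (x + y + z) = - x :> V.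
Proof. by rewrite -opprB subDDr. Qed.

Definition difs (x y z : V) :=
  (subDD x y z, subDDC x y z, subDDlC x y z, subDDmC x y z, subDDrC x y z,
  subDDl x y z, subDDm x y z, subDDr x y z, addKl x y, addKl y z, addKl x z,
  addrK y x, addrK z y, addrK z x,
  subDl x y, subDl y z, subDl x z, subDr x y, subDr y z, subDr x z).

Variables b i L : V -> K.
Hypothesis b_odd : forall x, b (- x) = - b x.
Hypothesis i_odd : forall x, i (- x) = - i x.
Hypothesis L_even : forall x, L (- x) = L x.

Ltac char0 := repeat first [apply/andP; split | exact: K0].
Ltac unf := rewrite /sh3 /sh2 /st3 /st2 /Theta3_of /gamma3_of /rest3_of
  /Theta2_of /s1gamma1_of /C3_of /C2_of /brack12 /brack21 /brack11 /uxi_neg1_of /s2_of /s1_of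
  /gamma2_of /gamma1_of /circ21 /circ12 /circ11 /b2_of.

(** The shuffle equations hold identically in b, i and L: their expansions agree
monomial by monomial once the parity of the three functions is used.  The
summands of Theta with a given number of factors i have their own identity; with
two factors i it contains the product of gamma1 with the lowest degree part of
Theta2, because Phi2 is Theta2 minus that part. *)
Lemma sh2_gamma2 x1 x2 : sh2 (gamma2_of b) x1 x2 = gamma1_of b x1 * gamma1_of b x2.
Proof. by unf; rewrite !(difs x1 x2 x2) !b_odd; field; char0. Qed.

Lemma sh2_s1gamma1 x1 x2 :
  sh2 (s1gamma1_of i b) x1 x2 = gamma1_of b x1 * s1_of i x2 + s1_of i x1 * gamma1_of b x2.
Proof. by unf; rewrite !(difs x1 x2 x2); field; char0. Qed.

Lemma sh3_gamma3 x1 x2 x3 :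
  sh3 (gamma3_of b) x1 x2 x3 = gamma1_of b x1 * gamma2_of b x2 (x2 + x3).
Proof. by unf; rewrite !(difs x1 x2 x3) !b_odd; field; char0. Qed.

Lemma sh3_s1gamma2 x1 x2 x3 :
  sh3 (circ12 (s1_of i) (gamma2_of b)) x1 x2 x3 =
  gamma1_of b x1 * s1gamma1_of i b x2 (x2 + x3) + s1_of i x1 * gamma2_of b x2 (x2 + x3).
Proof. by unf; rewrite !(difs x1 x2 x3) !b_odd; field; char0. Qed.

Lemma sh3_rest3 x1 x2 x3 :
  sh3 (rest3_of i b) x1 x2 x3 =
  s1_of i x1 * s1gamma1_of i b x2 (x2 + x3) - gamma1_of b x1 * Theta2_of i i x2 (x2 + x3).
Proof. by unf; rewrite !(difs x1 x2 x3) ?b_odd ?i_odd; field; char0. Qed.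

Lemma sh2_C2 x1 x2 : sh2 (C2_of i L) x1 x2 = 0.
Proof. by unf; rewrite !(difs x1 x2 x2) ?L_even ?i_odd; field; char0. Qed.

Lemma sh3_C2_circ x1 x2 x3 :
  sh3 (circ21 (C2_of i L) b) x1 x2 x3 = b x1 * C2_of i L x2 (x2 + x3).
Proof. by unf; rewrite !(difs x1 x2 x3) ?L_even ?i_odd; field; char0. Qed.

(** Jacobi identity for the bracket of q = x^(-2) / 12, s1 and L: the depth three
part {q, {s1, L}} + {{s1, q}, L} of the correction is {s1, {q, L}}. *)
Lemma C3E x1 x2 x3 : C3_of i L x1 x2 x3 = brack12 (s1_of i) (C2_of i L) x1 x2 x3.
Proof.
unf; rewrite !subBB !subBBr -!(opprB x1) -!(opprB x2) ?L_even ?i_odd.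
by field; char0.
Qed.

Lemma sh3_C3 x1 x2 x3 : sh3 (C3_of i L) x1 x2 x3 = 0.
Proof.
by rewrite /sh3 !C3E; unf; rewrite !(difs x1 x2 x3) ?L_even ?i_odd; field; char0.
Qed.

Section Stuffle.
(** For the stuffle equations parity is not enough: they follow from the addition
formula of b, with the constant kappa = 1/4 for the Bernoulli series and
kappa = 0 for 1/x.  The constant is what forces the corrections in depths two and
three. *)
Variable kappa : K.
Variables (x y z : V).
Hypothesis b_add : forall x y : V, x != 0 -> y != 0 -> x - y != 0 ->
  b x * (b y + b (x - y)) = b y * b (x - y) + kappa.
Hypothesis i_add : forall x y : V, x != 0 -> y != 0 -> x - y != 0 ->
  i x * (i y + i (x - y)) = i y * i (x - y).

Definition quot2 (f : V -> K) x y := (f x - f y) * i (y - x).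
Definition quot3 (f : V -> V -> K) x y z :=
  (f y x - f y z) * i (z - x) + (f x z - f y z) * i (y - x).
Hypotheses (x0 : x != 0) (y0 : y != 0) (z0 : z != 0)
  (xy : x - y != 0) (xz : x - z != 0) (yz : y - z != 0).

Let Bxy := b_add x0 y0 xy.
Let Bxz := b_add x0 z0 xz.
Let Ixy := i_add x0 y0 xy.
Let Ixyz : i (x - z) * (i (x - y) + i (y - z)) = i (x - y) * i (y - z).
Proof. by have := i_add xz xy; rewrite subBB; apply. Qed.

(** An identity that holds modulo a relation l = r: the difference of its sides
is a multiple of l - r, and the multiplier m makes the remaining claim a free
polynomial identity. *)
Let modulo (p q m l r : K) : p - q = m * (l - r) -> l = r -> p = q.
Proof. by move=> E lr; move: E; rewrite lr subrr mulr0 => /subr0_eq. Qed.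

Ltac norm :=
  rewrite ?subBB ?subBBr -?(opprB x) -?(opprB y z) ?b_odd ?i_odd ?L_even.

Lemma st2_gamma2 :
  st2 (gamma2_of b) x y + kappa / 6 = gamma1_of b x * gamma1_of b y.
Proof.
by unf; norm; apply: (modulo (m := - 6^-1)) Bxy; field; char0.
Qed.

Lemma st2_s1gamma1 : st2 (s1gamma1_of i b) x y =
   gamma1_of b x * s1_of i y + s1_of i x * gamma1_of b y + quot2 (gamma1_of b) x y.
Proof. by rewrite /quot2; unf; norm; field; char0. Qed.

(** The term b x + 2 b y is the stuffle sum of the function b of the first
argument alone; together with the opposite term in i of the next identity it
becomes the correction by b x - 1/x in depth three. *)
Lemma st3_gamma3 : st3 (gamma3_of b) x y z - kappa / 24 * (b x + 2 * b y)
  = gamma1_of b x * (gamma2_of b y z + kappa / 12).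
Proof.
by unf; norm; apply: (modulo (m := 12^-1 * b y)) Bxz; field; char0.
Qed.

Lemma st3_s1gamma2 :
  st3 (circ12 (s1_of i) (gamma2_of b)) x y z + kappa / 24 * (i x + 2 * i y) =
  gamma1_of b x * s1gamma1_of i b y z + s1_of i x * (gamma2_of b y z + kappa / 12)
  + quot3 (gamma2_of b) x y z.
Proof.
rewrite /quot3; unf; norm.
(* The products b x * b (x - y) and b x * b (x - z) are eliminated with the
   addition formulas at (x, y) and (x, z), multiplied by their coefficients. *)
have E : i (y - z) * (b x * (b y + b (x - y)))
  - (i y + i (y - z)) * (b x * (b z + b (x - z))) =
   i (y - z) * (b y * b (x - y) + kappa)
  - (i y + i (y - z)) * (b z * b (x - z) + kappa).
  by rewrite Bxy Bxz.
by apply: (modulo (m := 12^-1)) E; field; char0.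
Qed.

Lemma st3_rest3 :
  st3 (rest3_of i b) x y z = s1_of i x * s1gamma1_of i b y z
  - gamma1_of b x * Theta2_of i i y z + quot3 (s1gamma1_of i b) x y z.
Proof.
rewrite /quot3; unf; norm.
(* Linear in b: here only the addition formula of 1/x enters. *)
have E : - b z * (i x * (i y + i (x - y)))
  + (2 * b x - b y - b z) * (i (x - z) * (i (x - y) + i (y - z)))
  = - b z * (i y * i (x - y))
  + (2 * b x - b y - b z) * (i (x - y) * i (y - z)).
  by rewrite Ixy Ixyz.
by apply: (modulo (m := 12^-1)) E; field; char0.
Qed.

Lemma st2_C2 : st2 (C2_of i L) x y = 0.
Proof. by unf; norm; field; char0. Qed.
Lemma st3_C2_circ : st3 (circ21 (C2_of i L) b) x y z = b x * C2_of i L y z.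
Proof. by unf; norm; field; char0. Qed.
Lemma st3_C3 : st3 (C3_of i L) x y z = quot3 (C2_of i L) x y z.
Proof. by rewrite /st3 !C3E /quot3; unf; norm; field; char0. Qed.

End Stuffle.

End Shuffle.

Lemma Phi1E (V : zmodType) (K : fieldType) (b i : V -> K) u :
  Phi1_of b i u = 2^-1 * - (b u - i u).
Proof. by rewrite /Phi1_of /gamma1_of opprB !mulrN mulrBr opprK addrC. Qed.

Section DoubleShuffle.
Variables (V : zmodType) (K : fieldType).
Hypothesis K0 : forall n, n.+1%:R != 0 :> K.
Variables b i L : V -> K.
Hypothesis b_odd : forall x, b (- x) = - b x.
Hypothesis i_odd : forall x, i (- x) = - i x.
Hypothesis L_even : forall x, L (- x) = L x.

Let gamma1_inv x : gamma1_of i x = - s1_of i x.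
Proof. by rewrite /gamma1_of mulrN. Qed.

(** Summing the identities of the summands: Phi is Theta minus the same formula
with b := i, and gamma1 = - s1 for the latter, which makes the mixed products on the
right recombine into products of tau. *)
Lemma sh2_tau x y : sh2 (tau2_of b i L) x y = tau1_of b i x * tau1_of b i y.
Proof.
transitivity (sh2 (gamma2_of b) x y + sh2 (s1gamma1_of i b) x y
  - (sh2 (gamma2_of i) x y + sh2 (s1gamma1_of i i) x y) + sh2 (C2_of i L) x y).
  by rewrite /sh2 /tau2_of /Phi2_of /Theta2_of; ring.
rewrite !sh2_gamma2 // !sh2_s1gamma1 // sh2_C2 // /tau1_of /Phi1_of !gamma1_inv; ring.
Qed.

Lemma sh3_tau x y z :
  sh3 (tau3_of b i L) x y z = tau1_of b i x * tau2_of b i L y (y + z).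
Proof.
transitivity (
  (sh3 (gamma3_of b) x y z + sh3 (circ12 (s1_of i) (gamma2_of b)) x y z
     + sh3 (rest3_of i b) x y z)
  - (sh3 (gamma3_of i) x y z + sh3 (circ12 (s1_of i) (gamma2_of i)) x y z
     + sh3 (rest3_of i i) x y z)
  + sh3 (circ21 (C2_of i L) (Phi1_of b i)) x y z + sh3 (C3_of i L) x y z).
  by rewrite /sh3 /tau3_of /Phi3_of /Theta3_of; ring.
rewrite !sh3_gamma3 // !sh3_s1gamma2 // !sh3_rest3 // sh3_C2_circ // sh3_C3 //.
rewrite /tau1_of /tau2_of /Phi1_of /Phi2_of /Theta2_of !gamma1_inv; ring.
Qed.

Section Stuffle.
Variable kappa : K.
Variables (x y z : V).
Hypothesis b_add : forall x y : V, x != 0 -> y != 0 -> x - y != 0 ->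
  b x * (b y + b (x - y)) = b y * b (x - y) + kappa.
Hypothesis i_add : forall x y : V, x != 0 -> y != 0 -> x - y != 0 ->
  i x * (i y + i (x - y)) = i y * i (x - y).
Hypotheses (x0 : x != 0) (y0 : y != 0) (z0 : z != 0)
  (xy : x - y != 0) (xz : x - z != 0) (yz : y - z != 0).

Let i_add0 (u v : V) : u != 0 -> v != 0 -> u - v != 0 ->
  i u * (i v + i (u - v)) = i v * i (u - v) + 0.
Proof. by rewrite addr0; apply: i_add. Qed.

Definition tau2s_of x y := tau2_of b i L x y + kappa / 12.
Definition tau3s_of x y z := tau3_of b i L x y z - kappa / 24 * (b x - i x).

(** The stuffle sums of tau itself, needed to see that they are power series. *)
Lemma st2_tau2E : tau2_of b i L x y + tau2_of b i L y x =
  st2 tau2s_of x y - (kappa / 12 + kappa / 12).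
Proof. by rewrite /st2 /tau2s_of; ring. Qed.

Lemma st3_tau3E : tau3_of b i L x y z + tau3_of b i L y x z + tau3_of b i L y z x =
  st3 tau3s_of x y z + kappa / 24 * ((b x - i x) + (b y - i y) + (b y - i y)).
Proof. by rewrite /st3 /tau3s_of; ring. Qed.

Lemma st2_tau : st2 tau2s_of x y = quot2 i (tau1_of b i) x y + tau1_of b i x * tau1_of b i y.
Proof.
transitivity (
  (st2 (gamma2_of b) x y + kappa / 6) + st2 (s1gamma1_of i b) x y
  - ((st2 (gamma2_of i) x y + 0 / 6) + st2 (s1gamma1_of i i) x y) + st2 (C2_of i L) x y).
  by rewrite /st2 /tau2s_of /tau2_of /Phi2_of /Theta2_of; field; rewrite !K0.
rewrite (st2_gamma2 K0 b_odd (kappa := kappa)) // (st2_gamma2 K0 i_odd (kappa := 0)) //.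
rewrite !(st2_s1gamma1 K0 _ i_odd) // st2_C2 // /tau1_of /quot2 /Phi1_of !gamma1_inv; ring.
Qed.

Lemma st3_tau :
  st3 tau3s_of x y z = quot3 i tau2s_of x y z + tau1_of b i x * tau2s_of y z.
Proof.
transitivity (
  (st3 (gamma3_of b) x y z - kappa / 24 * (b x + 2 * b y))
  + (st3 (circ12 (s1_of i) (gamma2_of b)) x y z + kappa / 24 * (i x + 2 * i y))
  + st3 (rest3_of i b) x y z
  - ((st3 (gamma3_of i) x y z - 0 / 24 * (i x + 2 * i y))
  + (st3 (circ12 (s1_of i) (gamma2_of i)) x y z + 0 / 24 * (i x + 2 * i y))
  + st3 (rest3_of i i) x y z)
  + st3 (circ21 (C2_of i L) (Phi1_of b i)) x y z + st3 (C3_of i L) x y z).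
  by rewrite /st3 /tau3s_of /tau3_of /Phi3_of /Theta3_of; field; rewrite !K0.
rewrite (st3_gamma3 K0 b_odd (kappa := kappa)) // (st3_gamma3 K0 i_odd (kappa := 0)) //.
rewrite (st3_s1gamma2 K0 b_odd i_odd (kappa := kappa)) //.
rewrite (st3_s1gamma2 K0 i_odd i_odd (kappa := 0)) //.
rewrite !(st3_rest3 K0 _ i_odd) //.
rewrite st3_C2_circ // st3_C3 //.
rewrite /tau2s_of /tau1_of /tau2_of /quot3 /Phi1_of /Phi2_of /Theta2_of !gamma1_inv.
by field; rewrite !K0.
Qed.
End Stuffle.
End DoubleShuffle.

(** * The field of formal sums of bounded below degree *)
Section Convolution.
Variable F : fieldType.
Implicit Types (f g h : int -> F) (A B C : int).

(** The product of formal sums of homogeneous terms is the convolution of their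
coefficients over all degrees; it is a commutative ring structure only on sums
of bounded below degree.  The ring axioms are read off from polynomials: shifted
to start in degree 0 and truncated, such a sum is a polynomial, and its product
with another one is the truncated product of polynomials. *)
Definition conv f g : int -> F :=
  fun d => \sum_(e \in [set: int]%classic) f e * g (d - e).
Definition vanishes_below A f := forall d, d < A -> f d = 0.
Definition jet A (K : nat) f : {poly F} := \poly_(i < K) f (A + i%:Z).

Lemma vanishes_below_le A B f :
  B <= A -> vanishes_below A f -> vanishes_below B f.
Proof. by move=> BA fA d dB; apply: fA; apply: lt_le_trans BA. Qed.

Lemma fsum_int A (K : nat) f :
  (forall e, e < A -> f e = 0) -> (forall e, A + K%:Z <= e -> f e = 0) ->
  \sum_(e \in [set: int]%classic) f e = \sum_(k < K) f (A + k%:Z).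
Proof.
move=> lo hi.
rewrite (fsbigE [seq A + k%:Z | k <- iota 0 K]) //=; first last.
- move=> e _ /mapP e_out; case: (ltP e A) => [/lo //|Ae].
  case: (leP (A + K%:Z) e) => [/hi //|eK]; case: e_out.
  by exists (absz (e - A)); rewrite ?mem_iota; lia.
- by rewrite map_inj_uniq ?iota_uniq // => j k /addrI [].
rewrite big_map -(big_mkord xpredT (fun k => f (A + k%:Z))) /index_iota subn0.
by apply: eq_bigl => k; rewrite in_setT.
Qed.

Lemma conv_sum A B (K : nat) f g d :
  vanishes_below A f -> vanishes_below B g -> d - A - B < K%:Z ->
  conv f g d = \sum_(k < K) f (A + k%:Z) * g (d - (A + k%:Z)).
Proof.
move=> fA gB dK; rewrite /conv; apply: fsum_int => e eA.
  by rewrite fA ?mul0r.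
by rewrite gB ?mulr0 //; lia.
Qed.

Lemma conv_jet A B (K m : nat) f g :
  vanishes_below A f -> vanishes_below B g -> (m < K)%N ->
  conv f g (A + B + m%:Z) = (jet A K f * jet B K g)`_m.
Proof.
move=> fA gB mK; rewrite (@conv_sum A B m.+1) //; last by lia.
rewrite coefM; apply: eq_bigr => k _; rewrite !coef_poly.
rewrite (leq_trans _ mK) ?ltn_ord // (leq_ltn_trans _ mK) ?leq_subr //.
by congr (_ * g _); have := ltn_ord k; lia.
Qed.

Lemma conv_below A B f g :
  vanishes_below A f -> vanishes_below B g -> vanishes_below (A + B) (conv f g).
Proof.
by move=> fA gB d dAB; rewrite (@conv_sum A B 0) ?big_ord0 //; lia.
Qed.

Lemma below_ext A f g : vanishes_below A f -> vanishes_below A g ->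
  (forall m : nat, f (A + m%:Z) = g (A + m%:Z)) -> f = g.
Proof.
move=> fA gA fg; apply/funext => d; case: (ltP d A) => [dA|Ad].
  by rewrite fA ?gA.
by have -> : d = A + (absz (d - A))%:Z by lia.
Qed.

Lemma convC A B f g : vanishes_below A f -> vanishes_below B g ->
  conv f g = conv g f.
Proof.
move=> fA gB; apply: (@below_ext (A + B)); [exact: conv_below| |].
  by rewrite addrC; apply: conv_below.
move=> m; rewrite (conv_jet fA gB (ltnSn m)) mulrC (addrC A).
by rewrite (conv_jet gB fA (ltnSn m)).
Qed.

Lemma jet_conv A B K f g : vanishes_below A f -> vanishes_below B g ->
  jet (A + B) K (conv f g) = \poly_(i < K) (jet A K f * jet B K g)`_i.
Proof.
move=> fA gB; apply/polyP => i; rewrite !coef_poly.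
by case: ifP => // iK; rewrite -(conv_jet fA gB iK).
Qed.

Lemma coefM_trunc (p q : {poly F}) K i : (i < K)%N ->
  ((\poly_(j < K) p`_j) * q)`_i = (p * q)`_i.
Proof.
move=> iK; rewrite !coefM; apply: eq_bigr => k _; rewrite coef_poly.
by rewrite (leq_trans _ iK) ?ltn_ord.
Qed.

Lemma convA A B C f g h :
  vanishes_below A f -> vanishes_below B g -> vanishes_below C h ->
  conv f (conv g h) = conv (conv f g) h.
Proof.
move=> fA gB hC; have fg := conv_below fA gB; have gh := conv_below gB hC.
apply: (@below_ext (A + B + C)); [|exact: conv_below|].
  by rewrite -addrA; apply: conv_below.
move=> m.
transitivity ((jet A m.+1 f * jet B m.+1 g * jet C m.+1 h)`_m).
  have -> : A + B + C + m%:Z = A + (B + C) + m%:Z by rewrite !addrA.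
  rewrite (conv_jet fA gh (ltnSn m)) jet_conv // mulrC coefM_trunc //.
  by rewrite mulrC mulrA.
by rewrite (conv_jet fg hC (ltnSn m)) jet_conv // coefM_trunc.
Qed.

Lemma convDl A B f f' g :
  vanishes_below A f -> vanishes_below A f' -> vanishes_below B g ->
  conv (f \+ f') g = conv f g \+ conv f' g.
Proof.
move=> fA f'A gB; apply/funext => d /=.
have ff' : vanishes_below A (f \+ f') by move=> e eA /=; rewrite fA ?f'A ?addr0.
rewrite !(@conv_sum A B (absz (d - A - B)%R).+1) //; try lia.
by rewrite -big_split; apply: eq_bigr => k _; rewrite mulrDl.
Qed.

Definition pure (a : int) (c : F) : int -> F := fun e => if e == a then c else 0.

Lemma pure_below a c : vanishes_below a (pure a c).
Proof. by move=> d da; rewrite /pure lt_eqF. Qed.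

Lemma conv_pure a c f d : conv (pure a c) f d = c * f (d - a).
Proof.
rewrite /conv (@fsum_int a 1) ?big_ord1 ?addr0 /pure ?eqxx // => e ea.
  by rewrite lt_eqF ?mul0r.
by rewrite gt_eqF ?mul0r //; lia.
Qed.

Fixpoint recip_seq (a : nat -> F) (n : nat) : seq F :=
  if n is m.+1 then
    let c := recip_seq a m in
    rcons c (((m == 0)%N%:R - \sum_(k < m) c`_k * a (m - k)%N) / a 0%N)
  else [::].

Lemma recip (a : nat -> F) : a 0%N != 0 -> exists c : nat -> F,
  forall n, \sum_(k < n.+1) c k * a (n - k)%N = (n == 0)%N%:R.
Proof.
move=> a0; exists (fun n => (recip_seq a n.+1)`_n) => n.
have sz m : size (recip_seq a m) = m by elim: m => //= m IHm; rewrite size_rcons IHm.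
have nthE m k : (k < m)%N -> (recip_seq a m)`_k = (recip_seq a k.+1)`_k.
  elim: m => // m IHm; rewrite ltnS leq_eqVlt => /predU1P[-> //|km].
  by rewrite [LHS]nth_rcons sz km IHm.
rewrite big_ord_recr /= subnn nth_rcons sz ltnn eqxx divfK // addrC -[RHS]addr0.
rewrite -addrA; congr (_ + _); apply/eqP; rewrite addrC subr_eq0; apply/eqP.
by apply: eq_bigr => k _; rewrite -(nthE n) ?ltn_ord.
Qed.
End Convolution.

(** A formal sum of bounded below degree, with coefficients in a field: a Laurent
series in a parameter t that records the degree.  The reason for the bundled type
is that it is a field, so that identities between the functions of the theorem
are proved by normalisation of rational expressions. *)
Record laurent (F : fieldType) := Laurent {
  lcoef :> int -> F; _ : exists A, vanishes_below A lcoef }.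

Section LaurentField.
Variable F : fieldType.
Local Notation lau := (laurent F).

HB.instance Definition _ := gen_eqMixin lau.
HB.instance Definition _ := gen_choiceMixin lau.

Lemma laurentP (f g : lau) : (forall d, f d = g d) -> f = g.
Proof.
case: f g => f fA [g gA] /= /funext fg; rewrite fg in fA *.
by congr Laurent; exact: Prop_irrelevance.
Qed.

Lemma below (f : lau) : exists A, vanishes_below A f.
Proof. by case: f. Qed.

Lemma common_below (f g : lau) :
  exists A, vanishes_below A f /\ vanishes_below A g.
Proof.
have [[A fA] [B gB]] := (below f, below g); exists (Order.min A B).
by split; [move: fA|move: gB]; apply: vanishes_below_le; lia.
Qed.

Fact zero_below : exists A, vanishes_below A (fun=> 0 : F).
Proof. by exists 0. Qed.
Fact add_below (f g : lau) : exists A, vanishes_below A (fun d => f d + g d).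
Proof.
have [A [fA gA]] := common_below f g.
by exists A => d dA; rewrite fA ?gA ?addr0.
Qed.
Fact opp_below (f : lau) : exists A, vanishes_below A (fun d => - f d).
Proof. by have [A fA] := below f; exists A => d dA; rewrite fA ?oppr0. Qed.
Fact mul_below (f g : lau) : exists A, vanishes_below A (conv f g).
Proof.
have [[A fA] [B gB]] := (below f, below g).
by exists (A + B); apply: conv_below.
Qed.

Definition lpure a c : lau := Laurent (ex_intro _ a (@pure_below F a c)).
Definition lzero : lau := Laurent zero_below.
Definition ladd (f g : lau) : lau := Laurent (add_below f g).
Definition lopp (f : lau) : lau := Laurent (opp_below f).
Definition lmul (f g : lau) : lau := Laurent (mul_below f g).

Fact laddA : associative ladd.
Proof. by move=> f g h; apply: laurentP => d /=; rewrite addrA. Qed.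
Fact laddC : commutative ladd.
Proof. by move=> f g; apply: laurentP => d /=; rewrite addrC. Qed.
Fact ladd0 : left_id lzero ladd.
Proof. by move=> f; apply: laurentP => d /=; rewrite add0r. Qed.
Fact laddN : left_inverse lzero lopp ladd.
Proof. by move=> f; apply: laurentP => d /=; rewrite addNr. Qed.

HB.instance Definition _ :=
  GRing.isZmodule.Build lau laddA laddC ladd0 laddN.

Fact lmulA : associative lmul.
Proof.
move=> f g h; apply: laurentP => d /=.
have [[A fA] [[B gB] [C hC]]] := (below f, (below g, below h)).
by rewrite (convA fA gB hC).
Qed.
Fact lmulC : commutative lmul.
Proof.
move=> f g; apply: laurentP => d /=.
by have [[A fA] [B gB]] := (below f, below g); rewrite (convC fA gB).
Qed.
Fact lmul1 : left_id (lpure 0 1) lmul.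
Proof. by move=> f; apply: laurentP => d /=; rewrite conv_pure mul1r subr0. Qed.
Fact lmulDl : left_distributive lmul ladd.
Proof.
move=> f g h; apply: laurentP => d /=.
have [A [fA gA]] := common_below f g; have [B hB] := below h.
exact: (congr1 (@^~ d) (convDl fA gA hB)).
Qed.
Fact lone_neq0 : lpure 0 1 != 0.
Proof.
by apply/eqP => /(congr1 (fun f : lau => f 0)) /= /eqP; rewrite /pure oner_eq0.
Qed.

HB.instance Definition _ :=
  GRing.Zmodule_isComNzRing.Build lau lmulA lmulC lmul1 lmulDl lone_neq0.

Lemma lcoefD (f g : lau) d : (f + g) d = f d + g d. Proof. by []. Qed.
Lemma lcoefN (f : lau) d : (- f) d = - f d. Proof. by []. Qed.
Lemma lcoefM (f g : lau) d : (f * g) d = conv f g d. Proof. by []. Qed.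
Lemma lcoef_sum I (r : seq I) P (f : I -> lau) d :
  (\sum_(i <- r | P i) f i) d = \sum_(i <- r | P i) f i d.
Proof. by elim/big_rec2: _ => // i x y _ <-. Qed.

Lemma lpureM a b c e : lpure a c * lpure b e = lpure (a + b) (c * e).
Proof.
apply: laurentP => d; rewrite lcoefM conv_pure /= /pure.
by rewrite subr_eq (addrC b); case: ifP => //; rewrite mulr0.
Qed.

Lemma low_term (f : lau) : f != 0 -> exists A, vanishes_below A f /\ f A != 0.
Proof.
move=> f0; have [A fA] := below f.
have: exists n : nat, f (A + n%:Z) != 0.
  apply: contra_notP (negP f0) => f00; apply/eqP/laurentP => d.
  apply: (congr1 (@^~ d) (below_ext fA (g := fun=> 0) _ _)) => // m.
  by apply/eqP/negPn/negP => fm; apply: f00; exists m.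
move=> exn; have [m fm minm] := ex_minnP exn.
exists (A + m%:Z); split=> // d dm; case: (ltP d A) => [/fA //|Ad].
apply/eqP/negPn/negP => fd; have := minm (absz (d - A)).
have -> : A + (absz (d - A))%:Z = d by lia.
by move=> /(_ fd); lia.
Qed.

(** The inverse of c t^A (1 + ...) starts in degree -A, and its coefficients are
found recursively. *)
Lemma linv_exists (f : lau) : exists g, (f != 0 -> g * f = 1) /\ (f = 0 -> g = 0).
Proof.
have [->|f0] := eqVneq f 0; first by exists 0.
have [A [fA fA0]] := low_term f0.
pose a n := f (A + n%:Z); have [|c cP] := @recip F a; first by rewrite /a addr0.
pose g d := if d + A is Posz n then c n else 0.
have gA : vanishes_below (- A) g.
  by rewrite /g => d dA; case E: (d + A) => [n|n] //; lia.
exists (Laurent (ex_intro _ (- A) gA)); split=> [_|/eqP]; last by rewrite (negPf f0).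
apply: laurentP => d; rewrite lcoefM /=.
have cg : vanishes_below (- A + A) (conv g f) := conv_below gA fA.
have p1 : vanishes_below (- A + A) (pure 0 (1 : F)).
  by rewrite addNr; apply: pure_below.
apply: (congr1 (@^~ d) (below_ext cg p1 _)) => m.
rewrite addNr add0r (@conv_sum _ (- A) A m.+1) //; last by lia.
rewrite /pure -[RHS]/(if (m == 0)%N then 1 else 0).
transitivity ((m == 0)%N%:R : F); last by case: eqP.
rewrite -cP; apply: eq_bigr => k _; congr (_ * _).
  by rewrite /g addrAC addNr add0r.
by rewrite /a; congr (f _); have := ltn_ord k; lia.
Qed.

Definition linv (f : lau) : lau := projT1 (cid (linv_exists f)).
Fact lmulVf (f : lau) : f != 0 -> linv f * f = 1.
Proof. by move=> f0; have [/(_ f0)] := projT2 (cid (linv_exists f)). Qed.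
Fact linv0 : linv 0 = 0.
Proof. by have [_] := projT2 (cid (linv_exists 0)); apply. Qed.

HB.instance Definition _ := GRing.ComNzRing_isField.Build lau lmulVf linv0.

Definition lconst (c : F) : lau := lpure 0 c.
Fact lconst_additive : zmod_morphism lconst.
Proof.
move=> c e; apply: laurentP => d; rewrite lcoefD lcoefN /= /pure.
by case: ifP; rewrite ?subr0.
Qed.
Fact lconst_multiplicative : monoid_morphism lconst.
Proof. by split=> // c e; rewrite /lconst lpureM. Qed.
HB.instance Definition _ := GRing.isZmodMorphism.Build F lau lconst lconst_additive.
HB.instance Definition _ :=
  GRing.isMonoidMorphism.Build F lau lconst lconst_multiplicative.

Lemma lconstV c : lconst c^-1 = (lconst c)^-1.
Proof. exact: fmorphV. Qed.
Lemma lconst_nat k : lconst k%:R = k%:R.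
Proof. exact: rmorph_nat. Qed.

End LaurentField.

Section Lead.
Variable F : fieldType.
Local Notation K := (laurent F).
(** g is the part of f in degree N, and f has no terms of lower degree.  This is
how the component that is removed from Theta is computed: taking the lowest part
is compatible with sums and products. *)
Definition lead N (f g : K) := vanishes_below N f /\ g = lpure N (f N).

Lemma leadD N f g f' g' : lead N f g -> lead N f' g' -> lead N (f + f') (g + g').
Proof.
move=> [fN ->] [fN' ->]; split=> [d dN|]; first by rewrite lcoefD fN ?fN' ?addr0.
by apply: laurentP => d; rewrite !lcoefD /= /pure; case: eqP; rewrite ?addr0.
Qed.

Lemma leadM N M f g f' g' :
  lead N f g -> lead M f' g' -> lead (N + M) (f * f') (g * g').
Proof.
move=> [fN ->] [fM ->]; split; first exact: conv_below.
rewrite lpureM lcoefM (@conv_sum _ N M 1) // ?big_ord1 ?addr0 //; last by lia.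
by rewrite addrAC subrr add0r.
Qed.

Lemma leadC c N f g : lead N f g -> lead N (lconst c * f) (lconst c * g).
Proof.
move=> [fN ->]; split=> [d dN|]; rewrite ?lpureM ?lcoefM conv_pure subr0.
  by rewrite fN ?mulr0.
by rewrite add0r.
Qed.

Lemma leadN N f g : lead N f g -> lead N (- f) (- g).
Proof. by move=> /(leadC (-1)); rewrite !rmorphN1 !mulN1r. Qed.
Lemma leadB N f g f' g' : lead N f g -> lead N f' g' -> lead N (f - f') (g - g').
Proof. by move=> a /leadN; apply: leadD. Qed.

Lemma leadV k N f g : lead N f g -> lead N (k%:R^-1 * f) (k%:R^-1 * g).
Proof.
have -> : k%:R^-1 = lconst (k%:R^-1 : F) :> K by rewrite lconstV lconst_nat.
exact: leadC.
Qed.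
End Lead.

(** * The Bernoulli series and its even primitive *)
Section Coefficients.
Definition npower (a : nat -> rat) (d : int) : rat :=
  if d is Posz k then a k else 0.
Fact npower_below a : exists A, vanishes_below A (npower a).
Proof. by exists 0 => -[]. Qed.
Definition power_coefs a : laurent rat := Laurent (npower_below a).
Definition exp_coefs := power_coefs (fun k => k`!%:R^-1).
Definition bern_coefs : laurent rat := lpure (-1) 1 * power_coefs bcoef.
Definition b_coefs : laurent rat := bern_coefs + lconst 2^-1.

Lemma bern_coefsE d : bern_coefs d = if d + 1 is Posz k then bcoef k else 0.
Proof. by rewrite /bern_coefs lcoefM conv_pure mul1r opprK. Qed.
(** The primitive of b(x) - 1/x, that is log (sinh (x/2) / (x/2)).  Its coefficients
B_(2n) / (2n (2n)!) are the weights of the sum defining C, and the relation of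
its derivative to b is what cancels the last poles of tau. *)
Definition log_coefs :=
  power_coefs (fun k => if k is j.+1 then b_coefs j%:Z / k%:R else 0).
End Coefficients.

Section Series.
Variables (F : fieldType) (rho : {rmorphism rat -> F}).
Local Notation K := (laurent F).

(** [ser c l] is the series with coefficients c at the point l; the degree is that
in l, so that the term of degree d is c_d l^d. *)
Fact ser_below (c : laurent rat) (l : F) :
  exists A, vanishes_below A (fun d => rho (c d) * l ^ d).
Proof.
by have [A cA] := below c; exists A => d dA; rewrite cA // rmorph0 mul0r.
Qed.
Definition ser c l : K := Laurent (ser_below c l).

Lemma serE c l d : ser c l d = rho (c d) * l ^ d. Proof. by []. Qed.

Lemma serD c c' l : ser (c + c') l = ser c l + ser c' l.
Proof. by apply: laurentP => d /=; rewrite rmorphD mulrDl. Qed.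

Lemma ser_const q l : ser (lconst q) l = lconst (rho q).
Proof.
apply: laurentP => d /=; rewrite /pure; case: eqP => [->|_].
  by rewrite mulr1.
by rewrite rmorph0 mul0r.
Qed.

Lemma char0 k : k.+1%:R != 0 :> F.
Proof. by rewrite -(rmorph_nat rho) fmorph_eq0 pnatr_eq0. Qed.

Lemma lchar0 k : k.+1%:R != 0 :> K.
Proof. by rewrite -lconst_nat fmorph_eq0 char0. Qed.

Lemma const48 : 48^-1 = 4^-1 / 12 :> K. Proof. by field; rewrite !lchar0. Qed.
Lemma const96 : 96^-1 = 4^-1 / 24 :> K. Proof. by field; rewrite !lchar0. Qed.

Lemma below0_power a l : vanishes_below 0 (ser (power_coefs a) l).
Proof. by move=> [k|k] // _; rewrite /= rmorph0 mul0r. Qed.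

Lemma exp_ser_add x y : ser exp_coefs (x + y) = ser exp_coefs x * ser exp_coefs y.
Proof.
apply: laurentP => d; apply: (congr1 (@^~ d) (@below_ext _ 0 _ _ _ _ _)).
- exact: below0_power.
- by rewrite -[0]addr0; apply: conv_below; apply: below0_power.
move=> m; rewrite add0r lcoefM.
rewrite (@conv_sum _ 0 0 m.+1 _ _ m%:Z (below0_power _ _) (below0_power _ _)) //; last by lia.
rewrite /= -[_ ^ m%:Z]/(_ ^+ m) (addrC x) exprDn mulr_sumr; apply: eq_bigr => i _.
have im : (i <= m)%N by rewrite -ltnS ltn_ord.
rewrite -[(_ * _) *+ _]mulr_natl.
have key : rho m`!%:R^-1 * 'C(m, i)%:R = rho i`!%:R^-1 * rho (m - i)`!%:R^-1.
  rewrite -(rmorph_nat rho) -!rmorphM; congr (rho _).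
  have f0 k : k`!%:R != 0 :> rat by rewrite pnatr_eq0 -lt0n fact_gt0.
  rewrite -(bin_fact im) !natrM; field.
  by rewrite !f0 pnatr_eq0 -lt0n bin_gt0 im.
rewrite [LHS]mulrA key add0r; have -> : m%:Z - i%:Z = (m - i)%N%:Z by lia.
rewrite /= -[x ^ i%:Z]/(x ^+ i) -[y ^ _]/(y ^+ (m - i)).
by move: (x ^+ i) (y ^+ _) (rho _) (rho _) => a b c e; ring.
Qed.

(** The recursion for the Bernoulli coefficients says that their generating series
times (e^x - 1) / x is 1. *)
Lemma bern_exp l : l != 0 ->
  ser bern_coefs l * (ser exp_coefs l - 1) = 1.
Proof.
move=> l0; apply: laurentP => d.
have b1 : vanishes_below (-1) (ser bern_coefs l).
  move=> e e1; rewrite serE bern_coefsE.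
  by case E: (e + 1) => [k|k]; [lia|rewrite rmorph0 mul0r].
have e1 : vanishes_below 1 (ser exp_coefs l - 1).
  move=> e e1; rewrite lcoefD lcoefN /= /pure.
  case: e e1 => [[|k]|k] //= _; last by rewrite rmorph0 mul0r subr0.
  by rewrite invr1 rmorph1 mul1r subrr.
apply: (congr1 (@^~ d) (@below_ext _ 0 _ _ _ _ _)).
- by rewrite -[0](addNr 1); apply: conv_below.
- exact: pure_below.
move=> m; rewrite add0r lcoefM (conv_sum (K := m.+1) b1 e1); last by lia.
transitivity (rho (m == 0)%N%:R * l ^ m).
  rewrite -(@psinvP (fun k => (k.+1`!%:R)^-1)); last by rewrite invr1 oner_eq0.
  rewrite rmorph_sum mulr_suml; apply: eq_bigr => i _.
  have im : (i <= m)%N by rewrite -ltnS ltn_ord.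
  rewrite serE bern_coefsE addrAC addNr add0r rmorphM -/bcoef.
  have -> : m%:Z - (-1 + i%:Z) = (m - i).+1%:Z by lia.
  rewrite lcoefD lcoefN /= /pure subr0 mulrACA; congr (_ * _).
  by rewrite -expfzDr //; congr (_ ^ _); lia.
rewrite /= /pure; case: m => [|m]; first by rewrite rmorph1 mulr1.
by rewrite rmorph0 mul0r.
Qed.

Definition bser l := ser b_coefs l.

Lemma exp_ser_neq1 l : l != 0 -> ser exp_coefs l - 1 != 0.
Proof.
move=> /bern_exp; apply: contra_eqN => /eqP ->.
by rewrite mulr0 eq_sym oner_eq0.
Qed.

Lemma bserE l : l != 0 -> bser l = (ser exp_coefs l - 1)^-1 + 2^-1.
Proof.
move=> l0; rewrite /bser serD ser_const; congr (_ + _).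
  apply: (mulIf (exp_ser_neq1 l0)); rewrite bern_exp // mulVf //.
  exact: exp_ser_neq1.
by rewrite fmorphV rmorph_nat lconstV lconst_nat.
Qed.

(** Addition formula of (coth (x/2)) / 2.  Both sides are the same rational
function of e^y and e^(x - y). *)
Lemma bser_add x y : x != 0 -> y != 0 -> x - y != 0 ->
  bser x * (bser y + bser (x - y)) = bser y * bser (x - y) + 4^-1.
Proof.
move=> x0 y0 xy0; rewrite !bserE //.
have := exp_ser_neq1 x0; rewrite -{1 2}(subrK y x) exp_ser_add.
have := exp_ser_neq1 y0; have := exp_ser_neq1 xy0.
move: (ser exp_coefs (x - y)) (ser exp_coefs y) => P Q P1 Q1 PQ.
by field; rewrite P1 Q1 PQ !lchar0.
Qed.

Lemma exp_serN l : ser exp_coefs (- l) * ser exp_coefs l = 1.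
Proof.
rewrite -exp_ser_add addNr; apply: laurentP => -[[|k]|k]; rewrite serE.
- by rewrite /= invr1 rmorph1 mul1r.
- by rewrite exp0rz mulr0.
- by rewrite rmorph0 mul0r.
Qed.

Lemma bser_odd_neq0 l : l != 0 -> bser (- l) = - bser l.
Proof.
move=> l0; have l0' : - l != 0 by rewrite oppr_eq0.
rewrite !bserE //; have := exp_ser_neq1 l0; have := exp_ser_neq1 l0'.
have := exp_serN l; move: (ser _ (- l)) (ser _ l) => Q P QP Q1 P1.
have P0 : P != 0.
  by apply: contra_eqN QP => /eqP ->; rewrite mulr0 eq_sym oner_eq0.
have -> : Q = P^-1 by apply: (mulIf P0); rewrite QP mulVf.
field; rewrite P1 P0 !lchar0 /=.
by rewrite mulN1r -opprB oppr_eq0.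
Qed.

Definition inv_lin (l : F) : K := lpure (-1) l^-1.
Definition logser (l : F) : K := ser log_coefs l.

Lemma inv_lin_odd l : inv_lin (- l) = - inv_lin l.
Proof.
rewrite /inv_lin invrN; apply: laurentP => d; rewrite lcoefN /= /pure.
by case: eqP; rewrite ?oppr0.
Qed.

Lemma inv_lin_add x y : x != 0 -> y != 0 -> x - y != 0 ->
  inv_lin x * (inv_lin y + inv_lin (x - y)) = inv_lin y * inv_lin (x - y).
Proof.
have lpureD a c e : lpure a c + lpure a e = lpure a (c + e) :> K.
  by apply: laurentP => d; rewrite lcoefD /= /pure; case: eqP; rewrite ?addr0.
move=> x0 y0 xy; rewrite /inv_lin lpureD !lpureM; congr lpure.
by field; rewrite x0 y0 xy.
Qed.
End Series.

(** Read off at the point 1 of the rational line; oddness then holds at every point,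
including 0 where the closed form of the series has no meaning. *)
Lemma b_coefs_odd d : b_coefs d * (-1) ^ d = - b_coefs d.
Proof.
have /(congr1 (fun f : laurent rat => f d)) := @bser_odd_neq0 rat idfun 1 (oner_neq0 _).
by rewrite lcoefN !serE /= exp1rz mulr1.
Qed.

Lemma log_coefs_even d : log_coefs d * (-1) ^ d = log_coefs d.
Proof.
case: d => [[|k]|k]; rewrite ?mul0r ?mulr1 //=.
by rewrite -exprnP exprS mulN1r mulrN mulrAC exprnP b_coefs_odd mulNr opprK.
Qed.

Section Parity.
Variables (F : fieldType) (rho : {rmorphism rat -> F}).

Lemma bser_odd l : bser rho (- l) = - bser rho l.
Proof.
apply: laurentP => d; rewrite lcoefN !serE -mulN1r expfzMl mulrA.
by rewrite -(rmorphN1 rho) -fmorphXz -rmorphM b_coefs_odd rmorphN mulNr.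
Qed.

Lemma logser_even l : logser rho (- l) = logser rho l.
Proof.
apply: laurentP => d; rewrite !serE -mulN1r expfzMl mulrA.
by rewrite -(rmorphN1 rho) -fmorphXz -rmorphM log_coefs_even.
Qed.

Lemma lead_bser l : lead (-1) (bser rho l) (inv_lin l).
Proof.
split=> [d d1|].
  rewrite serE /b_coefs lcoefD bern_coefsE /= /pure.
  case E: (d + 1) => [k|k]; first by lia.
  by case: eqP => [?|_]; [lia|rewrite addr0 rmorph0 mul0r].
rewrite /inv_lin serE /b_coefs lcoefD bern_coefsE /= /pure /= addr0 /bcoef /psinv /=.
by rewrite big_ord0 subr0 invr1 divr1 rmorph1 mul1r.
Qed.

Lemma lead_inv_lin (l : F) : lead (-1) (inv_lin l) (inv_lin l).
Proof. by split=> [d d1|]; [apply: pure_below|rewrite /inv_lin /= /pure eqxx]. Qed.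

End Parity.

(** * Values of formal sums at algebraically independent points *)

(** Algebraic independence of the first r entries of v: the condition under which
substitution into rational functions is a ring morphism. *)
Definition indep r n (v : nat -> rfun n) :=
  forall p : {mpoly rat[r]}, psubst (fun j : 'I_r => v j) p = 0 -> p = 0.

Section Hom.
Variables (r n : nat).

Lemma psubst_ratc (v : 'I_r -> rfun n) c : psubst v (mpolyC r c) = ratc n c.
Proof. exact: mmapC. Qed.

Lemma psubst_X (v : 'I_r -> rfun n) k : psubst v 'X_k = v k.
Proof. by rewrite /psubst mmapX mmap1U. Qed.

Lemma psubst_rmorph m (phi : {rmorphism rfun m -> rfun n}) (u : 'I_r -> rfun m) p :
  (forall c, phi (ratc m c) = ratc n c) ->
  phi (psubst u p) = psubst (phi \o u) p.
Proof.
move=> phic; rewrite /psubst /mmap rmorph_sum; apply: eq_bigr => k _.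
rewrite rmorphM phic /mmap1 rmorph_prod; congr (_ * _).
by apply: eq_bigr => j _; rewrite rmorphXn.
Qed.

Lemma fsubst_rmorph m (phi : {rmorphism rfun m -> rfun n}) (u : 'I_r -> rfun m) f :
  (forall c, phi (ratc m c) = ratc n c) ->
  phi (fsubst f u) = fsubst f (phi \o u).
Proof. by move=> phic; rewrite /fsubst fmorph_div !psubst_rmorph. Qed.

Variable v : nat -> rfun n.
Hypothesis v_indep : indep r v.
Let v' (j : 'I_r) := v j.

Lemma fsubst_tofrac p : fsubst (tofrac p) v' = psubst v' p.
Proof.
have := @fsubst_frac r n v' p 1 v_indep (oner_neq0 _).
by rewrite tofrac1 divr1 => ->; rewrite -mpolyC1 psubst_ratc rmorph1 divr1.
Qed.

Lemma fsubst_hom : exists phi : {rmorphism rfun r -> rfun n},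
  [/\ forall f, fsubst f v' = phi f, forall c, phi (ratc r c) = ratc n c
    & forall k, phi (tofrac 'X_k) = v k].
Proof.
have ev0 u : u != 0 -> psubst v' u != 0 by apply: contra_neq; exact: v_indep.
have d0 f : (frac (repr f)).2 != 0 :> {mpoly rat[r]} by exact: denom_ratioP.
have zm : zmod_morphism (fun f => fsubst f v').
  move=> f g; rewrite {1}[f]frac_repr {1}[g]frac_repr.
  rewrite -mulNr addf_div ?tofrac_eq0 // -tofracN -!tofracM -tofracD.
  rewrite (@fsubst_frac r n v') ?mulf_neq0 //.
  rewrite /fsubst -[- (_ / _)]mulNr addf_div ?ev0 // /psubst.
  by rewrite rmorphD !rmorphM rmorphN.
have mm : monoid_morphism (fun f => fsubst f v').
  split=> [|f g]; first by rewrite -tofrac1 fsubst_tofrac /psubst rmorph1.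
  rewrite {1}[f]frac_repr {1}[g]frac_repr mulf_div -!tofracM.
  rewrite (@fsubst_frac r n v') ?mulf_neq0 // /fsubst mulf_div /psubst.
  by rewrite !rmorphM.
pose phi : {rmorphism rfun r -> rfun n} := HB.pack (fun f => fsubst f v')
  (GRing.isZmodMorphism.Build _ _ _ zm) (GRing.isMonoidMorphism.Build _ _ _ mm).
exists phi; split=> // [c|k]; first by rewrite /= fsubst_tofrac psubst_ratc.
by rewrite /= fsubst_tofrac psubst_X.
Qed.

(** The polynomial left inverse w carries a relation between the values of the
polynomials u to a relation between coordinates. *)
Lemma indep_inv m (u : nat -> {mpoly rat[r]}) (w : nat -> {mpoly rat[m]})
  (g : nat -> rfun n) : (forall j, (j < m)%N -> g j = psubst v' (u j)) ->
  (forall j, (j < m)%N -> mmap (@mpolyC m rat) (fun j : 'I_r => w j) (u j) =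
     if insub j is Some k then 'X_k else 0) ->
  indep m g.
Proof.
move=> gE uw p; set W := mmap _ _ in uw.
pose U : {mpoly rat[m]} -> {mpoly rat[r]} :=
   mmap (@mpolyC r rat) (fun j : 'I_m => u j).
have -> : psubst (fun j : 'I_m => g j) p = psubst v' (U p).
  rewrite /U [in RHS]/mmap /psubst rmorph_sum; apply: eq_bigr => k _.
  rewrite rmorphM; congr (_ * _); first exact/esym/psubst_ratc.
  rewrite /mmap1 rmorph_prod; apply: eq_bigr => j _; rewrite rmorphXn.
  by rewrite gE.
move=> /v_indep Up; rewrite -[p]comp_mpoly_id.
have -> : p \mPo [tuple 'X_i | i < m] = W (U p).
  rewrite /U /comp_mpoly [in RHS]/mmap /W rmorph_sum; apply: eq_bigr => k _.
  rewrite rmorphM; congr (_ * _); first exact/esym/mmapC.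
  rewrite /mmap1 rmorph_prod; apply: eq_bigr => j _; rewrite rmorphXn.
  rewrite tnth_mktuple; congr (_ ^+ _); rewrite [RHS]uw //.
  by rewrite valK.
by rewrite Up /W rmorph0.
Qed.
End Hom.

Definition dif n (z : nat -> rfun n) j := z j.+1 - z 0%N.

Definition coord r (k : nat) : {mpoly rat[r]} :=
  if k is j.+1 then if insub j is Some i then 'X_i else 0 else 0.

Lemma coordS r (j : 'I_r) : coord r j.+1 = 'X_j.
Proof. by rewrite /coord valK. Qed.

Lemma psubstB r n (v : 'I_r -> rfun n) : {morph psubst v : p q / p - q}.
Proof. exact: rmorphB. Qed.

Lemma psubst_coord m n (z : nat -> rfun n) k : (k <= m)%N ->
  psubst (fun j : 'I_m => dif z j) (coord m k) = z k - z 0%N.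
Proof.
case: k => [|k] km; first by rewrite subrr /psubst rmorph0.
by rewrite (coordS (Ordinal km)) psubst_X.
Qed.

Lemma indep_sub m r n (z : nat -> rfun n) (h : nat -> nat) :
  indep m (dif z) -> (forall j, (j <= r)%N -> (h j <= m)%N) ->
  {in [pred j | j <= r]%N &, injective h} ->
  indep r (dif (fun j => z (h j))).
Proof.
move=> zm hm hinj.
pose s := map h (iota 0 r.+1); pose T k := coord r (index k s).
have Th j : (j <= r)%N -> T (h j) = coord r j.
  move=> jr; rewrite /T; have jI : nth 0%N (iota 0 r.+1) j = j by rewrite nth_iota.
  have -> : h j = nth 0%N s j by rewrite (nth_map 0%N) ?size_iota ?jI.
  rewrite index_uniq ?size_map ?size_iota // map_inj_in_uniq ?iota_uniq //.
  by move=> a b; rewrite !mem_iota => ar br; apply: hinj; rewrite inE; lia.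
apply: (indep_inv zm (u := fun j => coord m (h j.+1) - coord m (h 0%N))
  (w := fun k => T k.+1 - T 0%N)) => j jr.
  rewrite psubstB !psubst_coord ?hm //.
  by rewrite /dif opprB addrA subrK.
set W := mmap _ _.
have Wc k : (k <= m)%N -> W (coord m k) = T k - T 0%N.
  case: k => [|k] km; first by rewrite subrr /W rmorph0.
  by rewrite (coordS (Ordinal km)) /W mmapX mmap1U.
have WB a b : W (a - b) = W a - W b by exact: rmorphB.
rewrite WB !Wc ?hm // opprB addrA subrK !Th //.
by rewrite subr0.
Qed.

Lemma indep_le m r n (v : nat -> rfun n) : (r <= m)%N -> indep m v -> indep r v.
Proof.
move=> rm vi; apply: (indep_inv vi (u := fun j => coord m j.+1)
  (w := fun j => coord r j.+1)) => j jr; have jm := leq_trans jr rm.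
  by rewrite (coordS (Ordinal jm)) psubst_X.
by rewrite (coordS (Ordinal jm)) mmapX mmap1U.
Qed.

Lemma indep_ext r n (v v' : nat -> rfun n) : (forall j, (j < r)%N -> v j = v' j) ->
  indep r v -> indep r v'.
Proof.
move=> vv' vi p; rewrite (_ : (fun j : 'I_r => v' j) = (fun j : 'I_r => v j)).
  exact: vi.
by apply/funext => j; rewrite vv'.
Qed.
Lemma indep_xvar n : indep n (dif (xvar n)).
Proof.
move=> p; suff -> : psubst (fun j : 'I_n => dif (xvar n) j) p = tofrac p.
  by move/eqP; rewrite tofrac_eq0 => /eqP.
rewrite [in RHS](mpolyE p) rmorph_sum; apply: eq_bigr => k _.
rewrite -mul_mpolyC rmorphM; congr (_ * _).
rewrite mpolyXE_id rmorph_prod /mmap1; apply: eq_bigr => j _.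
by rewrite rmorphXn /dif /= subr0 valK.
Qed.

(** f evaluates to T when T, as a function of points (z_0, z_1, ...), gives the
values of the translation-invariant function attached to f.  The scalar l encodes
homogeneity: in T the point is multiplied by l, on the left the component of
degree d by l^d.  With l = -1 this turns the sign (-1)^deg of the insertion
operation into a change of sign of the point, and with l = 2 it will show that
the components of the result are homogeneous polynomials. *)
Definition evaluates n r (f : hsum r) (T : (nat -> rfun n) -> laurent (rfun n)) :=
  (exists A, vanishes_below A f) /\
  forall z (l : rat), indep r (dif z) -> l != 0 -> forall d,
    ratc n l ^ d * tinv (f d) z = T (fun j => ratc n l * z j) d.

Section Circ.
Variables (n m r s : nat).
Hypothesis rsm : (r + s <= m)%N.

(** The insertion operation on values; the sign (-1)^deg has become the opposite
point in the second sum. *)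
Definition circ_val (T U : (nat -> rfun n) -> laurent (rfun n)) z :=
  \sum_(0 <= i < s.+1)
     T (fun j => z (i + j)%N)
     * U (fun j => if (j <= i)%N then z j else z (j + r)%N)
  + (-1) ^+ r * \sum_(1 <= i < s.+1)
     T (fun j => - z (i + r - j)%N)
     * U (fun j => if (j < i)%N then z j else z (j + r)%N).

Lemma tinv_sub (z : nat -> rfun n) (phi : {rmorphism rfun m -> rfun n})
  (h : nat -> nat) q (f : rfun q) :
  (forall c, phi (ratc m c) = ratc n c) ->
  (forall k, phi (tofrac 'X_k) = dif z k) ->
  (forall j, (j <= q)%N -> (h j <= m)%N) ->
  phi (tinv f (fun j => xvar m (h j))) = tinv f (fun j => z (h j)).
Proof.
move=> phic phiX hm; rewrite /tinv fsubst_rmorph //; congr (fsubst f _).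
have phix k : (k <= m)%N -> phi (xvar m k) = z k - z 0%N.
  case: k => [|k] km; first by rewrite /= rmorph0 subrr.
  by rewrite /= (insubT (fun x => x < m)%N km) phiX.
apply/funext => j /=; rewrite rmorphB !phix ?hm //.
by rewrite opprB addrA subrK.
Qed.

(** Degree by degree, both sides are finite sums of products of values of f and g.
The points at which f and g are taken are selections of coordinates of the given
point, hence again independent. *)
Lemma evaluates_circ f g T U : @evaluates n r f T -> @evaluates n s g U ->
  evaluates (circ_in m f g) (circ_val T U).
Proof.
move=> [[A fA] fT] [[B gB] gU].
pose ha i j := (i + j)%N; pose hb i j := if (j <= i)%N then j else (j + r)%N.
pose hc i j := (i + r - j)%N; pose hd i j := if (j < i)%N then j else (j + r)%N.
have hm i : (i <= s)%N -> [/\ forall j, (j <= r)%N -> (ha i j <= m)%N,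
   forall j, (j <= s)%N -> (hb i j <= m)%N, forall j, (j <= r)%N -> (hc i j <= m)%N
   & forall j, (j <= s)%N -> (hd i j <= m)%N].
  move=> si; split=> j; rewrite /ha /hb /hc /hd; try case: ifP; lia.
have hI i : (i <= s)%N -> [/\ {in [pred j | j <= r]%N &, injective (ha i)},
   {in [pred j | j <= s]%N &, injective (hb i)},
   {in [pred j | j <= r]%N &, injective (hc i)} &
   {in [pred j | j <= s]%N &, injective (hd i)}].
  move=> si; split=> j k; rewrite !inE /ha /hb /hc /hd; do 2? case: ifP; lia.
have ifE Y (z : nat -> Y) (P : pred nat) :
  (fun j => if P j then z j else z (j + r)%N) =
  (fun j => z (if P j then j else (j + r)%N)).
  by apply/funext => j; case: (P j).
have tinv0 q k (z : nat -> rfun k) : indep q (dif z) -> tinv (0 : rfun q) z = 0.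
  by case/fsubst_hom => phi [E _ _]; rewrite /tinv E rmorph0.
have ixm q h : (forall j, (j <= q)%N -> (h j <= m)%N) ->
  {in [pred j | j <= q]%N &, injective h} -> indep q (dif (fun j => xvar m (h j))).
  by apply: indep_sub; apply: indep_xvar.
have ch0l e g' : circ_homog m e (0 : rfun r) (g' : rfun s) = 0.
  rewrite /circ_homog !big1_seq ?mulr0 ?addr0 // => i;
  rewrite mem_index_iota => /andP[i1 i2]; rewrite tinv0 ?mul0r //.
    by apply: (ixm r (hc i)); [case: (hm i)|case: (hI i)] => //; lia.
  by apply: (ixm r (ha i)); [case: (hm i)|case: (hI i)] => //; lia.
have ch0r e f' : circ_homog m e (f' : rfun r) (0 : rfun s) = 0.
  rewrite /circ_homog !big1_seq ?mulr0 ?addr0 // => i;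
  rewrite mem_index_iota => /andP[i1 i2]; rewrite (tinv0 s) ?mulr0 //.
    rewrite (ifE _ _ (fun j => j < i)%N).
    by apply: (ixm s (hd i)); [case: (hm i)|case: (hI i)] => //; lia.
  rewrite (ifE _ _ (fun j => j <= i)%N).
  by apply: (ixm s (hb i)); [case: (hm i)|case: (hI i)] => //; lia.
have circE d K : d - A - B < K%:Z ->
  circ_in m f g d = \sum_(k < K) circ_homog m (A + k%:Z) (f (A + k%:Z)) (g (d - (A + k%:Z))).
  move=> dK; rewrite /circ_in; apply: fsum_int => e eA; first by rewrite fA ?ch0l.
  by rewrite gB ?ch0r //; lia.
split.
  by exists (A + B) => d dAB; rewrite (circE d 0%N) ?big_ord0 //; lia.
move=> z l zm l0 d.
have [phi [phiE phic phiX]] := fsubst_hom zm.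
rewrite /tinv phiE (circE d (absz (d - A - B)%R).+1); last by lia.
set K := (absz _).+1; have dK : d - A - B < K%:Z by rewrite /K; lia.
have Tb z' (l' : rat) : indep r (dif z') -> l' != 0 ->
  vanishes_below A (T (fun j => ratc n l' * z' j)).
  move=> z'i l'0 e eA; rewrite -fT // fA // tinv0 ?mulr0 //.
have Ub z' : indep s (dif z') -> vanishes_below B (U (fun j => ratc n l * z' j)).
  by move=> z'i e eA; rewrite -gU // gB // tinv0 ?mulr0.
pose dsum := \sum_(k < K) ratc n l ^ d *
  phi (circ_homog m (A + k%:Z) (f (A + k%:Z)) (g (d - (A + k%:Z)))).
transitivity dsum; first by rewrite rmorph_sum mulr_sumr.
have ixz q h : (forall j, (j <= q)%N -> (h j <= m)%N) ->
  {in [pred j | j <= q]%N &, injective h} -> indep q (dif (fun j => z (h j))).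
  exact: indep_sub.
have l'0 : - l != 0 by rewrite oppr_eq0.
have mulE (l' : rat) (z' z'' : nat -> rfun n) : l' != 0 -> indep r (dif z') -> indep s (dif z'') ->
  (T (fun j => ratc n l' * z' j) * U (fun j => ratc n l * z'' j)) d =
  \sum_(k < K) (ratc n l' ^ (A + k%:Z) * tinv (f (A + k%:Z)) z')
     * (ratc n l ^ (d - (A + k%:Z)) * tinv (g (d - (A + k%:Z))) z'').
  move=> l'n z'i z''i; rewrite lcoefM (conv_sum (Tb _ _ z'i l'n) (Ub _ z''i) dK).
  by apply: eq_bigr => k _; rewrite fT // gU.
rewrite /circ_val lcoefD.
have signE (h : laurent (rfun n)) : ((-1) ^+ r * h) d = (-1) ^+ r * h d.
  by rewrite -signr_odd -(signr_odd (rfun n)); case: (odd r);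
     rewrite ?expr0 ?expr1 ?mul1r ?mulN1r ?lcoefN.
rewrite signE !lcoef_sum.
under eq_big_nat => i /andP[_ i_s].
  rewrite (ifE _ (fun j => ratc n l * z j) (fun j => j <= i)%N).
  rewrite (mulE l (fun j => z (ha i j)) (fun j => z (hb i j))) //; first over.
    by apply: ixz; [case: (hm i)|case: (hI i)].
  by apply: ixz; [case: (hm i)|case: (hI i)].
under [X in _ = _ + _ * X]eq_big_nat => i /andP[_ i_s].
  rewrite (ifE _ (fun j => ratc n l * z j) (fun j => j < i)%N).
  rewrite (_ : (fun j => - (ratc n l * z _)) = (fun j => ratc n (- l) * z (hc i j))); last first.
    by apply/funext => j; rewrite rmorphN mulNr.
  rewrite (mulE (- l) (fun j => z (hc i j)) (fun j => z (hd i j))) //; first over.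
    by apply: ixz; [case: (hm i)|case: (hI i)].
  by apply: ixz; [case: (hm i)|case: (hI i)].
rewrite exchange_big [X in _ = _ + _ * X]exchange_big /= mulr_sumr -big_split.
apply: eq_bigr => k _ /=; set e := A + k%:Z; rewrite /circ_homog rmorphD rmorphM.
rewrite !rmorph_sum mulrDr; congr (_ + _).
  rewrite mulr_sumr; apply: eq_big_nat => i /andP[_ i_s].
  rewrite rmorphM (ifE _ _ (fun j => j <= i)%N).
  rewrite (tinv_sub (z := z) (h := ha i)) //; last by case: (hm i).
  rewrite (tinv_sub (z := z) (h := hb i)) //; last by case: (hm i).
  by rewrite [RHS]mulrACA -expfzDr ?fmorph_eq0 // (addrC e) subrK.
have -> : phi ((-1) ^ (e + r%:Z)) = (-1) ^+ r * (-1) ^ e.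
  by rewrite expfzDr ?oppr_eq0 ?oner_eq0 // mulrC rmorphM rmorph_sign fmorphXz rmorphN1.
rewrite -mulrA mulrCA; congr (_ * _); rewrite !mulr_sumr; apply: eq_big_nat.
move=> i /andP[_ i_s]; rewrite rmorphM (ifE _ _ (fun j => j < i)%N).
rewrite (tinv_sub (z := z) (h := hc i)) //; last by case: (hm i).
rewrite (tinv_sub (z := z) (h := hd i)) //; last by case: (hm i).
have -> : ratc n (- l) ^ e = (-1) ^ e * ratc n l ^ e.
  by rewrite rmorphN -mulN1r expfzMl.
have -> : ratc n l ^ d = ratc n l ^ e * ratc n l ^ (d - e).
  by rewrite -expfzDr ?fmorph_eq0 // (addrC e) subrK.
move: (ratc n l ^ e) (ratc n l ^ (d - e)) ((-1) ^ e) (tinv _ _) (tinv _ _).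
by move=> a b c x y; ring.
Qed.
End Circ.

Section Closure.
Variable n : nat.
Local Notation K := (laurent (rfun n)).
Local Notation val := ((nat -> rfun n) -> K).

Lemma evaluates_eq r (f : hsum r) (T U : val) :
  evaluates f T -> T =1 U -> evaluates f U.
Proof. by move=> fT /funext <-. Qed.

Lemma evaluatesD r (f g : hsum r) (T U : val) :
  evaluates f T -> evaluates g U -> evaluates (f + g) (fun z => T z + U z).
Proof.
move=> [[A fA] fT] [[B gB] gU]; split.
  exists (Order.min A B) => d dAB.
  have -> : (f + g) d = f d + g d by [].
  by rewrite fA ?gB ?addr0 //; lia.
move=> z l zi l0 d; rewrite lcoefD -fT // -gU // -mulrDr; congr (_ * _).
by have [phi [phiE _ _]] := fsubst_hom zi; rewrite /tinv !phiE -rmorphD.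
Qed.

Lemma evaluatesZ r (f : hsum r) (T : val) c :
  evaluates f T -> evaluates (c *: f) (fun z => lconst (ratc n c) * T z).
Proof.
move=> [[A fA] fT]; split.
  exists A => d dA; have -> : (c *: f) d = ratc r c * f d by [].
  by rewrite fA ?mulr0.
move=> z l zi l0 d; rewrite lcoefM conv_pure subr0 -fT //.
have [phi [phiE phic _]] := fsubst_hom zi; rewrite /tinv !phiE.
by have -> : (c *: f) d = ratc r c * f d by []; rewrite rmorphM phic mulrCA.
Qed.

Lemma evaluatesN r (f : hsum r) (T : val) :
  evaluates f T -> evaluates (- f) (fun z => - T z).
Proof.
move=> /(evaluatesZ (-1)); rewrite scaleN1r => /evaluates_eq; apply => z.
by rewrite !rmorphN1 mulN1r.
Qed.

Lemma evaluatesB r (f g : hsum r) (T U : val) :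
  evaluates f T -> evaluates g U -> evaluates (f - g) (fun z => T z - U z).
Proof. by move=> fT gU; apply: evaluatesD => //; apply: evaluatesN. Qed.

Lemma evaluatesM r (f g : hsum r) (T U : val) :
  evaluates f T -> evaluates g U -> evaluates (hmul f g) (fun z => T z * U z).
Proof.
move=> [[A fA] fT] [[B gB] gU]; split.
  by exists (A + B); apply: conv_below.
move=> z l zi l0 d; have [phi [phiE phic phiX]] := fsubst_hom zi.
have TA : vanishes_below A (T (fun j => ratc n l * z j)).
  by move=> e eA; rewrite -fT // fA // /tinv phiE rmorph0 mulr0.
have UB : vanishes_below B (U (fun j => ratc n l * z j)).
  by move=> e eA; rewrite -gU // gB // /tinv phiE rmorph0 mulr0.
have dK : d - A - B < (absz (d - A - B)%R).+1%:Z by lia.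
rewrite lcoefM (conv_sum TA UB dK) -[hmul f g]/(conv f g) (conv_sum fA gB dK).
rewrite /tinv phiE rmorph_sum mulr_sumr; apply: eq_bigr => k _.
rewrite -fT // -gU // /tinv !phiE rmorphM.
set e := A + k%:Z.
by rewrite [RHS]mulrACA -expfzDr ?fmorph_eq0 // (addrC e) subrK.
Qed.

Lemma evaluates_sub m r (f : hsum r) (T : val) (h : nat -> nat) :
  (forall j, (j <= r)%N -> (h j <= m)%N) ->
  {in [pred j | j <= r]%N &, injective h} ->
  evaluates f T ->
  evaluates ((fun d => tinv (f d) (fun j => xvar m (h j))) : hsum m)
    (fun z => T (fun j => z (h j))).
Proof.
move=> hm hI [[A fA] fT]; split.
  exists A => d /fA ->.
  have [phi [E _ _]] := fsubst_hom (indep_sub (indep_xvar (n:=m)) hm hI).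
  by rewrite /tinv E rmorph0.
move=> z l zi l0 d; rewrite -fT //; last exact: indep_sub zi hm hI.
congr (_ * _); have [phi [E phic phiX]] := fsubst_hom zi.
by rewrite /tinv E -/(tinv _ _) (tinv_sub (z := z) (h := h)).
Qed.

(** Values that depend on the differences z_j - z_0 only. *)
Definition inv1 (F : rfun n -> K) : val := fun z => F (z 1%N - z 0%N).
Definition inv2 (F : rfun n -> rfun n -> K) : val :=
  fun z => F (z 1%N - z 0%N) (z 2 - z 0%N).
Definition inv3 (F : rfun n -> rfun n -> rfun n -> K) : val :=
  fun z => F (z 1%N - z 0%N) (z 2 - z 0%N) (z 3 - z 0%N).

Let shift (a b c : rfun n) : a - b = (a - c) - (b - c).
Proof. by rewrite opprB addrA subrK. Qed.

Lemma circ_val11 F G z : circ_val 1 1 (inv1 F) (inv1 G) z = inv2 (circ11 F G) z.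
Proof.
transitivity (F (z 1%N - z 0%N) * G (z 2 - z 0%N)
  + (F (z 2 - z 1%N) * G (z 1%N - z 0%N) + 0)
  + (-1) ^+ 1 * (F (- z 1%N - - z 2) * G (z 2 - z 0%N) + 0)).
  by rewrite /circ_val /index_iota /= !big_cons !big_nil.
rewrite /inv2 /circ11 opprK addrC (addrC (- z 1%N)).
by rewrite (shift (z 2) (z 1%N) (z 0%N)); ring.
Qed.

Lemma circ_val12 F G z :
  circ_val 1 2 (inv1 F) (inv2 G) z = inv3 (circ12 F G) z.
Proof.
transitivity (F (z 1%N - z 0%N) * G (z 2 - z 0%N) (z 3 - z 0%N)
  + (F (z 2 - z 1%N) * G (z 1%N - z 0%N) (z 3 - z 0%N)
  + (F (z 3 - z 2) * G (z 1%N - z 0%N) (z 2 - z 0%N) + 0))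
  + (-1) ^+ 1 * (F (- z 1%N - - z 2) * G (z 2 - z 0%N) (z 3 - z 0%N)
     + (F (- z 2 - - z 3) * G (z 1%N - z 0%N) (z 3 - z 0%N) + 0))).
  by rewrite /circ_val /index_iota /= !big_cons !big_nil.
rewrite /inv3 /circ12 !opprK addrC (addrC (- z 1%N)) (addrC (- z 2)).
rewrite (shift (z 2) (z 1%N) (z 0%N)) (shift (z 3) (z 2) (z 0%N)); ring.
Qed.

Lemma circ_val21 F G z :
  circ_val 2 1 (inv2 F) (inv1 G) z = inv3 (circ21 F G) z.
Proof.
transitivity (F (z 1%N - z 0%N) (z 2 - z 0%N) * G (z 3 - z 0%N)
  + (F (z 2 - z 1%N) (z 3 - z 1%N) * G (z 1%N - z 0%N) + 0)
  + (-1) ^+ 2 * (F (- z 2 - - z 3) (- z 1%N - - z 3) * G (z 3 - z 0%N) + 0)).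
  by rewrite /circ_val /index_iota /= !big_cons !big_nil.
rewrite /inv3 /circ21 !opprK (addrC (- z 1%N)) (addrC (- z 2)).
rewrite (shift (z 2) (z 1%N) (z 0%N)) (shift (z 3) (z 2) (z 0%N)).
by rewrite (shift (z 3) (z 1%N) (z 0%N)); ring.
Qed.

Lemma evaluates_circ11 m (f g : hsum 1) F G : (2 <= m)%N ->
  evaluates f (inv1 F) -> evaluates g (inv1 G) ->
  evaluates (circ_in m f g) (inv2 (circ11 F G)).
Proof.
move=> m2 fF gG; apply: evaluates_eq (@circ_val11 _ _).
exact: (@evaluates_circ n m 1 1).
Qed.

Lemma evaluates_circ12 m (f : hsum 1) (g : hsum 2) F G : (3 <= m)%N ->
  evaluates f (inv1 F) -> evaluates g (inv2 G) ->
  evaluates (circ_in m f g) (inv3 (circ12 F G)).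
Proof.
move=> m2 fF gG; apply: evaluates_eq (@circ_val12 _ _).
exact: (@evaluates_circ n m 1 2).
Qed.

Lemma evaluates_circ21 m (f : hsum 2) (g : hsum 1) F G : (3 <= m)%N ->
  evaluates f (inv2 F) -> evaluates g (inv1 G) ->
  evaluates (circ_in m f g) (inv3 (circ21 F G)).
Proof.
move=> m2 fF gG; apply: evaluates_eq (@circ_val21 _ _).
exact: (@evaluates_circ n m 2 1).
Qed.

Lemma evaluates_drop_pole r (f : hsum r) (T U : val) :
  evaluates f T -> (forall z, lead (- r%:Z) (T z) (U z)) ->
  evaluates (drop_pole f) (fun z => T z - U z).
Proof.
move=> [[A fA] fT] TU; split.
  exists (Order.min A (- r%:Z)) => d dA.
  have -> : drop_pole f d = f d - hpure (- r%:Z) (f (- r%:Z)) d by [].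
  rewrite fA /hpure ?lt_eqF ?subr0 //; lia.
move=> z l zi l0 d; have [_ ->] := TU (fun j => ratc n l * z j).
rewrite lcoefD lcoefN /= /pure -!fT //.
have [phi [phiE _ _]] := fsubst_hom zi; rewrite /tinv !phiE.
have -> : drop_pole f d = f d - hpure (- r%:Z) (f (- r%:Z)) d by [].
rewrite rmorphB mulrBr /hpure; case: eqP => [->|_] //.
by rewrite rmorph0 mulr0.
Qed.

End Closure.

(** * Values of gamma, Theta, C and tau *)
Section Pure.
Variable F : fieldType.
Local Notation K := (laurent F).
Implicit Types f g : K.
Definition is_pure a f := exists c, f = lpure a c.
Lemma pureM a b f g : is_pure a f -> is_pure b g -> is_pure (a + b) (f * g).
Proof. by move=> [c ->] [e ->]; exists (c * e); rewrite lpureM. Qed.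
Lemma pureD a f g : is_pure a f -> is_pure a g -> is_pure a (f + g).
Proof.
move=> [c ->] [e ->]; exists (c + e); apply: laurentP => d.
by rewrite lcoefD /= /pure; case: eqP; rewrite ?addr0.
Qed.
Lemma pureN a f : is_pure a f -> is_pure a (- f).
Proof.
move=> [c ->]; exists (- c); apply: laurentP => d.
by rewrite lcoefN /= /pure; case: eqP; rewrite ?oppr0.
Qed.
Lemma pureV k : is_pure 0 (k%:R^-1 : K).
Proof. by exists k%:R^-1; rewrite -/(lconst _) lconstV lconst_nat. Qed.
Lemma pureI x : is_pure (-1) (inv_lin x : K).
Proof. by exists x^-1. Qed.

(** Agreement in one degree.  A bracket with functions homogeneous of degree a
transports it from degree d - a to degree d, which reduces the degreewise sum over
n in C to the coefficients of the logarithmic series. *)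
Definition eqat d f g := f d = g d.
Lemma eqatD d f g f' g' : eqat d f g -> eqat d f' g' -> eqat d (f + f') (g + g').
Proof. by rewrite /eqat !lcoefD => -> ->. Qed.
Lemma eqatN d f g : eqat d f g -> eqat d (- f) (- g).
Proof. by rewrite /eqat !lcoefN => ->. Qed.
Lemma eqatMl a d p f g : is_pure a p -> eqat (d - a) f g -> eqat d (p * f) (p * g).
Proof. by rewrite /eqat => -[c ->] fg; rewrite !lcoefM !conv_pure fg. Qed.
Lemma eqatMr a d p f g : is_pure a p -> eqat (d - a) f g -> eqat d (f * p) (g * p).
Proof. by rewrite ![_ * p]mulrC; apply: eqatMl. Qed.

Lemma s1_pure x : is_pure (-1) (s1_of (@inv_lin F) x).
Proof. exact: pureM (pureV 2) (pureI x). Qed.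
Lemma uxi_neg1_pure x : is_pure (-2) (uxi_neg1_of (@inv_lin F) x).
Proof. exact: pureM (pureV 12) (pureM (pureI x) (pureI x)). Qed.

Lemma brack11_pure a b (f g : F -> K) x y :
  (forall x, is_pure a (f x)) -> (forall x, is_pure b (g x)) ->
  is_pure (a + b) (brack11 f g x y).
Proof.
move=> fa gb; rewrite /brack11 /circ11 !mulrBr.
have fg u v : is_pure (a + b) (f u * g v) by apply: pureM.
have gf u v : is_pure (a + b) (g u * f v) by rewrite mulrC.
apply: pureD; last apply: pureN.
  exact: pureD (fg _ _) (pureD (fg _ _) (pureN (fg _ _))).
exact: pureD (gf _ _) (pureD (gf _ _) (pureN (gf _ _))).
Qed.

Lemma brack11_eqat a d (f : F -> K) (g g' : F -> K) x y :
  (forall x, is_pure a (f x)) -> (forall x, eqat (d - a) (g x) (g' x)) ->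
  eqat d (brack11 f g x y) (brack11 f g' x y).
Proof.
move=> fa gg'; apply: eqatD; last apply: eqatN.
  apply: eqatD; apply: eqatMl (fa _) _; first exact: gg'.
  exact: eqatD (gg' _) (eqatN (gg' _)).
apply: eqatD; first exact: eqatMr (fa _) (gg' _).
exact: eqatMr (pureD (fa _) (pureN (fa _))) (gg' _).
Qed.

Lemma brack12_eqat a d (f : F -> K) (g g' : F -> F -> K) x y z :
  (forall x, is_pure a (f x)) -> (forall x y, eqat (d - a) (g x y) (g' x y)) ->
  eqat d (brack12 f g x y z) (brack12 f g' x y z).
Proof.
move=> fa gg'; apply: eqatD; last apply: eqatN; (apply: eqatD; first apply: eqatD).
- exact: eqatMl (fa _) (gg' _ _).
- exact: eqatMl (fa _) (eqatD (gg' _ _) (eqatN (gg' _ _))).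
- exact: eqatMl (fa _) (eqatD (gg' _ _) (eqatN (gg' _ _))).
- exact: eqatMr (fa _) (gg' _ _).
- exact: eqatMr (fa _) (gg' _ _).
- exact: eqatMr (fa _) (gg' _ _).
Qed.

Lemma brack21_eqat a d (f : F -> F -> K) (g g' : F -> K) x y z :
  (forall x y, is_pure a (f x y)) -> (forall x, eqat (d - a) (g x) (g' x)) ->
  eqat d (brack21 f g x y z) (brack21 f g' x y z).
Proof.
move=> fa gg'; apply: eqatD; last apply: eqatN; (apply: eqatD; first apply: eqatD).
- exact: eqatMl (fa _ _) (gg' _).
- exact: eqatMl (fa _ _) (gg' _).
- exact: eqatMl (fa _ _) (gg' _).
- exact: eqatMr (fa _ _) (gg' _).
- exact: eqatMr (pureD (fa _ _) (pureN (fa _ _))) (gg' _).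
- exact: eqatMr (pureD (fa _ _) (pureN (fa _ _))) (gg' _).
Qed.
End Pure.

Section TauValues.
Variable n : nat.
Local Notation K := (laurent (rfun n)).
Local Notation val := ((nat -> rfun n) -> K).
Local Notation b := (bser (@ratc n)).
Local Notation i := (@inv_lin (rfun n)).
Local Notation L := (logser (@ratc n)).

Lemma evaluatesV r (f : hsum r) (T : val) k :
  evaluates f T -> evaluates (k%:R^-1 *: f) (fun z => k%:R^-1 * T z).
Proof.
have -> : k%:R^-1 = lconst (ratc n k%:R^-1).
  by rewrite fmorphV rmorph_nat lconstV lconst_nat.
exact: evaluatesZ.
Qed.

Lemma evaluates_ser (f : hsum 1) (c : laurent rat) :
  (forall d, f d = ratc 1 (c d) * xvar 1 1 ^ d) ->
  evaluates f (@inv1 n (ser (@ratc n) c)).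
Proof.
move=> fE; split.
  by have [A cA] := below c; exists A => d dA; rewrite fE cA // rmorph0 mul0r.
move=> z l zi l0 d; have [phi [phiE phic phiX]] := fsubst_hom zi.
rewrite /tinv phiE fE rmorphM phic fmorphXz serE mulrCA; congr (_ * _).
by rewrite /= (insubT (fun x => x < 1)%N (ltnSn 0)) phiX /dif -mulrBr expfzMl.
Qed.

Lemma evaluates_b1 : evaluates b1 (inv1 b).
Proof.
apply: evaluates_ser => d; rewrite /b_coefs lcoefD bern_coefsE rmorphD mulrDl.
rewrite -[b1 d]/(_ + hpure 0 (ratc 1 2^-1) d); congr (_ + _).
  by case: (d + 1) => // k; rewrite rmorph0 mul0r.
rewrite /hpure /= /pure; case: eqP => [->|_]; last by rewrite rmorph0 mul0r.
by rewrite expr0z mulr1.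
Qed.

Lemma evaluates_xi1 k : evaluates (xi1 k) (inv1 (fun l : rfun n => lpure (2 * k) (l ^ (2 * k)))).
Proof.
have := @evaluates_ser (xi1 k) (lpure (2 * k) 1).
move=> /(_ _)/evaluates_eq; apply.
  move=> d; rewrite /xi1 /hpure /= /pure; case: eqP => [->|_].
    by rewrite rmorph1 mul1r.
  by rewrite rmorph0 mul0r.
move=> z; rewrite /inv1; apply: laurentP => d; rewrite serE /= /pure.
by case: eqP => [->|_]; rewrite ?rmorph1 ?mul1r // rmorph0 mul0r.
Qed.

Lemma evaluates_s1 : evaluates s1 (inv1 (s1_of i)).
Proof.
have := @evaluates_ser s1 (lpure (-1) 2^-1).
move=> /(_ _)/evaluates_eq; apply.
  move=> d; rewrite /s1 /hpure /= /pure; case: eqP => [->|_].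
    by rewrite fmorphV rmorph_nat invfM.
  by rewrite rmorph0 mul0r.
move=> z; rewrite /inv1 /s1_of; move: (_ - _) => l.
rewrite (_ : 2^-1 = lconst (ratc n 2^-1)); last first.
  by rewrite fmorphV rmorph_nat lconstV lconst_nat.
rewrite lpureM add0r; apply: laurentP => d; rewrite serE /= /pure.
by case: eqP => [->|_]; rewrite ?rmorph1 ?mul1r // rmorph0 mul0r.
Qed.

Lemma evaluates_b2 : evaluates b2 (inv2 (b2_of b)).
Proof.
(* The arguments x_1, x_2, x_1 - x_2 of b are differences of the coordinates
   0, x_1, x_2 at the two positions selected by h. *)
have sub h l : (forall j, (j <= 1)%N -> (h j <= 2)%N) ->
  {in [pred j | j <= 1]%N &, injective h} -> l = xvar 2 (h 1) - xvar 2 (h 0) ->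
  evaluates (hsubst b1 [:: l]) (fun z => b (z (h 1%N) - z (h 0%N))).
  move=> hm hI lE; have := evaluates_sub hm hI evaluates_b1.
  congr evaluates; apply/funext => d; rewrite /hsubst /tinv; congr fsubst.
  by apply/funext => j; rewrite ord1 lE.
have e1 := @sub (fun j => j) (xvar 2 1) _ _ _.
have e2 := @sub (fun j => if j is 0 then 0 else 2)%N (xvar 2 2) _ _ _.
have e3 := @sub (fun j => if j is 0 then 2 else 1)%N (xvar 2 1 - xvar 2 2) _ _ _.
rewrite /b2 /b2_of.
have := evaluatesV 3 (evaluatesD (evaluatesM (e1 _ _ _) (e2 _ _ _))
  (evaluatesM (e2 _ _ _) (e3 _ _ _))).
move=> /(_ _ _ _ _ _ _ _ _ _ _ _ _)/evaluates_eq; apply => //;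
  try by [rewrite subr0|case=>[|[]]|case=>[|[]] // [|[]]].
by move=> z; rewrite /inv2 opprB addrA subrK.
Qed.

Lemma evaluates_s2 : evaluates s2 (inv2 (s2_of i)).
Proof.
split.
  by exists (-2) => d dA; rewrite /s2 /hpure lt_eqF.
move=> z l zi l0 d; have [phi [phiE phic phiX]] := fsubst_hom zi.
rewrite /inv2 /s2_of !lpureM.
rewrite (_ : 12^-1 = lconst (ratc n 12^-1)); last first.
  by rewrite fmorphV rmorph_nat lconstV lconst_nat.
rewrite lcoefM conv_pure subr0 lcoefD /= /pure /tinv phiE /s2 /hpure.
case: eqP => [->|_]; last by rewrite rmorph0 mulr0 addr0 mulr0.
rewrite -!mulrBr rmorphM rmorphD !fmorphV !rmorphM !rmorphB !rmorph_nat /=.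
rewrite (insubT (fun x => x < 2)%N (isT : 0 < 2)%N).
rewrite (insubT (fun x => x < 2)%N (isT : 1 < 2)%N) !phiX.
rewrite /dif /=.
rewrite !invfM -!mulrA.
rewrite -[ratc n l ^ (-2)]/((_ * _)^-1) invfM.
move: (ratc n l)^-1 => m.
by move: (z 1%N - z 0%N)^-1 (z 2 - z 0%N)^-1 (_ - _ - _)^-1 (12^-1) => a c e t; ring.
Qed.

Lemma evaluates_gamma1 : evaluates gamma1 (inv1 (gamma1_of b)).
Proof. exact: evaluatesV (evaluatesN evaluates_b1). Qed.

Lemma evaluates_gamma2 : evaluates gamma2 (inv2 (gamma2_of b)).
Proof.
apply: evaluatesV; apply: evaluatesD (evaluatesN evaluates_b2) _.
apply: evaluatesV; apply: (evaluates_circ11 (m := 2)) => //; exact: evaluates_b1.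
Qed.

Lemma evaluates_gamma3 : evaluates gamma3 (inv3 (gamma3_of b)).
Proof.
apply: evaluatesV; apply: evaluatesB.
  apply: (evaluates_circ21 (m := 3)) => //; [exact: evaluates_b2|exact: evaluates_b1].
apply: evaluatesV; apply: (evaluates_circ12 (m := 3)) => //; first exact: evaluates_b1.
apply: (evaluates_circ11 (m := 2)) => //; exact: evaluates_b1.
Qed.

Lemma evaluates_Theta2 : evaluates Theta2 (inv2 (Theta2_of i b)).
Proof.
apply: evaluatesD evaluates_gamma2 _; apply: (evaluates_circ11 (m := 2)) => //.
  exact: evaluates_s1.
exact: evaluates_gamma1.
Qed.
Lemma evaluates_Theta3 : evaluates Theta3 (inv3 (Theta3_of i b)).
Proof.
apply: (@evaluates_eq _ _ _ _ (inv3 (Theta3_of i b))).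
  apply: evaluatesD; first apply: evaluatesD; first apply: evaluatesD evaluates_gamma3 _.
  - exact: (evaluates_circ12 (m := 3) _ evaluates_s1 evaluates_gamma2).
  - exact: (evaluates_circ21 (m := 3) _ evaluates_s2 evaluates_gamma1).
  - apply: evaluatesV.
    apply: (evaluates_circ12 (m := 3) _ evaluates_s1) => //.
    exact: (evaluates_circ11 (m := 2) _ evaluates_s1 evaluates_gamma1).
by move=> z; rewrite /inv3 /Theta3_of /rest3_of !addrA.
Qed.
End TauValues.

Section LeadFull.
Variables (F : fieldType) (rho : {rmorphism rat -> F}).
Local Notation K := (laurent F).
Local Notation b := (bser rho).
Local Notation i := (@inv_lin F).

Section Ops.
Variables (f f' g g' : F -> K) (f2 f2' : F -> F -> K) (N M : int).
Hypotheses (fN : forall x, lead N (f x) (f' x)) (gM : forall x, lead M (g x) (g' x)).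

Lemma lead_circ11 x y : lead (N + M) (circ11 f g x y) (circ11 f' g' x y).
Proof.
by apply: leadD; apply: leadM => //; apply: leadB.
Qed.

Lemma lead_circ12 x y z : (forall x y, lead M (f2 x y) (f2' x y)) ->
  lead (N + M) (circ12 f f2 x y z) (circ12 f' f2' x y z).
Proof.
move=> f2M; apply: leadD; [apply: leadD|]; apply: leadM => //; exact: leadB.
Qed.

Lemma lead_circ21 x y z : (forall x y, lead N (f2 x y) (f2' x y)) ->
  lead (N + M) (circ21 f2 g x y z) (circ21 f2' g' x y z).
Proof.
by move=> f2M; apply: leadD; [apply: leadD|]; apply: leadM.
Qed.
End Ops.

Let b1 x : lead (-1) (b x) (i x). Proof. exact: lead_bser. Qed.
Let i1 x : lead (-1) (i x) (i x). Proof. exact: lead_inv_lin. Qed.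

Lemma lead_gamma1 x : lead (-1) (gamma1_of b x) (gamma1_of i x).
Proof. exact: leadV (leadN (b1 x)). Qed.
Lemma lead_s1 x : lead (-1) (s1_of i x) (s1_of i x).
Proof. exact: leadV (i1 x). Qed.
Lemma lead_b2 x y : lead (-2) (b2_of b x y) (b2_of i x y).
Proof. by apply: leadV; apply: leadD; apply: (leadM (N := -1) (M := -1)). Qed.
Lemma lead_gamma2 x y : lead (-2) (gamma2_of b x y) (gamma2_of i x y).
Proof.
apply: leadV; apply: leadD (leadN (lead_b2 x y)) (leadV _ _).
exact: (lead_circ11 (N := -1) (M := -1)).
Qed.
Lemma lead_gamma3 x y z : lead (-3) (gamma3_of b x y z) (gamma3_of i x y z).
Proof.
apply: leadV; apply: leadB; last apply: leadV.
  by apply: (lead_circ21 (N := -2) (M := -1)) => // *; apply: lead_b2.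
apply: (lead_circ12 (N := -1) (M := -2)) => // *.
exact: (lead_circ11 (N := -1) (M := -1)).
Qed.
Lemma lead_s1gamma1 x y : lead (-2) (s1gamma1_of i b x y) (s1gamma1_of i i x y).
Proof.
apply: (lead_circ11 (N := -1) (M := -1)) => *; [exact: lead_s1|exact: lead_gamma1].
Qed.
Lemma lead_Theta2 x y : lead (-2) (Theta2_of i b x y) (Theta2_of i i x y).
Proof. exact: leadD (lead_gamma2 x y) (lead_s1gamma1 x y). Qed.
Lemma lead_Theta3 x y z : lead (-3) (Theta3_of i b x y z) (Theta3_of i i x y z).
Proof.
apply: leadD; [apply: leadD; first exact: lead_gamma3|apply: leadD; last apply: leadV].
- apply: (lead_circ12 (N := -1) (M := -2)) => *; [exact: lead_s1|exact: lead_gamma2].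
- apply: (lead_circ21 (N := -2) (M := -1)) => *; first exact: lead_gamma1.
  by apply: leadV; apply: leadD; apply: (leadM (N := -1) (M := -1)).
- apply: (lead_circ12 (N := -1) (M := -2)) => *; [exact: lead_s1|exact: lead_s1gamma1].
Qed.
End LeadFull.

Section Scale.
Variable F : fieldType.
Local Notation K := (laurent F).

Lemma pure_vanish a (f : K) d : is_pure a f -> d != a -> f d = 0.
Proof. by move=> [c ->] da; rewrite /= /pure (negPf da). Qed.

Lemma brack11Z (c : K) (f g : F -> K) x y :
  c * brack11 f g x y = brack11 f (fun v => c * g v) x y.
Proof. by rewrite /brack11 /circ11; ring. Qed.

Lemma brack11_0 (f : F -> K) x y : brack11 f (fun=> 0) x y = 0.
Proof. by rewrite /brack11 /circ11; ring. Qed.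

(** The shape {q, {h, g}} + {{h, q}, g} of a summand of the depth three part of C. *)
Definition nested (q h g : F -> K) x y z :=
  brack12 q (brack11 h g) x y z + brack21 (brack11 h q) g x y z.

Lemma nestedZ (c : K) (q h g : F -> K) x y z :
  c * nested q h g x y z = nested q h (fun v => c * g v) x y z.
Proof.
by rewrite /nested /brack12 /brack21 /circ12 /circ21 /brack11 /circ11; ring.
Qed.

Lemma nested0 (q h : F -> K) x y z : nested q h (fun=> 0) x y z = 0.
Proof.
by rewrite /nested /brack12 /brack21 /circ12 /circ21 /brack11 /circ11; ring.
Qed.

Local Notation s1_of := (s1_of (@inv_lin F)).
Local Notation uxi_neg1_of := (uxi_neg1_of (@inv_lin F)).
Lemma brack11_uxi_eqat d (g g' : F -> K) x y :
  (forall v, g v (d + 2) = g' v (d + 2)) ->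
  brack11 uxi_neg1_of g x y d = brack11 uxi_neg1_of g' x y d.
Proof.
move=> gg'; apply: (brack11_eqat (a := -2)) => v; first exact: uxi_neg1_pure.
by rewrite /eqat opprK.
Qed.

Lemma nested_uxi_eqat d (g g' : F -> K) x y z :
  (forall v, g v (d + 3) = g' v (d + 3)) ->
  nested uxi_neg1_of s1_of g x y z d = nested uxi_neg1_of s1_of g' x y z d.
Proof.
move=> gg'; apply: eqatD.
  apply: (brack12_eqat (a := -2)) => [v|u v]; first exact: uxi_neg1_pure.
  apply: (brack11_eqat (a := -1)) => w; first exact: s1_pure.
  by rewrite /eqat !opprK -addrA.
apply: (brack21_eqat (a := -3)) => [u v|v]; last by rewrite /eqat opprK.
by apply: (brack11_pure (a := -1) (b := -2)) => w; [exact: s1_pure|exact: uxi_neg1_pure].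
Qed.

Variable rho : {rmorphism rat -> F}.
(** The value of the function with underlined xi of index 2k + 1; for k >= 1 it is 2k
times the term of degree 2k of the logarithmic series. *)
Definition log_term k l : K := lconst (rho (xi_coef k)) * lpure (2 * k) (l ^ (2 * k)).

Lemma log_term_neg1 l : log_term (-1) l = uxi_neg1_of l.
Proof.
rewrite /log_term /uxi_neg1_of fmorphV rmorph_nat lconstV lconst_nat lpureM.
by congr (_ * lpure _ _); rewrite -invfM.
Qed.

Lemma log_coefs_pos k : log_coefs k.+2%:Z = bcoef k.+2 / k.+2%:R.
Proof.
rewrite -[log_coefs _]/(b_coefs k.+1%:Z / _); congr (_ / _).
rewrite lcoefD bern_coefsE -[RHS]addr0; congr (_ + _).
by rewrite addn1.
Qed.

Lemma log_term_neg1F : log_term (-1) = uxi_neg1_of.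
Proof. by apply/funext => l; apply: log_term_neg1. Qed.

Lemma log_term_coef k v : (1 <= k)%N ->
  ((2 * k)%N%:R^-1 * log_term k v) (2 * k)%N%:Z = logser rho v (2 * k)%N%:Z.
Proof.
case: k => // k _; rewrite /log_term -lconst_nat -lconstV !lcoefM conv_pure lcoefM.
rewrite conv_pure !subr0 serE /lpure [lcoef (Laurent _) _]/(pure _ _ _) /pure.
have E : 2 * k.+1%:Z = (2 * k.+1)%N%:Z by lia.
rewrite E eqxx mulrA; congr (_ * _).
rewrite -(rmorph_nat rho) -fmorphV -rmorphM; congr (rho _).
rewrite -[xi_coef _]/(bernoulli (2 * k.+1) / _) /bernoulli.
rewrite (_ : (2 * k.+1)%N = k.*2.+2); last by lia.
rewrite log_coefs_pos mulrC; congr (_ / _).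
by rewrite mulrC mulKf // pnatr_eq0 -lt0n fact_gt0.
Qed.

Lemma log_vanish d v : (forall k, (1 <= k)%N -> d != (2 * k)%N%:Z) -> logser rho v d = 0.
Proof.
move=> dk; rewrite serE; suff -> : log_coefs d = 0 by rewrite rmorph0 mul0r.
have := log_coefs_even d; case: d dk => [d|//] dk.
have [d0|d0] := posnP d; first by rewrite d0.
have od : odd d.
  apply: contraT => ev; have := dk d./2; rewrite half_gt0.
  by rewrite mul2n even_halfK // eqxx; case: (d) d0 ev => [|[|]] // ? _ _ /(_ isT).
rewrite -exprnP -signr_odd od expr1 mulrN1 => /eqP; rewrite eqNr => /eqP.
exact.
Qed.
End Scale.

Section Sums.
Variable n : nat.
Local Notation K := (laurent (rfun n)).
Local Notation val := ((nat -> rfun n) -> K).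
Local Notation b := (bser (@ratc n)).
Local Notation i := (@inv_lin (rfun n)).
Local Notation L := (logser (@ratc n)).

Lemma evaluates_Phi1 : evaluates Phi1 (inv1 (Phi1_of b i)).
Proof.
apply: evaluates_drop_pole (evaluates_gamma1 n) _ => z; exact: lead_gamma1.
Qed.
Lemma evaluates_Phi2 : evaluates Phi2 (inv2 (Phi2_of b i)).
Proof.
apply: evaluates_drop_pole (evaluates_Theta2 n) _ => z; exact: lead_Theta2.
Qed.
Lemma evaluates_Phi3 : evaluates Phi3 (inv3 (Phi3_of b i)).
Proof.
apply: evaluates_drop_pole (evaluates_Theta3 n) _ => z; exact: lead_Theta3.
Qed.

(** A sum over k whose k-th term is homogeneous of degree 2k + a: each degree gets at
most one term, so that the sum is finite degreewise and its value U may be compared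
with the terms one degree at a time. *)
Lemma evaluates_fsum r (X : nat -> hsum r) (T : nat -> val) (U : val) (a : int) :
  (r <= n)%N ->
  (forall k, (1 <= k)%N -> evaluates (X k) (T k)) ->
  (forall k z d, (1 <= k)%N -> d != (2 * k)%N%:Z + a -> T k z d = 0) ->
  (forall k z, (1 <= k)%N -> T k z ((2 * k)%N%:Z + a) = U z ((2 * k)%N%:Z + a)) ->
  (forall z d, (forall k, (1 <= k)%N -> d != (2 * k)%N%:Z + a) -> U z d = 0) ->
  evaluates ((fun d => \sum_(k \in [set k : nat | (1 <= k)%N]%classic) X k d) : hsum r) U.
Proof.
move=> rn XT T0 TU U0.
pose z0 := xvar n; have z0i : indep r (dif z0) by apply: indep_le rn (@indep_xvar n).
have X0 k d : (1 <= k)%N -> d != (2 * k)%N%:Z + a -> X k d = 0.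
  move=> k1 da; have [_ /(_ z0 1 z0i (oner_neq0 _) d)] := XT k k1.
  rewrite T0 // rmorph1 exp1rz mul1r; have [phi [phiE _ _]] := fsubst_hom z0i.
  by rewrite /tinv phiE => /eqP; rewrite fmorph_eq0 => /eqP.
have X1 k0 : (1 <= k0)%N ->
  \sum_(k \in [set k : nat | (1 <= k)%N]%classic) X k ((2 * k0)%N%:Z + a) =
  X k0 ((2 * k0)%N%:Z + a).
  move=> k01; rewrite -(@fsbig_widen _ _ _ _ [set k0]%classic) ?fsbig_set1 //.
    by move=> k /= ->.
  by move=> k [/= k1 /eqP kk0]; apply: X0 => //; apply: contra kk0; lia.
have Xn d : (forall k, (1 <= k)%N -> d != (2 * k)%N%:Z + a) ->
  \sum_(k \in [set k : nat | (1 <= k)%N]%classic) X k d = 0.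
  by move=> da; apply: fsbig1 => k /= k1; apply: X0 => //; apply: da.
split.
  by exists a => d da; apply: Xn => k k1; apply/eqP; lia.
move=> z l zi l0 d.
have [[k [k1 ->]]|none] := pselect (exists k, (1 <= k)%N /\ d = (2 * k)%N%:Z + a).
  by rewrite X1 // -TU //; have [_ ->] := XT k k1.
have none' k : (1 <= k)%N -> d != (2 * k)%N%:Z + a.
  by move=> k1; apply/eqP => dk; apply: none; exists k.
rewrite Xn // U0 // /tinv; have [phi [phiE _ _]] := fsubst_hom zi.
by rewrite phiE rmorph0 mulr0.
Qed.

Lemma evaluates_uxi1 k : evaluates (uxi1 k) (inv1 (log_term (@ratc n) k)).
Proof. exact: evaluatesZ (evaluates_xi1 n k). Qed.

Lemma evaluates_uxi1_neg1 : evaluates (uxi1 (-1)) (inv1 (uxi_neg1_of i)).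
Proof.
by apply: evaluates_eq (evaluates_uxi1 _) _ => z; rewrite /inv1 log_term_neg1.
Qed.

Lemma evaluates_bracket11 (f g : hsum 1) F G :
  evaluates f (@inv1 n F) -> evaluates g (inv1 G) ->
  evaluates (bracket f g) (inv2 (brack11 F G)).
Proof.
by move=> fF gG; apply: evaluatesB; apply: evaluates_circ11.
Qed.
Lemma evaluates_bracket12 (f : hsum 1) (g : hsum 2) F G :
  evaluates f (@inv1 n F) -> evaluates g (inv2 G) ->
  evaluates (bracket f g) (inv3 (brack12 F G)).
Proof.
by move=> fF gG; apply: evaluatesB; [apply: evaluates_circ12|apply: evaluates_circ21].
Qed.
Lemma evaluates_bracket21 (f : hsum 2) (g : hsum 1) F G :
  evaluates f (@inv2 n F) -> evaluates g (inv1 G) ->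
  evaluates (bracket f g) (inv3 (brack21 F G)).
Proof.
by move=> fF gG; apply: evaluatesB; [apply: evaluates_circ21|apply: evaluates_circ12].
Qed.

Lemma evaluates_uxi2 k : evaluates (uxi2 k) (inv2 (brack11 (s1_of i) (log_term (@ratc n) k))).
Proof.
have := evaluatesZ (xi_coef k) (evaluates_bracket11 (evaluates_s1 n) (evaluates_xi1 n k)).
move=> /evaluates_eq; apply => z; exact: brack11Z.
Qed.

Lemma evaluates_uxi2_neg1 : evaluates (uxi2 (-1)) (inv2 (brack11 (s1_of i) (uxi_neg1_of i))).
Proof.
by have := evaluates_uxi2 (-1); rewrite log_term_neg1F.
Qed.

Lemma evaluates_C2 : (2 <= n)%N -> evaluates C2 (inv2 (C2_of i L)).
Proof.
move=> n2; apply: (evaluates_fsum (a := -2)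
  (T := fun k => inv2 (brack11 (uxi_neg1_of i)
    (fun v => (2 * k)%N%:R^-1 * log_term (@ratc n) k v)))).
- exact: n2.
- move=> k k1; apply: evaluates_eq (evaluatesV _ _) _; last first.
    move=> z; apply: brack11Z.
  exact: evaluates_bracket11 evaluates_uxi1_neg1 (evaluates_uxi1 _).
- move=> k z d k1; rewrite addrC; apply: pure_vanish.
  apply: (brack11_pure (a := -2) (b := (2 * k)%N%:Z)) => v; first exact: uxi_neg1_pure.
  rewrite -[(2 * k)%N%:Z]add0r; apply: pureM; first exact: pureV.
  rewrite -[(2 * k)%N%:Z]add0r; apply: pureM; first by eexists.
  rewrite (_ : (2 * k)%N%:Z = 2 * k%:Z); last by lia.
  by eexists.
- move=> k z k1; apply: brack11_uxi_eqat => v; rewrite subrK; exact: log_term_coef.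
- move=> z d dk; rewrite /inv2 /C2_of (@brack11_uxi_eqat _ d _ (fun=> 0)) ?brack11_0 // => v.
  by apply: log_vanish => k /dk; apply: contra => /eqP <-; rewrite addrK.
Qed.

Lemma evaluates_C3 : (3 <= n)%N -> evaluates C3 (inv3 (C3_of i L)).
Proof.
move=> n3; apply: (evaluates_fsum (a := -3)
  (T := fun k => inv3 (nested (uxi_neg1_of i) (s1_of i)
    (fun v => (2 * k)%N%:R^-1 * log_term (@ratc n) k v)))).
- exact: n3.
- move=> k k1; apply: evaluates_eq (evaluatesV _ _) _; last first.
    move=> z; apply: nestedZ.
  apply: evaluatesD.
    exact: evaluates_bracket12 evaluates_uxi1_neg1 (evaluates_uxi2 _).
  exact: evaluates_bracket21 evaluates_uxi2_neg1 (evaluates_uxi1 _).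
- move=> k z d k1 dk; rewrite /inv3 -nestedZ.
  rewrite -lconst_nat -lconstV lcoefM conv_pure subr0.
  rewrite (@nested_uxi_eqat _ d _ (fun=> 0)) ?nested0 ?mulr0 // => v.
  apply: (@pure_vanish _ (2 * k%:Z)); last by apply: contra dk; lia.
  rewrite -[2 * k%:Z]add0r; apply: pureM; by eexists.
- move=> k z k1; apply: nested_uxi_eqat => v; rewrite subrK; exact: log_term_coef.
- move=> z d dk; rewrite /inv3 (@nested_uxi_eqat _ d _ (fun=> 0)) ?nested0 // => v.
  by apply: log_vanish => k /dk; apply: contra => /eqP <-; rewrite addrK.
Qed.

Lemma evaluates_tau1 : evaluates tau1 (inv1 (tau1_of b i)).
Proof. exact: evaluates_Phi1. Qed.
Lemma evaluates_tau2 : (2 <= n)%N -> evaluates tau2 (inv2 (tau2_of b i L)).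
Proof. by move=> n2; apply: evaluatesD; [exact: evaluates_Phi2|exact: evaluates_C2]. Qed.
Lemma evaluates_tau3 : (3 <= n)%N -> evaluates tau3 (inv3 (tau3_of b i L)).
Proof.
move=> n3; apply: evaluatesD; last exact: evaluates_C3.
apply: evaluatesD; first exact: evaluates_Phi3.
by apply: (evaluates_circ21 (m := 3)) => //; [apply: evaluates_C2; lia|exact: evaluates_Phi1].
Qed.

End Sums.

(** * Residues along the last variable *)
Section Place.
(** S x x' says that x' is the value of x under a partially defined specialisation
of F, a place that is the identity on the rationals.  It is applied to setting the
last variable of a rational function to 0. *)
Variables (F : fieldType) (rho : {rmorphism rat -> F}) (S : F -> F -> Prop).
Hypothesis SD : forall x x' y y', S x x' -> S y y' -> S (x + y) (x' + y').
Hypothesis SM : forall x x' y y', S x x' -> S y y' -> S (x * y) (x' * y').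
Hypothesis Sc : forall q, S (rho q) (rho q).
Hypothesis SV : forall x x', S x x' -> x' != 0 -> S x^-1 x'^-1.
Local Notation K := (laurent F).
Local Notation b := (bser rho).
Local Notation i := (@inv_lin F).
Local Notation L := (logser rho).

Let S0 : S 0 0. Proof. by rewrite -(rmorph0 rho); apply: Sc. Qed.
Let S1 : S 1 1. Proof. by rewrite -(rmorph1 rho); apply: Sc. Qed.
Let SN x x' : S x x' -> S (- x) (- x').
Proof.
by move=> xx'; rewrite -mulN1r -[- x']mulN1r -(rmorphN1 rho); apply: SM.
Qed.
Let SX x x' k : S x x' -> S (x ^+ k) (x' ^+ k).
Proof. by move=> xx'; elim: k => // k IH; rewrite !exprS; apply: SM. Qed.
Let SXz x x' k : S x x' -> x' != 0 -> S (x ^ k) (x' ^ k).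
Proof.
move=> xx' x0; case: k => k; rewrite /exprz; [|apply: SV; rewrite ?expf_neq0 //];
  exact: SX.
Qed.

Definition specializes (f g : K) := forall d, S (f d) (g d).

Lemma specD f f' g g' : specializes f f' -> specializes g g' -> specializes (f + g) (f' + g').
Proof. by move=> ff gg d; rewrite !lcoefD; apply: SD. Qed.
Lemma specN f f' : specializes f f' -> specializes (- f) (- f').
Proof. by move=> ff d; rewrite !lcoefN; apply: SN. Qed.
Lemma specB f f' g g' : specializes f f' -> specializes g g' -> specializes (f - g) (f' - g').
Proof. by move=> ff gg; apply: specD => //; apply: specN. Qed.
Lemma specM f f' g g' : specializes f f' -> specializes g g' -> specializes (f * g) (f' * g').
Proof.
move=> ff gg d; have [A [fA f'A]] := common_below f f'.
have [C [gC g'C]] := common_below g g'; rewrite !lcoefM.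
have dK : d - A - C < (absz (d - A - C)%R).+1%:Z by lia.
rewrite (conv_sum fA gC dK) (conv_sum f'A g'C dK).
by apply: (big_ind2 S S0) => [x x' y y'|k _]; [apply: SD|apply: SM].
Qed.
Lemma spec_pure a c c' : S c c' -> specializes (lpure a c) (lpure a c').
Proof. by move=> cc' d; rewrite /= /pure; case: eqP. Qed.
Lemma specV k f f' : specializes f f' -> specializes (k%:R^-1 * f) (k%:R^-1 * f').
Proof.
apply: specM; rewrite -lconst_nat -lconstV; apply: spec_pure.
by rewrite -(rmorph_nat rho) -fmorphV.
Qed.

Lemma spec_b u u' : S u u' -> u' != 0 -> specializes (b u) (b u').
Proof. by move=> uu' u0 d; rewrite !serE; apply: SM => //; apply: SXz. Qed.
Lemma spec_i u u' : S u u' -> u' != 0 -> specializes (i u) (i u').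
Proof. by move=> uu' u0; apply: spec_pure; apply: SV. Qed.
Lemma spec_L u u' : S u u' -> specializes (L u) (L u').
Proof.
move=> uu' [k|k]; rewrite !serE; first by apply: SM => //; apply: SX.
by rewrite rmorph0 !mul0r.
Qed.

Variable e : F.
Hypotheses (Se : S e 0) (e0 : e != 0).
Let E : K := lpure 1 e.

Lemma spec_Ei : specializes (E * i e) 1.
Proof. by rewrite /E /inv_lin lpureM divff //; apply: spec_pure. Qed.

Lemma spec_Eb : specializes (E * b e) 1.
Proof.
move=> d; rewrite lcoefM conv_pure serE mulrCA.
have -> : e * e ^ (d - 1) = e ^ d by rewrite -{1}[e]expr1z -expfzDr // addrC subrK.
rewrite /b_coefs lcoefD bern_coefsE subrK /= /pure.
case: d => [[|k]|k].
- rewrite /= addr0 /bcoef /psinv /= big_ord0 subr0 invr1 divr1 rmorph1 mul1r.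
  exact: S1.
- set c := rho _; suff : S (c * e ^+ k.+1) (c * 0) by rewrite mulr0.
  by apply: SM; [exact: Sc|have := SX k.+1 Se; rewrite expr0n].
- by rewrite /= addr0 rmorph0 mul0r.
Qed.

Lemma spec_E : specializes E 0.
Proof.
have -> : 0 = lpure 1 0 :> K by apply: laurentP => d; rewrite /= /pure if_same.
exact: spec_pure.
Qed.

Lemma spec_E0 f f' : specializes f f' -> specializes (E * f) 0.
Proof. by move=> ff'; rewrite -[0](mul0r f'); apply: specM => //; apply: spec_E. Qed.

(** The difference quotient of L tends to its derivative b - 1/x: for the term
l^(d+1) of L, (u^(d+1) - (u - e)^(d+1)) / e is a sum of d + 1 products with limit
u^d. *)
Lemma spec_iL u : S u u -> u != 0 -> specializes (i e * (L u - L (u - e))) (b u - i u).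
Proof.
move=> Su u0 d; rewrite lcoefM conv_pure !lcoefD !lcoefN !serE opprK.
have -> : b_coefs d = (if d == -1 then 1 else 0) + log_coefs (d + 1) * (d + 1)%:~R.
  case: d => [k|[|k]].
  + rewrite add0r (_ : k%:Z + 1 = k.+1%:Z); last by lia.
    by rewrite /= divfK // pnatr_eq0.
  + rewrite /b_coefs lcoefD bern_coefsE mulr0 addr0.
    by rewrite /= /pure /= addr0 /bcoef /psinv /= big_ord0 subr0 invr1 divr1.
  rewrite /b_coefs lcoefD bern_coefsE.
  rewrite (_ : Negz k.+1 + 1 = Negz k) //=; last by lia.
  by rewrite /pure mul0r addr0.
rewrite rmorphD mulrDl addrAC /inv_lin /= /pure.
have -> : rho (if d == -1 then 1 else 0) * u ^ d - (if d == -1 then u^-1 else 0) = 0.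
  by case: eqP => [->|_]; rewrite ?rmorph1 ?mul1r ?rmorph0 ?mul0r subrr.
rewrite add0r -mulrBr mulrCA rmorphM -mulrA.
case: d => [k|[|k]]; last 2 first.
- by rewrite /= rmorph0 !mul0r.
- rewrite (_ : Negz k.+1 + 1 = Negz k) //=; last by lia.
  by rewrite rmorph0 !mul0r.
rewrite (_ : k%:Z + 1 = k.+1%:Z); last by lia.
apply: SM => //; rewrite /exprz subrXX opprB addrC subrK mulKf //.
rewrite rmorph_int -[_%:~R]/(k.+1%:R) mulr_natl -[X in _ *+ X]card_ord -sumr_const.
apply: (big_ind2 S S0) => [? ? ? ?|j _]; first exact: SD.
have -> : u ^+ k = u ^+ (k.+1.-1 - j) * u ^+ j.
  by rewrite -exprD subnK // -ltnS.
apply: SM; first exact: SX.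
by apply: SX; have := SD Su (SN Se); rewrite oppr0 addr0.
Qed.

(** The limit of e f.  The series E = e t carries the degree of e, so that f and its
residue stay homogeneous together. *)
Definition residue (f : K) (r : K) := specializes (E * f) r.

Lemma res_D f r f' r' : residue f r -> residue f' r' -> residue (f + f') (r + r').
Proof. by rewrite /residue mulrDr; apply: specD. Qed.
Lemma res_B f r f' r' : residue f r -> residue f' r' -> residue (f - f') (r - r').
Proof. by rewrite /residue mulrBr; apply: specB. Qed.
Lemma res_N f r : residue f r -> residue (- f) (- r).
Proof. by rewrite /residue mulrN; apply: specN. Qed.
Lemma res_V k f r : residue f r -> residue (k%:R^-1 * f) (k%:R^-1 * r).
Proof. by rewrite /residue mulrCA; apply: specV. Qed.
Lemma res_M f g r s : specializes f r -> residue g s -> residue (f * g) (r * s).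
Proof. by rewrite /residue mulrCA; apply: specM. Qed.
Lemma res_0 f r : specializes f r -> residue f 0.
Proof. exact: spec_E0. Qed.

Lemma res_circ11 (f g : F -> K) u rg : specializes (f u) (f u) -> specializes (g u) (g u) ->
  specializes (f (e - u)) (f (- u)) -> residue (g e) rg ->
  residue (circ11 f g u e) (f u * rg + f (- u) * (0 - rg)).
Proof.
move=> fu gu fe ge; apply: res_D; apply: res_M => //.
by apply: res_B => //; apply: res_0 gu.
Qed.

Let K0 := lchar0 rho.

(** What b and 1/x have in common at e; the residue of Theta is computed for both at
once. *)
Definition simple_pole (f : F -> K) :=
  [/\ forall u, f (- u) = - f u,
      forall u u', S u u' -> u' != 0 -> specializes (f u) (f u') & residue (f e) 1].

Lemma simple_pole_b : simple_pole b.
Proof. by split; [exact: bser_odd|exact: spec_b|exact: spec_Eb]. Qed.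
Lemma simple_pole_i : simple_pole i.
Proof. by split; [exact: inv_lin_odd|exact: spec_i|exact: spec_Ei]. Qed.

Let Seu u : S u u -> S (e - u) (- u).
Proof. by move=> Su; have := SD Se (SN Su); rewrite add0r. Qed.
Let Sue u : S u u -> S (u - e) u.
Proof. by move=> Su; have := SD Su (SN Se); rewrite oppr0 addr0. Qed.

Section OnePole.
Variable f : F -> K.
Hypothesis fP : simple_pole f.
Let f_odd : forall u, f (- u) = - f u. Proof. by case: fP. Qed.
Let f_spec u u' : S u u' -> u' != 0 -> specializes (f u) (f u').
Proof. by case: fP => _ H _; exact: H. Qed.
Let f_res : residue (f e) 1. Proof. by case: fP. Qed.

Lemma spec_s1 u u' : S u u' -> u' != 0 -> specializes (s1_of i u) (s1_of i u').
Proof. by move=> uu' u0; apply: specV; apply: spec_i. Qed.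
Lemma spec_gamma1 u u' : S u u' -> u' != 0 -> specializes (gamma1_of f u) (gamma1_of f u').
Proof. by move=> uu' u0; apply: specV; apply: specN; apply: f_spec. Qed.

Lemma spec_circ11 (g h : F -> K) u u' v v' :
  (forall u u', S u u' -> u' != 0 -> specializes (g u) (g u')) ->
  (forall u u', S u u' -> u' != 0 -> specializes (h u) (h u')) ->
  S u u' -> S v v' -> u' != 0 -> v' != 0 -> v' - u' != 0 ->
  specializes (circ11 g h u v) (circ11 g h u' v').
Proof.
move=> gs hs uu vv u0 v0 uv; apply: specD; apply: specM.
- exact: gs.
- exact: hs.
- by apply: gs => //; apply: SD => //; apply: SN.
- by apply: specB; apply: hs.
Qed.

Lemma spec_b2 (g : F -> K) u u' v v' :
  (forall u u', S u u' -> u' != 0 -> specializes (g u) (g u')) ->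
  S u u' -> S v v' -> u' != 0 -> v' != 0 -> u' - v' != 0 ->
  specializes (b2_of g u v) (b2_of g u' v').
Proof.
move=> gs uu vv u0 v0 uv; apply: specV; apply: specD; apply: specM; apply: gs => //.
by apply: SD => //; apply: SN.
Qed.

Lemma spec_gamma2 u u' v v' : S u u' -> S v v' -> u' != 0 -> v' != 0 -> v' - u' != 0 ->
  specializes (gamma2_of f u v) (gamma2_of f u' v').
Proof.
move=> uu vv u0 v0 uv; apply: specV; apply: specD.
  by apply: specN; apply: spec_b2; rewrite // -opprB oppr_eq0.
by apply: specV; apply: spec_circ11.
Qed.

Lemma spec_s1gamma1 u u' v v' : S u u' -> S v v' -> u' != 0 -> v' != 0 -> v' - u' != 0 ->
  specializes (s1gamma1_of i f u v) (s1gamma1_of i f u' v').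
Proof.
by move=> *; apply: spec_circ11 => //; [exact: spec_s1|exact: spec_gamma1].
Qed.

Section AtPoint.
Variable u : F.
Hypotheses (Su : S u u) (u0 : u != 0).
Let nu0 : - u != 0. Proof. by rewrite oppr_eq0. Qed.

Lemma res_diag : residue (circ11 f f u e) (2 * f u).
Proof.
have -> : 2 * f u = f u * 1 + f (- u) * (0 - 1) by rewrite f_odd; ring.
by apply: res_circ11 => //; apply: f_spec => //; apply: Seu.
Qed.

Lemma res_gamma2 : residue (gamma2_of f u e) (12^-1 * f u).
Proof.
have -> : 12^-1 * f u = 4^-1 * (- (3^-1 * (f u * 1 + f u * 1)) + 2^-1 * (2 * f u)).
  by field; rewrite !K0.
apply: res_V; apply: res_D; last by apply: res_V; apply: res_diag.
apply: res_N; apply: res_V; apply: res_D; first by apply: res_M => //; apply: f_spec.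
by rewrite mulrC; apply: res_M => //; apply: f_spec => //; apply: Sue.
Qed.

Lemma res_gamma1 : residue (gamma1_of f e) (- 2^-1).
Proof. by rewrite -[2^-1]mulr1 -mulrN; apply: res_V; apply: res_N. Qed.

Lemma res_s1gamma1 : residue (s1gamma1_of i f u e) (- 2^-1 * i u).
Proof.
have -> : - 2^-1 * i u = s1_of i u * (- 2^-1) + s1_of i (- u) * (0 - - 2^-1).
  by rewrite /s1_of inv_lin_odd; field; rewrite !K0.
apply: res_circ11.
- exact: spec_s1.
- exact: spec_gamma1.
- by apply: spec_s1 => //; apply: Seu.
- exact: res_gamma1.
Qed.
End AtPoint.

Section TwoPoints.
Variables x y : F.
Hypotheses (Sx : S x x) (Sy : S y y) (x0 : x != 0) (y0 : y != 0) (xy : y - x != 0).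
Let Syx : S (y - x) (y - x). Proof. exact: SD Sy (SN Sx). Qed.
Let xy' : x - y != 0. Proof. by rewrite -opprB oppr_eq0. Qed.

Lemma res_circ12 (g : F -> K) (G : F -> F -> K) rx ry :
  specializes (g x) (g x) -> specializes (g (y - x)) (g (y - x)) ->
  specializes (g (e - y)) (g (- y)) ->
  specializes (G x y) (G x y) -> residue (G x e) rx -> residue (G y e) ry ->
  residue (circ12 g G x y e) (g x * ry + g (y - x) * (rx - ry) + g (- y) * (0 - rx)).
Proof.
move=> gx gyx gy Gxy Gx Gy; apply: res_D; first apply: res_D; apply: res_M => //.
  exact: res_B.
by apply: res_B => //; apply: res_0 Gxy.
Qed.

Lemma res_circ21 (G : F -> F -> K) (g : F -> K) r :
  specializes (G x y) (G x y) -> specializes (G (y - x) (e - x)) (G (y - x) (- x)) ->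
  specializes (G (e - y) (e - x)) (G (- y) (- x)) -> specializes (g x) (g x) -> residue (g e) r ->
  residue (circ21 G g x y e) (G x y * r + G (- y) (- x) * r).
Proof.
move=> G1 G2 G3 gx ge; rewrite -[G x y * r]addr0.
apply: res_D; first apply: res_D; try exact: res_M.
exact: res_0 (specM G2 gx).
Qed.

Let nx0 : - x != 0. Proof. by rewrite oppr_eq0. Qed.
Let ny0 : - y != 0. Proof. by rewrite oppr_eq0. Qed.
Let c1 : y - x - - x != 0. Proof. by rewrite opprK subrK. Qed.
Let c2 : - y - - x != 0. Proof. by rewrite opprK addrC. Qed.

Lemma res_gamma3 : residue (gamma3_of f x y e) 0.
Proof.
pose V := 8^-1 * (b2_of f x y * 1 + b2_of f (- y) (- x) * 1 - 6^-1 * (f x * (2 * f y)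
  + f (y - x) * (2 * f x - 2 * f y) + f (- y) * (0 - 2 * f x))).
suff : residue (gamma3_of f x y e) V.
  have Exy : x - y = - (y - x) by rewrite opprB.
  have Eyx : - y - - x = - (y - x) by rewrite opprK opprB addrC.
  congr residue; rewrite /V /b2_of Exy Eyx !f_odd.
  by field; rewrite !K0.
apply: res_V; apply: res_B.
  apply: res_circ21 _ _ _ _ f_res.
  - exact: spec_b2.
  - by apply: spec_b2 => //; apply: Seu.
  - by apply: spec_b2 => //; apply: Seu.
  - exact: f_spec.
apply: res_V; apply: res_circ12.
- exact: f_spec.
- exact: f_spec.
- by apply: f_spec => //; apply: Seu.
- by apply: spec_circ11.
- exact: res_diag.
- exact: res_diag.
Qed.

Lemma res_s1gamma2 : residue (circ12 (s1_of i) (gamma2_of f) x y e)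
  (24^-1 * (i x * f y + i (y - x) * (f x - f y) + i y * f x)).
Proof.
have -> : 24^-1 * (i x * f y + i (y - x) * (f x - f y) + i y * f x) =
  s1_of i x * (12^-1 * f y) + s1_of i (y - x) * (12^-1 * f x - 12^-1 * f y)
  + s1_of i (- y) * (0 - 12^-1 * f x).
  by rewrite /s1_of inv_lin_odd; field; rewrite !K0.
apply: res_circ12.
- exact: spec_s1.
- exact: spec_s1.
- by apply: spec_s1 => //; apply: Seu.
- exact: spec_gamma2.
- exact: res_gamma2.
- exact: res_gamma2.
Qed.

(** Not simplified and independent of f, so that it cancels in the difference of
the two values of f that occur in Phi3. *)
Definition rest3_residue := s2_of i x y * (- 2^-1) + s2_of i (- y) (- x) * (- 2^-1)
  + 2^-1 * (s1_of i x * (- 2^-1 * i y)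
    + s1_of i (y - x) * ((- 2^-1 * i x) - (- 2^-1 * i y))
    + s1_of i (- y) * (0 - (- 2^-1 * i x))).

Lemma res_rest3 : residue (rest3_of i f x y e) rest3_residue.
Proof.
have sp12 u u' v v' : S u u' -> S v v' -> u' != 0 -> v' != 0 -> u' - v' != 0 ->
  specializes (s2_of i u v) (s2_of i u' v').
  move=> uu vv u0 v0 uv; apply: specV; apply: specD; apply: specM; apply: spec_i => //.
  by apply: SD => //; apply: SN.
apply: res_D.
  apply: res_circ21 _ _ _ _ res_gamma1.
  - exact: sp12 Sx Sy x0 y0 xy'.
  - exact: sp12 Syx (Seu Sx) xy nx0 c1.
  - exact: sp12 (Seu Sy) (Seu Sx) ny0 nx0 c2.
  - exact: spec_gamma1.
apply: res_V; apply: res_circ12.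
- exact: spec_s1.
- exact: spec_s1.
- by apply: spec_s1 => //; apply: Seu.
- exact: spec_s1gamma1.
- exact: res_s1gamma1.
- exact: res_s1gamma1.
Qed.

End TwoPoints.
End OnePole.

Section Log.
Lemma spec_uxi_neg1 u u' : S u u' -> u' != 0 -> specializes (uxi_neg1_of i u) (uxi_neg1_of i u').
Proof. by move=> uu u0; apply: specV; apply: specM; apply: spec_i. Qed.

Lemma spec_brack11 (g h : F -> K) u u' v v' :
  (forall u u', S u u' -> u' != 0 -> specializes (g u) (g u')) ->
  (forall u u', S u u' -> u' != 0 -> specializes (h u) (h u')) ->
  S u u' -> S v v' -> u' != 0 -> v' != 0 -> v' - u' != 0 ->
  specializes (brack11 g h u v) (brack11 g h u' v').
Proof. by move=> *; apply: specB; apply: spec_circ11. Qed.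

Lemma spec_C2 u u' v v' : S u u' -> S v v' -> u' != 0 -> v' != 0 -> v' - u' != 0 ->
  specializes (C2_of i L u v) (C2_of i L u' v').
Proof.
move=> *; apply: spec_brack11 => //; first exact: spec_uxi_neg1.
by move=> *; apply: spec_L.
Qed.

(** The factor 1/(12 e^2) of the bracket seems to give a double pole.  It multiplies
L (e - u) - L u, which by parity of L is e times a difference quotient of L: the
pole is simple and its residue is the derivative of -L/12. *)
Lemma res_C2 u : S u u -> u != 0 ->
  residue (C2_of i L u e) (- (12^-1 * (b u - i u))).
Proof.
move=> Su u0; have Ee : E * i e = 1 by rewrite /E /inv_lin lpureM divff.
rewrite /residue.
have -> : E * C2_of i L u e = E * (uxi_neg1_of i u * (L e - L (u - e))
     + uxi_neg1_of i (u - e) * (L u - L e))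
   - 12^-1 * (i e * (L u - L (u - e))).
  rewrite /C2_of /brack11 /circ11 /uxi_neg1_of -(opprB u e) logser_even !inv_lin_odd.
  have -> : i e * (L u - L (u - e)) = E * i e * (i e * (L u - L (u - e))).
    by rewrite Ee mul1r.
  by field; rewrite !K0.
rewrite -[X in specializes _ X]add0r; apply: specB; last by apply: specV; apply: spec_iL.
apply: (spec_E0 (f' := uxi_neg1_of i u * (L 0 - L u) + uxi_neg1_of i u * (L u - L 0))).
apply: specD; apply: specM.
- exact: spec_uxi_neg1.
- by apply: specB; apply: spec_L => //; apply: Sue.
- by apply: spec_uxi_neg1 => //; apply: Sue.
- by apply: specB; apply: spec_L.
Qed.

Lemma res_Phi1 : residue (Phi1_of b i e) 0.
Proof.
rewrite -(subrr (- 2^-1)); apply: res_B; apply: res_gamma1;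
[exact: simple_pole_b|exact: simple_pole_i].
Qed.

(** The summand gamma2 contributes (b - 1/u) / 12, the summand s1 o gamma1 has a residue
without b, and C2 contributes the opposite of the former.  This cancellation is the
purpose of C. *)
Lemma res_tau2 u : S u u -> u != 0 -> residue (tau2_of b i L u e) 0.
Proof.
move=> Su u0.
have -> : 0 = (12^-1 * b u - 2^-1 * i u) - (12^-1 * i u - 2^-1 * i u)
  - 12^-1 * (b u - i u) by field; rewrite !K0.
have [pb pi] := (simple_pole_b, simple_pole_i).
apply: res_D; last exact: res_C2.
by apply: res_B; apply: res_D; rewrite -?mulNr;
 [exact: res_gamma2|exact: res_s1gamma1|exact: res_gamma2|exact: res_s1gamma1].
Qed.

Section TwoPoints.
Variables x y : F.
Hypotheses (Sx : S x x) (Sy : S y y) (x0 : x != 0) (y0 : y != 0) (xy : y - x != 0).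
Let Syx : S (y - x) (y - x). Proof. exact: SD Sy (SN Sx). Qed.
Let xy' : x - y != 0. Proof. by rewrite -opprB oppr_eq0. Qed.

(** The residue of gamma3 is 0, that of the summands with two factors i does not depend
on b, and that of s1 o gamma2 is s1 inserted into the residue f / 12 of gamma2.  By
the Jacobi identity C3 is {s1, C2}.  The residue of s1 o C2 is s1 inserted into
-(b - i) / 12, the opposite of the difference of the values of the former at b and
at i, and that of C2 o s1 is (C2 (x, y) + C2 (-y, -x)) / 2 = 0. *)
Lemma res_tau3 : residue (tau3_of b i L x y e) 0.
Proof.
have [pb pi] := (simple_pole_b, simple_pole_i).
pose R (f : F -> K) := 24^-1 * (i x * f y + i (y - x) * (f x - f y) + i y * f x).
pose R2 u := - (12^-1 * (b u - i u)).
have nx0 : - x != 0 by rewrite oppr_eq0.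
have ny0 : - y != 0 by rewrite oppr_eq0.
have C2xy : specializes (C2_of i L x y) (C2_of i L x y) by exact: spec_C2.
have C2yx : specializes (C2_of i L (y - x) (e - x)) (C2_of i L (y - x) (- x)).
  by apply: spec_C2 (Seu Sx) _ _ _ => //; rewrite opprB addKr.
have C2e : specializes (C2_of i L (e - y) (e - x)) (C2_of i L (- y) (- x)).
  by apply: spec_C2 (Seu Sy) (Seu Sx) _ _ _ => //; rewrite opprK addrC.
have res_s1 : residue (s1_of i e) (2^-1 * 1) by apply: res_V; case: pi.
pose V := (0 + R b + rest3_residue x y) - (0 + R i + rest3_residue x y)
  + (C2_of i L x y * 0 + C2_of i L (- y) (- x) * 0)
  + ((s1_of i x * R2 y + s1_of i (y - x) * (R2 x - R2 y) + s1_of i (- y) * (0 - R2 x))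
    - (C2_of i L x y * (2^-1 * 1) + C2_of i L (- y) (- x) * (2^-1 * 1))).
have -> : 0 = V.
  rewrite /V /R /R2 /C2_of /brack11 /circ11 /uxi_neg1_of /s1_of.
  rewrite (_ : - x - - y = y - x); last by rewrite opprK addrC.
  rewrite -?opprD !inv_lin_odd !logser_even.
  by field; rewrite !K0.
apply: res_D; first apply: res_D.
- apply: res_B; (apply: res_D; first apply: res_D).
  + exact: res_gamma3.
  + exact: res_s1gamma2.
  + exact: res_rest3.
  + exact: res_gamma3.
  + exact: res_s1gamma2.
  + exact: res_rest3.
- apply: res_circ21 C2xy C2yx C2e _ res_Phi1.
  by apply: specB; apply: spec_gamma1.
rewrite (C3E K0); [|exact: inv_lin_odd|exact: logser_even].
apply: res_B.
  apply: res_circ12.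
  - exact: spec_s1.
  - exact: spec_s1.
  - by apply: spec_s1 => //; apply: Seu.
  - exact: spec_C2.
  - exact: res_C2.
  - exact: res_C2.
by apply: res_circ21 C2xy C2yx C2e _ res_s1; apply: spec_s1.
Qed.
End TwoPoints.
End Log.
End Place.

(** * Rational functions regular along a hyperplane *)
Section Substitution.
Variables r n : nat.
Local Notation P := {mpoly rat[r]}.
Implicit Types (U V : nat -> {mpoly rat[n]}) (p q : P).

Definition sub U p : {mpoly rat[n]} := mmap (@mpolyC n rat) (fun j : 'I_r => U j) p.
HB.instance Definition _ U := GRing.RMorphism.copy (sub U)
   (mmap (@mpolyC n rat) (fun j : 'I_r => U j)).

Lemma subC U c : sub U c%:MP = c%:MP. Proof. exact: mmapC. Qed.
Lemma subX U (k : 'I_r) : sub U 'X_k = U k.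
Proof. by rewrite /sub mmapX mmap1U. Qed.
Lemma subM U : {morph sub U : p q / p * q}. Proof. exact: rmorphM. Qed.
Lemma subB U : {morph sub U : p q / p - q}. Proof. exact: rmorphB. Qed.
Lemma subD U : {morph sub U : p q / p + q}. Proof. exact: rmorphD. Qed.

Lemma mpoly_hom_ext (R : comNzRingType) (f g : {rmorphism P -> R}) :
  (forall c, f c%:MP = g c%:MP) -> (forall k, f 'X_k = g 'X_k) -> f =1 g.
Proof.
move=> fgC fgX p; rewrite (mpolyE p) !rmorph_sum; apply: eq_bigr => m _.
rewrite -mul_mpolyC !rmorphM fgC; congr (_ * _).
rewrite mpolyXE_id !rmorph_prod; apply: eq_bigr => k _.
by rewrite !rmorphXn fgX.
Qed.

Lemma sub_ext U V : (forall k : 'I_r, U k = V k) -> sub U =1 sub V.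
Proof.
move=> UV; apply: (mpoly_hom_ext (f := sub U) (g := sub V)) => [c|k].
  by rewrite [LHS]subC [RHS]subC.
by rewrite [LHS]subX [RHS]subX.
Qed.

Lemma psubst_tofrac U p : psubst (fun j : 'I_r => tofrac (U j)) p = tofrac (sub U p).
Proof.
rewrite /psubst /sub /mmap rmorph_sum; apply: eq_bigr => m _.
rewrite rmorphM; congr (_ * _); rewrite /mmap1 rmorph_prod.
by apply: eq_bigr => k _; rewrite rmorphXn.
Qed.

Lemma sub_cong (l : {mpoly rat[n]}) U V p : (forall k : 'I_r, exists t, U k - V k = l * t) ->
  exists t, sub U p - sub V p = l * t.
Proof.
move=> UV; rewrite /sub /mmap.
apply: (big_ind2 (fun a b => exists t, a - b = l * t)).
- by exists 0; rewrite subrr mulr0.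
- move=> a b c d [q ab] [q' cd]; exists (q + q').
  by rewrite opprD addrACA ab cd mulrDr.
have cM a b c d : (exists t, a - b = l * t) -> (exists t, c - d = l * t) ->
  exists t, a * c - b * d = l * t.
  move=> [q ab] [q' cd]; exists (q * c + b * q').
  rewrite mulrDr mulrA -ab mulrCA -cd; ring.
move=> m _; apply: (cM); first by exists 0; rewrite subrr mulr0.
rewrite /mmap1; apply: (big_ind2 (fun a b => exists t, a - b = l * t)).
- by exists 0; rewrite subrr mulr0.
- exact: cM.
move=> k _; elim: (m k) => [|j IH]; first by exists 0; rewrite subrr mulr0.
by rewrite !exprS; apply: cM.
Qed.

End Substitution.

Section Regular.
Variable n : nat.
Local Notation P := {mpoly rat[n]}.
Implicit Types (U V W : nat -> P) (p q : P) (r s : rfun n).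

Lemma sub_sub U V p : sub U (sub V p) = sub (fun j => sub U (V j)) p.
Proof.
apply: (mpoly_hom_ext (f := sub U \o sub V) (g := sub (fun j => sub U (V j)))).
  by move=> c; rewrite /= !subC.
by move=> k; rewrite /= !subX.
Qed.

Lemma sub_id p : sub (fun j => if insub j is Some k then 'X_k else 0) p = p.
Proof.
apply: (mpoly_hom_ext (f := sub _) (g := idfun)) => [c|k]; first exact: subC.
by rewrite [LHS]subX valK.
Qed.

Lemma fsubst_id r (v : 'I_n -> rfun n) :
  (forall k, v k = tofrac 'X_k) -> fsubst r v = r.
Proof.
move=> /funext ->; have E p : psubst (fun j : 'I_n => tofrac 'X_j) p = tofrac p.
  rewrite -[p in RHS]sub_id -psubst_tofrac; congr psubst.
  by apply/funext => j; rewrite valK.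
rewrite {1}[r]frac_repr (@fsubst_frac n n (fun j => tofrac 'X_j)).
- by rewrite !E -frac_repr.
- by move=> p; rewrite E => /eqP; rewrite tofrac_eq0 => /eqP.
- exact: denom_ratioP.
Qed.

(** The substitution U, the parametrisation of a hyperplane, is defined at the rational
function r and has value s there. *)
Definition place U r s := exists p q,
  [/\ sub U q != 0, r = tofrac p / tofrac q & s = tofrac (sub U p) / tofrac (sub U q)].
Definition regular U r := exists s, place U r s.
Definition ispoly r := exists p, r = tofrac p.

Lemma sub_neq0 U q : sub U q != 0 -> q != 0.
Proof. by apply: contra_neq => ->; rewrite rmorph0. Qed.

Lemma place_poly U p : place U (tofrac p) (tofrac (sub U p)).
Proof. by exists p, 1; rewrite rmorph1 tofrac1 !divr1 oner_neq0. Qed.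

Lemma placeD U r s r' s' : place U r s -> place U r' s' -> place U (r + r') (s + s').
Proof.
move=> [p [q [q0 -> ->]]] [p' [q' [q'0 -> ->]]]; exists (p * q' + p' * q), (q * q').
have [q1 q'1] := (sub_neq0 q0, sub_neq0 q'0).
split; first by rewrite rmorphM mulf_neq0.
  by rewrite addf_div ?tofrac_eq0 // rmorphD !rmorphM.
by rewrite addf_div ?tofrac_eq0 // !(rmorphD, rmorphM).
Qed.

Lemma placeM U r s r' s' : place U r s -> place U r' s' -> place U (r * r') (s * s').
Proof.
move=> [p [q [q0 -> ->]]] [p' [q' [q'0 -> ->]]]; exists (p * p'), (q * q').
split; first by rewrite rmorphM mulf_neq0.
  by rewrite mulf_div !rmorphM.
by rewrite mulf_div !rmorphM.
Qed.

Lemma placeC U c : place U (ratc n c) (ratc n c).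
Proof. by have := place_poly U c%:MP; rewrite subC. Qed.

Lemma placeV U r s : place U r s -> s != 0 -> place U r^-1 s^-1.
Proof.
move=> [p [q [q0 -> ->]]]; rewrite mulf_eq0 negb_or tofrac_eq0 => /andP[p0 _].
by exists q, p; split; rewrite // ?invf_div.
Qed.

Lemma regularD U r s : regular U r -> regular U s -> regular U (r + s).
Proof. by move=> [r' R] [s' S]; exists (r' + s'); apply: placeD. Qed.
Lemma regularM U r s : regular U r -> regular U s -> regular U (r * s).
Proof. by move=> [r' R] [s' S]; exists (r' * s'); apply: placeM. Qed.
Lemma regular_poly U p : regular U (tofrac p).
Proof. by eexists; apply: place_poly. Qed.
Lemma regularN U r : regular U r -> regular U (- r).
Proof.
move=> R; rewrite -mulN1r; apply: regularM => //.
by rewrite -tofrac1 -tofracN; apply: regular_poly.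
Qed.
Lemma regularDl U r s : regular U s -> regular U (r + s) -> regular U r.
Proof. by move=> /regularN S /regularD /(_ S); rewrite addrK. Qed.
Lemma regular_first U r s t :
  regular U (r + s + t) -> regular U s -> regular U t -> regular U r.
Proof. by move=> + S T; rewrite -addrA; apply: regularDl; apply: regularD. Qed.
Lemma regular_last U r s t :
  regular U (r + s + t) -> regular U r -> regular U s -> regular U t.
Proof. by move=> + R S; rewrite addrC; apply: regularDl; apply: regularD. Qed.

(** The kernel of U is the ideal of l, the equation of the hyperplane.  If l r vanishes
on the hyperplane, its numerator is divisible by l, so that r has no pole. *)
Lemma place0_regular U l r : sub U l = 0 -> l != 0 ->
  (forall p, sub U p = 0 -> exists q, p = l * q) ->
  place U (tofrac l * r) 0 -> regular U r.
Proof.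
move=> l0 ln0 kerU [p [q [q0 E /esym/eqP]]].
rewrite mulf_eq0 invr_eq0 !tofrac_eq0 (negPf q0) orbF => /eqP/kerU[p' pE].
exists (tofrac (sub U p') / tofrac (sub U q)), p', q; split=> //.
apply: (mulfI (_ : tofrac l != 0)); first by rewrite tofrac_eq0.
by rewrite E pE rmorphM mulrA.
Qed.

(** The ideal of l is prime, being the kernel of U, and does not contain the denominator
c of a fraction a / c that is regular along l = 0.  If l a / c is a polynomial p, then
l divides p c, hence p. *)
Lemma regular_cancel U l r : sub U l = 0 -> l != 0 ->
  (forall p, sub U p = 0 -> exists q, p = l * q) ->
  regular U r -> ispoly (tofrac l * r) -> ispoly r.
Proof.
move=> l0 ln0 kerU [_ [a [c [c0 -> _]]]] [p E].
have c1 := sub_neq0 c0.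
have F : l * a = p * c.
  apply/eqP; rewrite -tofrac_eq !tofracM -E -!mulrA mulVf ?mulr1 ?tofrac_eq0 //.
have /kerU[q pE] : sub U p = 0.
  move: F => /(congr1 (sub U)); rewrite !subM l0 mul0r => /esym/eqP.
  by rewrite mulf_eq0 (negPf c0) orbF => /eqP.
exists q; apply: (mulfI (_ : tofrac l != 0)); first by rewrite tofrac_eq0.
by rewrite E pE tofracM.
Qed.

Lemma regular_cancelX U l r k : sub U l = 0 -> l != 0 ->
  (forall p, sub U p = 0 -> exists q, p = l * q) ->
  regular U r -> ispoly (tofrac (l ^+ k) * r) -> ispoly r.
Proof.
move=> l0 ln0 kerU R; elim: k => [|k IH]; first by rewrite expr0 tofrac1 mul1r.
rewrite exprS tofracM -mulrA => /regular_cancel H; apply: IH.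
by apply: (H U) => //; apply: regularM => //; apply: regular_poly.
Qed.

(** Regularity is carried along by a change of variables V.  The hyperplane
parametrised by U' is the image under V of the one parametrised by U; the two
parametrisations of the image need not agree, and W compares them. *)
Lemma regular_transport U U' V W r : indep n (fun j => tofrac (V j)) ->
  (forall k : 'I_n, U' k = sub W (sub U (V k))) ->
  regular U' r -> regular U (fsubst r (fun j : 'I_n => tofrac (V j))).
Proof.
move=> Vi UE [_ [p [q [q0 -> _]]]].
have q1 : sub U (sub V q) != 0.
  apply: contraNneq q0 => q0; have -> : sub U' q = sub W (sub U (sub V q)).
    by rewrite !sub_sub; apply: sub_ext => k; rewrite UE sub_sub.
  by rewrite q0 /sub rmorph0.
exists (tofrac (sub U (sub V p)) / tofrac (sub U (sub V q))), (sub V p), (sub V q).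
split=> //; rewrite (@fsubst_frac n n (fun j => tofrac (V j)) p q Vi (sub_neq0 q0)).
by rewrite !psubst_tofrac.
Qed.

Lemma fsubst_fsubst r V W : indep n (fun j => tofrac (V j)) ->
  fsubst (fsubst r (fun j : 'I_n => tofrac (W j))) (fun j : 'I_n => tofrac (V j))
  = fsubst r (fun j : 'I_n => tofrac (sub V (W j))).
Proof.
move=> Vi; have [phi [phiE phic phiX]] := fsubst_hom Vi.
rewrite phiE fsubst_rmorph //; congr fsubst; apply/funext => j /=.
by rewrite -phiE (fsubst_tofrac Vi) psubst_tofrac.
Qed.

Lemma regular_transport_inv U U' V W V' r : indep n (fun j => tofrac (V j)) ->
  indep n (fun j => tofrac (V' j)) ->
  (forall k : 'I_n, sub V' (V k) = 'X_k) ->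
  (forall k : 'I_n, U' k = sub W (sub U (V' k))) ->
  regular U' (fsubst r (fun j : 'I_n => tofrac (V j))) -> regular U r.
Proof.
move=> Vi V'i V'V UE /(regular_transport V'i UE); rewrite fsubst_fsubst //.
by rewrite fsubst_id // => k; rewrite V'V.
Qed.

End Regular.

Section Points.
Variable n : nat.
Local Notation P := {mpoly rat[n]}.

Lemma indep_tofrac (V V' : nat -> P) :
  (forall k : 'I_n, sub V' (V k) = 'X_k) -> indep n (fun j => tofrac (V j)).
Proof.
move=> V'V p; rewrite psubst_tofrac => /eqP; rewrite tofrac_eq0 => /eqP p0.
rewrite -[p](sub_id (n := n)); move: (congr1 (sub V') p0).
rewrite sub_sub [RHS]rmorph0 => <-.
by apply: sub_ext => k; rewrite V'V valK.
Qed.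

Lemma ker_sub (l : P) (U : nat -> P) : (forall k : 'I_n, exists t, 'X_k - U k = l * t) ->
  forall p, sub U p = 0 -> exists q, p = l * q.
Proof.
move=> Ul p p0; have [|q E] := @sub_cong n n l (fun j => coord n j.+1) U p.
  by move=> k; rewrite coordS.
by exists q; rewrite -E p0 subr0 -[LHS](sub_id (n := n)).
Qed.
End Points.

Lemma sub_neq0_diff n (a b : {mpoly rat[n]}) (V : nat -> {mpoly rat[n]}) :
  sub V (a - b) != 0 -> tofrac a - tofrac b != 0 :> rfun n.
Proof. by move=> /sub_neq0; rewrite -tofracB tofrac_eq0. Qed.

(** * Denominators of tau *)
Section Closed.
(** tau is a polynomial in the values of b, i and L at the differences of the
arguments, so any ring Q that contains these values contains those of tau.  Used
for the series whose coefficients have no denominators other than powers of one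
polynomial. *)
Variables (V : zmodType) (K : fieldType) (Q : K -> Prop) (G : V -> Prop).
Hypothesis QD : forall f g, Q f -> Q g -> Q (f + g).
Hypothesis QN : forall f, Q f -> Q (- f).
Hypothesis QM : forall f g, Q f -> Q g -> Q (f * g).
Hypothesis QV : forall k, Q k%:R^-1.
Hypothesis GN : forall u, G u -> G (- u).

Definition good2 x y := [/\ G x, G y & G (y - x)].
Definition good3 x y z := [/\ good2 x y, good2 y z & good2 x z].

Let QB f g : Q f -> Q g -> Q (f - g).
Proof. by move=> ? ?; apply: QD => //; apply: QN. Qed.

Lemma closed_circ11 (f g : V -> K) x y :
  (forall u, G u -> Q (f u)) -> (forall u, G u -> Q (g u)) -> good2 x y ->
  Q (circ11 f g x y).
Proof. by move=> fQ gQ [Gx Gy Gxy]; apply: QD; apply: QM; auto. Qed.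

Lemma closed_circ12 (f : V -> K) (g : V -> V -> K) x y z :
  (forall u, G u -> Q (f u)) -> (forall u v, good2 u v -> Q (g u v)) -> good3 x y z ->
  Q (circ12 f g x y z).
Proof.
move=> fQ gQ [xy yz xz]; have [Gx Gy Gxy] := xy; have [_ Gz Gyz] := yz.
by apply: QD; [apply: QD|]; apply: QM; auto.
Qed.

Lemma closed_circ21 (f : V -> V -> K) (g : V -> K) x y z :
  (forall u v, good2 u v -> Q (f u v)) -> (forall u, G u -> Q (g u)) -> good3 x y z ->
  Q (circ21 f g x y z).
Proof.
move=> fQ gQ [xy yz xz]; have [Gx Gy Gxy] := xy; have [_ Gz Gyz] := yz.
have [_ _ Gxz] := xz.
apply: QD; [apply: QD|]; apply: QM; auto; apply: fQ.
  by split; rewrite // subBBr.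
by split; rewrite // subBB.
Qed.

Variables b i L : V -> K.
Hypothesis Qb : forall u, G u -> Q (b u).
Hypothesis Qi : forall u, G u -> Q (i u).
Hypothesis QL : forall u, G u -> Q (L u).

Section One.
Variable f : V -> K.
Hypothesis Qf : forall u, G u -> Q (f u).

Lemma closed_s1 u : G u -> Q (s1_of i u).
Proof. by move=> Gu; apply: QM; auto. Qed.
Lemma closed_gamma1 u : G u -> Q (gamma1_of f u).
Proof. by move=> Gu; apply: QM; auto. Qed.
Lemma closed_b2 x y : good2 x y -> Q (b2_of f x y).
Proof.
move=> [Gx Gy Gxy]; apply: QM => //; apply: QD; apply: QM; auto.
by apply: Qf; rewrite -opprB; apply: GN.
Qed.
Lemma closed_gamma2 x y : good2 x y -> Q (gamma2_of f x y).
Proof.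
move=> xy; apply: QM => //; apply: QD; first by apply: QN; apply: closed_b2.
by apply: QM => //; apply: closed_circ11.
Qed.
Lemma closed_s1gamma1 x y : good2 x y -> Q (s1gamma1_of i f x y).
Proof. by apply: closed_circ11; [exact: closed_s1|exact: closed_gamma1]. Qed.

Lemma closed_Theta2 x y : good2 x y -> Q (Theta2_of i f x y).
Proof. by move=> xy; apply: QD; [exact: closed_gamma2|exact: closed_s1gamma1]. Qed.

Lemma closed_Theta3 x y z : good3 x y z -> Q (Theta3_of i f x y z).
Proof.
move=> xyz; apply: QD; first apply: QD; last apply: QD.
- apply: QM => //; apply: QB.
    by apply: closed_circ21 => //; apply: closed_b2.
  apply: QM => //; apply: closed_circ12 => // *; exact: closed_circ11.
- by apply: closed_circ12 => // *; [exact: closed_s1|exact: closed_gamma2].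
- apply: closed_circ21 => //; last exact: closed_gamma1.
  move=> u v [Gu Gv Guv]; apply: QM => //; apply: QD; apply: QM; auto.
  by apply: Qi; rewrite -opprB; apply: GN.
- apply: QM => //; apply: closed_circ12 => // *; [exact: closed_s1|exact: closed_s1gamma1].
Qed.
End One.

Lemma closed_Phi1 u : G u -> Q (Phi1_of b i u).
Proof. by move=> Gu; apply: QB; apply: closed_gamma1. Qed.

Lemma closed_brack11 (f g : V -> K) x y :
  (forall u, G u -> Q (f u)) -> (forall u, G u -> Q (g u)) -> good2 x y ->
  Q (brack11 f g x y).
Proof. by move=> *; apply: QB; apply: closed_circ11. Qed.

Lemma closed_uxi_neg1 u : G u -> Q (uxi_neg1_of i u).
Proof. by move=> Gu; apply: QM => //; apply: QM; apply: Qi. Qed.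

Lemma closed_C2 x y : good2 x y -> Q (C2_of i L x y).
Proof. by apply: closed_brack11 => //; exact: closed_uxi_neg1. Qed.

Lemma closed_C3 x y z : good3 x y z -> Q (C3_of i L x y z).
Proof.
have hq u v : good2 u v -> Q (brack11 (s1_of i) (uxi_neg1_of i) u v).
  by apply: closed_brack11; [exact: closed_s1|exact: closed_uxi_neg1].
have hL u v : good2 u v -> Q (brack11 (s1_of i) L u v).
  by apply: closed_brack11; [exact: closed_s1|exact: QL].
move=> xyz; apply: QD; apply: QB.
- by apply: closed_circ12 => //; exact: closed_uxi_neg1.
- by apply: closed_circ21 => //; exact: closed_uxi_neg1.
- exact: closed_circ21.
- exact: closed_circ12.
Qed.

Lemma closed_tau2 x y : good2 x y -> Q (tau2_of b i L x y).
Proof.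
by move=> xy; apply: QD; [apply: QB; apply: closed_Theta2|exact: closed_C2].
Qed.

Lemma closed_tau3 x y z : good3 x y z -> Q (tau3_of b i L x y z).
Proof.
move=> xyz; apply: QD; last exact: closed_C3.
apply: QD; first by apply: QB; apply: closed_Theta3.
by apply: closed_circ21 => //; [exact: closed_C2|exact: closed_Phi1].
Qed.
End Closed.

Section Coefficientwise.
Variables (F : fieldType) (q : F -> Prop).
Hypothesis qD : forall x y, q x -> q y -> q (x + y).
Hypothesis qM : forall x y, q x -> q y -> q (x * y).
Hypothesis q0 : q 0.
Definition coefwise (f : laurent F) := forall d, q (f d).
Lemma coefwiseD f g : coefwise f -> coefwise g -> coefwise (f + g).
Proof. by move=> qf qg d; rewrite lcoefD; apply: qD. Qed.
Lemma coefwiseM f g : coefwise f -> coefwise g -> coefwise (f * g).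
Proof.
move=> qf qg d; rewrite lcoefM; have [[A fA] [C gC]] := (below f, below g).
rewrite (@conv_sum _ A C (absz (d - A - C)%R).+1) //; last by lia.
by apply: (big_ind q) => // k _; apply: qM.
Qed.
Lemma coefwise_pure a c : q c -> coefwise (lpure a c).
Proof. by move=> qc d; rewrite /= /pure; case: eqP. Qed.
End Coefficientwise.

Section PolyDen.
Variable n : nat.
Local Notation P := {mpoly rat[n]}.
Local Notation F := (rfun n).

Lemma ispolyD (r s : F) : ispoly r -> ispoly s -> ispoly (r + s).
Proof. by move=> [p ->] [q ->]; exists (p + q); rewrite tofracD. Qed.
Lemma ispolyM (r s : F) : ispoly r -> ispoly s -> ispoly (r * s).
Proof. by move=> [p ->] [q ->]; exists (p * q); rewrite tofracM. Qed.
Lemma ispolyN (r : F) : ispoly r -> ispoly (- r).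
Proof. by move=> [p ->]; exists (- p); rewrite tofracN. Qed.
Lemma ispolyC c : ispoly (ratc n c).
Proof. by exists c%:MP. Qed.
Lemma ispoly0 : ispoly (0 : F).
Proof. by exists 0; rewrite tofrac0. Qed.
Lemma ispolyX (r : F) k : ispoly r -> ispoly (r ^+ k).
Proof. by move=> [p ->]; exists (p ^+ k); rewrite tofracXn. Qed.

(** The ring of polynomials localised at D. *)
Definition den (D : P) (r : F) := exists k, ispoly (tofrac (D ^+ k) * r).

Lemma den_poly D r : ispoly r -> den D r.
Proof. by exists 0%N; rewrite expr0 tofrac1 mul1r. Qed.
Lemma denM D r s : den D r -> den D s -> den D (r * s).
Proof.
move=> [k rk] [l sl]; exists (k + l)%N.
by rewrite exprD tofracM mulrACA; apply: ispolyM.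
Qed.
Lemma denD D r s : den D r -> den D s -> den D (r + s).
Proof.
move=> [k rk] [l sl]; exists (k + l)%N; rewrite exprD tofracM mulrDr.
apply: ispolyD; first by rewrite mulrAC; apply: ispolyM => //; exists (D ^+ l).
by rewrite -mulrA; apply: ispolyM => //; exists (D ^+ k).
Qed.
Lemma denX D r k : den D r -> den D (r ^+ k).
Proof.
move=> dr; elim: k => [|k IH]; last by rewrite exprS; apply: denM.
by apply: den_poly; exists 1; rewrite tofrac1.
Qed.

Definition divisor (D : P) (u : F) := exists U t, u = tofrac U /\ U * t = D.

Lemma divisorN D u : divisor D u -> divisor D (- u).
Proof.
by move=> [U [t [-> <-]]]; exists (- U), (- t); rewrite tofracN mulrNN.
Qed.

Lemma den_inv D u : D != 0 -> divisor D u -> den D u^-1.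
Proof.
move=> D0 [U [t [-> E]]]; exists 1%N; exists t; rewrite expr1 -E tofracM mulrAC divff ?mul1r //.
by rewrite tofrac_eq0; apply: contraNneq D0 => U0; rewrite -E U0 mul0r.
Qed.

Lemma den_exp D u d : D != 0 -> divisor D u -> den D (u ^ d).
Proof.
move=> D0 Du; case: d => k; rewrite /exprz; last first.
  by rewrite -exprVn; apply: denX; apply: den_inv.
by apply: denX; apply: den_poly; have [U [t [-> _]]] := Du; exists U.
Qed.

Lemma ispoly_psubst r (V : nat -> P) (v : 'I_r -> F) p :
  (forall k : 'I_r, v k = tofrac (V k)) -> psubst v p = tofrac (sub V p).
Proof. by move=> vV; rewrite -psubst_tofrac; congr psubst; apply/funext. Qed.
End PolyDen.

Section DenTau.
Variables (n : nat) (D : {mpoly rat[n]}).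
Hypothesis D0 : D != 0.
Local Notation K := (laurent (rfun n)).
Local Notation b := (bser (@ratc n)).
Local Notation i := (@inv_lin (rfun n)).
Local Notation L := (logser (@ratc n)).
Local Notation Q := (@coefwise (rfun n) (den D)).
Let dD := @denD n D.
Let dM := @denM n D.
Let dC c : den D (ratc n c). Proof. exact: den_poly (ispolyC n c). Qed.
Let d0 : den D 0. Proof. exact: den_poly (ispoly0 n). Qed.

Lemma Q_D f g : Q f -> Q g -> Q (f + g). Proof. exact: coefwiseD. Qed.
Lemma Q_M f g : Q f -> Q g -> Q (f * g). Proof. exact: coefwiseM. Qed.
Lemma Q_C c : Q (lconst (ratc n c)). Proof. exact: coefwise_pure. Qed.
Lemma Q_V k : Q k%:R^-1.
Proof. have := Q_C k%:R^-1; by rewrite fmorphV rmorph_nat lconstV lconst_nat. Qed.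
Lemma Q_N f : Q f -> Q (- f).
Proof. by move=> qf; rewrite -mulN1r; apply: Q_M => //; have := Q_C (-1); rewrite !rmorphN1. Qed.
Lemma Q_b u : divisor D u -> Q (b u).
Proof. by move=> Du d; rewrite serE; apply: dM; [exact: dC|exact: den_exp]. Qed.
Lemma Q_L u : divisor D u -> Q (L u).
Proof. by move=> Du d; rewrite serE; apply: dM; [exact: dC|exact: den_exp]. Qed.
Lemma Q_i u : divisor D u -> Q (i u).
Proof. by move=> Du; apply: coefwise_pure => //; apply: den_inv. Qed.

Lemma den_tau2 x y d : good2 (divisor D) x y -> den D (tau2_of b i L x y d).
Proof.
move=> xy; suff : Q (tau2_of b i L x y) by apply.
exact: (closed_tau2 (G := divisor D) Q_D Q_N Q_M Q_V (@divisorN n D) Q_b Q_i Q_L).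
Qed.
Lemma den_tau3 x y z d : good3 (divisor D) x y z -> den D (tau3_of b i L x y z d).
Proof.
move=> xy; suff : Q (tau3_of b i L x y z) by apply.
exact: (closed_tau3 (G := divisor D) Q_D Q_N Q_M Q_V (@divisorN n D) Q_b Q_i Q_L).
Qed.
End DenTau.

(** * Regularity along all hyperplanes *)
Lemma cancel_factor n (l : {mpoly rat[n]}) (U : nat -> {mpoly rat[n]}) r k :
  (exists V : nat -> {mpoly rat[n]}, sub V l != 0) -> sub U l = 0 ->
  (forall k : 'I_n, exists t, 'X_k - U k = l * t) ->
  regular U r -> ispoly (tofrac (l ^+ k) * r) -> ispoly r.
Proof.
move=> [V /sub_neq0 l0] Ul UX; apply: regular_cancelX => //.
exact: ker_sub.
Qed.

Ltac div0 := by exists 0; rewrite mulr0 ?subrr.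
Ltac div1 := by exists 1; rewrite mulr1 ?subr0.

Section Two.
Local Notation P := {mpoly rat[2]}.
Local Notation X1 := (coord 2 1).
Local Notation X2 := (coord 2 2).
Definition pt2 (a b : P) (j : nat) : P := nth 0 [:: a; b] j.
Definition at2 (f : rfun 2) a b := fsubst f (fun j : 'I_2 => tofrac (pt2 a b j)).

Lemma sub2E a b : (sub (pt2 a b) X1 = a) * (sub (pt2 a b) X2 = b).
Proof.
split.
- by rewrite (coordS (Ordinal (isT : 0 < 2)%N)) subX.
- by rewrite (coordS (Ordinal (isT : 1 < 2)%N)) subX.
Qed.

Lemma all2 (Q : nat -> P -> Prop) : Q 0 X1 -> Q 1 X2 -> forall k : 'I_2, Q k 'X_k.
Proof. by move=> q1 q2 k; rewrite -coordS; case: k => -[|[|]]. Qed.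
Lemma all2' (Q : nat -> Prop) : Q 0%N -> Q 1%N -> forall k : 'I_2, Q k.
Proof. by move=> q1 q2 [[|[|]]]. Qed.

(** The substitutions (a, b) and (a', b') are inverse to each other on one side. *)
Definition undo2 (a b a' b' : P) := sub (pt2 a' b') a = X1 /\ sub (pt2 a' b') b = X2.

Lemma indep2 a b a' b' : undo2 a b a' b' -> indep 2 (fun j => tofrac (pt2 a b j)).
Proof.
move=> [A B]; apply: (indep_tofrac (V' := pt2 a' b')).
exact: (all2 (Q := fun j x => sub (pt2 a' b') (pt2 a b j) = x)).
Qed.

Ltac calc := rewrite ?(subB, subD, sub2E) ?[sub _ 0]rmorph0; try by []; try ring.

Lemma transport2 a b a' b' f u1 u2 v1 v2 w1 w2 : undo2 a b a' b' ->
  u1 = sub (pt2 w1 w2) (sub (pt2 v1 v2) a) ->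
  u2 = sub (pt2 w1 w2) (sub (pt2 v1 v2) b) ->
  regular (pt2 u1 u2) f -> regular (pt2 v1 v2) (at2 f a b).
Proof.
move=> A E1 E2; apply: (regular_transport (W := pt2 w1 w2)).
  exact: indep2 A.
exact: (all2' (Q := fun j => pt2 u1 u2 j = sub (pt2 w1 w2) (sub (pt2 v1 v2) (pt2 a b j)))).
Qed.

Lemma transport2V a b a' b' f u1 u2 v1 v2 w1 w2 :
  undo2 a b a' b' -> undo2 a' b' a b ->
  u1 = sub (pt2 w1 w2) (sub (pt2 v1 v2) a') ->
  u2 = sub (pt2 w1 w2) (sub (pt2 v1 v2) b') ->
  regular (pt2 u1 u2) (at2 f a b) -> regular (pt2 v1 v2) f.
Proof.
move=> A A' E1 E2.
apply: (regular_transport_inv (W := pt2 w1 w2) (V' := pt2 a' b')).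
- exact: indep2 A.
- exact: indep2 A'.
- by have [A1 A2] := A; exact: (all2 (Q := fun j x => sub (pt2 a' b') (pt2 a b j) = x)).
- exact: (all2' (Q := fun j => pt2 u1 u2 j = sub (pt2 w1 w2) (sub (pt2 v1 v2) (pt2 a' b' j)))).
Qed.

Lemma undo2_12 : undo2 X1 X2 X1 X2. Proof. by split; calc. Qed.
Lemma undo2_21 : undo2 X2 X1 X2 X1. Proof. by split; calc. Qed.
Lemma undo2_s1 : undo2 X1 (X1 + X2) X1 (X2 - X1). Proof. by split; calc. Qed.
Lemma undo2_s2 : undo2 X2 (X1 + X2) (X2 - X1) X1. Proof. by split; calc. Qed.
Lemma undo2_s2V : undo2 (X2 - X1) X1 X2 (X1 + X2). Proof. by split; calc. Qed.

(** In each equation the terms other than one are regular along the hyperplane at hand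
and so is the right side; then the remaining term is regular too.  The stuffle
equation gives regularity along x1 = 0.  In the second term of the shuffle equation
x1 = 0 becomes the diagonal, while the first term is transported to x1 = 0. *)
Lemma regular_all2 f : regular (pt2 X1 0) f -> ispoly (f + at2 f X2 X1) ->
  ispoly (at2 f X1 (X1 + X2) + at2 f X2 (X1 + X2)) ->
  regular (pt2 0 X2) f /\ regular (pt2 X1 X1) f.
Proof.
move=> R2 [p stE] [q shE].
have R1 : regular (pt2 0 X2) f.
  apply: (regularDl _ (_ : regular _ (f + at2 f X2 X1))).
    by apply: (transport2 (w1 := 0) (w2 := X1) undo2_21 _ _ R2); calc.
  by rewrite stE; apply: regular_poly.
split; first exact: R1.
apply: (transport2V (w1 := X2) (w2 := 0) undo2_s2 undo2_s2V _ _ (_ : regular (pt2 0 X2) _));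
  [calc|calc|].
apply: (regularDl (s := at2 f X1 (X1 + X2))).
  by apply: (transport2 (w1 := 0) (w2 := X2) undo2_s1 _ _ R1); calc.
by rewrite addrC shE; apply: regular_poly.
Qed.
Lemma ispoly_all2 f :
  den (X1 * X2 * (X2 - X1)) f ->
  regular (pt2 X1 0) f -> regular (pt2 0 X2) f -> regular (pt2 X1 X1) f -> ispoly f.
Proof.
move=> [k]; rewrite !exprMn !tofracM -!mulrA => F R2 R1 R12.
apply: (cancel_factor (l := X2 - X1) (k := k) _ _ _ R12).
- by exists (pt2 0 1); calc; rewrite subr0 oner_neq0.
- by calc; rewrite subrr.
- by apply: (all2 (Q := fun j x => exists t, x - pt2 X1 X1 j = (X2 - X1) * t)); [div0|div1].
apply: (cancel_factor (l := X2) (U := pt2 X1 0) (k := k)).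
- by exists (pt2 0 1); calc; rewrite oner_neq0.
- by calc.
- by apply: (all2 (Q := fun j x => exists t, x - pt2 X1 0 j = X2 * t)); [div0|div1].
- by apply: regularM; [exact: regular_poly|exact: R2].
apply: (cancel_factor (l := X1) (U := pt2 0 X2) (k := k)) F.
- by exists (pt2 1 1); calc; rewrite oner_neq0.
- by calc.
- by apply: (all2 (Q := fun j x => exists t, x - pt2 0 X2 j = X1 * t)); [div1|div0].
- do 2 (apply: regularM; first exact: regular_poly); exact: R1.
Qed.
End Two.

Section Three.
Local Notation P := {mpoly rat[3]}.
Local Notation X1 := (coord 3 1).
Local Notation X2 := (coord 3 2).
Local Notation X3 := (coord 3 3).
Definition pt3 (a b c : P) (j : nat) : P := nth 0 [:: a; b; c] j.
Definition at3 (f : rfun 3) a b c := fsubst f (fun j : 'I_3 => tofrac (pt3 a b c j)).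

Lemma sub3E a b c : (sub (pt3 a b c) X1 = a) * (sub (pt3 a b c) X2 = b)
  * (sub (pt3 a b c) X3 = c).
Proof.
split; first split.
- by rewrite (coordS (Ordinal (isT : 0 < 3)%N)) subX.
- by rewrite (coordS (Ordinal (isT : 1 < 3)%N)) subX.
- by rewrite (coordS (Ordinal (isT : 2 < 3)%N)) subX.
Qed.

Lemma all3 (Q : nat -> P -> Prop) : Q 0 X1 -> Q 1 X2 -> Q 2 X3 ->
  forall k : 'I_3, Q k 'X_k.
Proof.
by move=> q1 q2 q3 k; rewrite -coordS; case: k => -[|[|[|]]].
Qed.
Lemma all3' (Q : nat -> Prop) : Q 0%N -> Q 1%N -> Q 2%N -> forall k : 'I_3, Q k.
Proof. by move=> q1 q2 q3 [[|[|[|]]]]. Qed.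

Lemma indep3 a b c a' b' c' : sub (pt3 a' b' c') a = X1 -> sub (pt3 a' b' c') b = X2 ->
  sub (pt3 a' b' c') c = X3 -> indep 3 (fun j => tofrac (pt3 a b c j)).
Proof. by move=> A B C; apply: (indep_tofrac (V' := pt3 a' b' c'));
apply: (all3 (Q := fun j x => sub (pt3 a' b' c') (pt3 a b c j) = x)). Qed.

(** The substitutions (a, b, c) and (a', b', c') are inverse to each other on one
side. *)
Definition undo3 (a b c a' b' c' : P) :=
 [/\ sub (pt3 a' b' c') a = X1, sub (pt3 a' b' c') b = X2 & sub (pt3 a' b' c') c = X3].

Ltac calc := rewrite ?(subB, subD, sub3E) ?[sub _ 0]rmorph0; try by []; try ring.

Lemma transport3 a b c a' b' c' f u1 u2 u3 v1 v2 v3 w1 w2 w3 :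
  undo3 a b c a' b' c' ->
  u1 = sub (pt3 w1 w2 w3) (sub (pt3 v1 v2 v3) a) ->
  u2 = sub (pt3 w1 w2 w3) (sub (pt3 v1 v2 v3) b) ->
  u3 = sub (pt3 w1 w2 w3) (sub (pt3 v1 v2 v3) c) ->
  regular (pt3 u1 u2 u3) f -> regular (pt3 v1 v2 v3) (at3 f a b c).
Proof.
move=> [A B C] E1 E2 E3; apply: (regular_transport (W := pt3 w1 w2 w3)).
  exact: indep3 A B C.
exact: (all3' (Q := fun j => pt3 u1 u2 u3 j =
  sub (pt3 w1 w2 w3) (sub (pt3 v1 v2 v3) (pt3 a b c j)))).
Qed.

Lemma transport3V a b c a' b' c' f u1 u2 u3 v1 v2 v3 w1 w2 w3 :
  undo3 a b c a' b' c' -> undo3 a' b' c' a b c ->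
  u1 = sub (pt3 w1 w2 w3) (sub (pt3 v1 v2 v3) a') ->
  u2 = sub (pt3 w1 w2 w3) (sub (pt3 v1 v2 v3) b') ->
  u3 = sub (pt3 w1 w2 w3) (sub (pt3 v1 v2 v3) c') ->
  regular (pt3 u1 u2 u3) (at3 f a b c) -> regular (pt3 v1 v2 v3) f.
Proof.
move=> [A B C] [A' B' C'] E1 E2 E3.
apply: (regular_transport_inv (W := pt3 w1 w2 w3) (V' := pt3 a' b' c')).
- exact: indep3 A B C.
- exact: indep3 A' B' C'.
- exact: (all3 (Q := fun j x => sub (pt3 a' b' c') (pt3 a b c j) = x)).
- exact: (all3' (Q := fun j => pt3 u1 u2 u3 j =
  sub (pt3 w1 w2 w3) (sub (pt3 v1 v2 v3) (pt3 a' b' c' j)))).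
Qed.

Ltac undo := by split; calc.

Lemma undo3_123 : undo3 X1 X2 X3 X1 X2 X3. Proof. undo. Qed.
Lemma undo3_132 : undo3 X1 X3 X2 X1 X3 X2. Proof. undo. Qed.
Lemma undo3_213 : undo3 X2 X1 X3 X2 X1 X3. Proof. undo. Qed.
Lemma undo3_231 : undo3 X2 X3 X1 X3 X1 X2. Proof. undo. Qed.
Lemma undo3_312 : undo3 X3 X1 X2 X2 X3 X1. Proof. undo. Qed.
Lemma undo3_s1 : undo3 X1 (X1 + X2) (X1 + X2 + X3) X1 (X2 - X1) (X3 - X2). Proof. undo. Qed.
Lemma undo3_s1V : undo3 X1 (X2 - X1) (X3 - X2) X1 (X1 + X2) (X1 + X2 + X3). Proof. undo. Qed.
Lemma undo3_s2 : undo3 X2 (X1 + X2) (X1 + X2 + X3) (X2 - X1) X1 (X3 - X2). Proof. undo. Qed.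
Lemma undo3_s3 : undo3 X2 (X2 + X3) (X1 + X2 + X3) (X3 - X2) X1 (X2 - X1). Proof. undo. Qed.
Lemma undo3_s3V : undo3 (X3 - X2) X1 (X2 - X1) X2 (X2 + X3) (X1 + X2 + X3). Proof. undo. Qed.

(** The depth three version.  From regularity along x3 = 0 the stuffle equation gives
x2 = 0 and then x1 = 0, the shuffle equation gives x1 = x2 and then x2 = x3, and the
stuffle equation again gives x1 = x3.  At each step the hyperplane is chosen so that
two of the three terms are transported to hyperplanes already treated and the third
one to the new hyperplane; w1, w2, w3 reparametrise the hyperplane. *)
Lemma regular_all3 f : regular (pt3 X1 X2 0) f ->
  ispoly (f + at3 f X2 X1 X3 + at3 f X2 X3 X1) ->
  ispoly (at3 f X1 (X1 + X2) (X1 + X2 + X3) + at3 f X2 (X1 + X2) (X1 + X2 + X3)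
     + at3 f X2 (X2 + X3) (X1 + X2 + X3)) ->
  [/\ regular (pt3 0 X2 X3) f, regular (pt3 X1 0 X3) f, regular (pt3 X1 X1 X3) f,
     regular (pt3 X1 X2 X2) f & regular (pt3 X1 X2 X1) f].
Proof.
move=> R3 [p stE] [q shE].
have st U : regular U (f + at3 f X2 X1 X3 + at3 f X2 X3 X1).
  by rewrite stE; apply: regular_poly.
have sh U : regular U (at3 f X1 (X1 + X2) (X1 + X2 + X3) + at3 f X2 (X1 + X2) (X1 + X2 + X3)
     + at3 f X2 (X2 + X3) (X1 + X2 + X3)).
  by rewrite shE; apply: regular_poly.
have R2 : regular (pt3 X1 0 X3) f.
  apply: (transport3V (w1 := X2) (w2 := 0) (w3 := X1) undo3_231 undo3_312 _ _ _
    (_ : regular (pt3 X1 X2 0) _)); [calc|calc|calc|].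
  apply: (regular_last (st _) R3).
  by apply: (transport3 (w1 := X2) (w2 := X1) (w3 := 0) undo3_213 _ _ _ R3); calc.
have R1 : regular (pt3 0 X2 X3) f.
  apply: (regular_first (st _)).
    by apply: (transport3 (w1 := 0) (w2 := X1) (w3 := X3) undo3_213 _ _ _ R2); calc.
  by apply: (transport3 (w1 := 0) (w2 := X1) (w3 := X2) undo3_231 _ _ _ R3); calc.
have R12 : regular (pt3 X1 X1 X3) f.
  apply: (transport3V (w1 := X1) (w2 := 0) (w3 := X3 + X1) undo3_s1 undo3_s1V _ _ _
    (_ : regular (pt3 X1 0 X3) _)); [calc|calc|calc|].
  apply: (regular_first (sh _)).
    by apply: (transport3 (w1 := X2) (w2 := 0) (w3 := X3 - X2) undo3_s2 _ _ _ R1); calc.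
  by apply: (transport3 (w1 := X3 - X2) (w2 := 0) (w3 := X2) undo3_s3 _ _ _ R1); calc.
have R23 : regular (pt3 X1 X2 X2) f.
  apply: (transport3V (w1 := X2) (w2 := X3 + X2) (w3 := 0) undo3_s3 undo3_s3V _ _ _
    (_ : regular (pt3 0 X2 X3) _)); [calc|calc|calc|].
  apply: (regular_last (sh _)).
    by apply: (transport3 (w1 := 0) (w2 := X2) (w3 := X3 - X2) undo3_s1 _ _ _ R1); calc.
  by apply: (transport3 (w1 := 0) (w2 := X1) (w3 := X3 - X1) undo3_s2 _ _ _ R12); calc.
have R13 : regular (pt3 X1 X2 X1) f.
  apply: (regular_first (st _)).
    by apply: (transport3 (w1 := X2) (w2 := X1) (w3 := 0) undo3_213 _ _ _ R23); calc.
  by apply: (transport3 (w1 := X2) (w2 := X1) (w3 := 0) undo3_231 _ _ _ R23); calc.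
by split; [exact: R1|exact: R2|exact: R12|exact: R23|exact: R13].
Qed.
Lemma ispoly_all3 f :
  den (X1 * X2 * X3 * (X2 - X1) * (X3 - X2) * (X3 - X1)) f ->
  regular (pt3 X1 X2 0) f ->
  [/\ regular (pt3 0 X2 X3) f, regular (pt3 X1 0 X3) f, regular (pt3 X1 X1 X3) f,
     regular (pt3 X1 X2 X2) f & regular (pt3 X1 X2 X1) f] -> ispoly f.
Proof.
move=> [k]; rewrite !exprMn !tofracM -!mulrA => F R3 [R1 R2 R12 R23 R13].
have n01 : sub (pt3 0 1 2) (X2 - X1) != 0 by calc; rewrite subr0 oner_neq0.
have n12 : sub (pt3 0 0 1) (X3 - X2) != 0 by calc; rewrite subr0 oner_neq0.
have n02 : sub (pt3 0 0 1) (X3 - X1) != 0 by calc; rewrite subr0 oner_neq0.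
have n0 : sub (pt3 1 1 1) X1 != 0 by calc; rewrite oner_neq0.
have n1 : sub (pt3 1 1 1) X2 != 0 by calc; rewrite oner_neq0.
have n2 : sub (pt3 1 1 1) X3 != 0 by calc; rewrite oner_neq0.
have RM U l r : regular U r -> regular U (tofrac l * r).
  by apply: regularM; apply: regular_poly.
apply: (cancel_factor (l := X3 - X1) (k := k) _ _ _ R13); [by eexists; apply: n02| | |].
- by calc; rewrite subrr.
- by apply: (all3 (Q := fun j x => exists t, x - pt3 X1 X2 X1 j = (X3 - X1) * t)); [div0|div0|div1].
apply: (cancel_factor (l := X3 - X2) (U := pt3 X1 X2 X2) (k := k)); [by eexists; apply: n12| | | |].
- by calc; rewrite subrr.
- by apply: (all3 (Q := fun j x => exists t, x - pt3 X1 X2 X2 j = (X3 - X2) * t)); [div0|div0|div1].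
- apply: (RM); exact: R23.
apply: (cancel_factor (l := X2 - X1) (U := pt3 X1 X1 X3) (k := k)); [by eexists; apply: n01| | | |].
- by calc; rewrite subrr.
- by apply: (all3 (Q := fun j x => exists t, x - pt3 X1 X1 X3 j = (X2 - X1) * t)); [div0|div1|div0].
- apply: (RM); apply: (RM); exact: R12.
apply: (cancel_factor (l := X3) (U := pt3 X1 X2 0) (k := k)); [by eexists; apply: n2| | | |].
- by calc.
- by apply: (all3 (Q := fun j x => exists t, x - pt3 X1 X2 0 j = X3 * t)); [div0|div0|div1].
- apply: (RM); apply: (RM); apply: (RM); exact: R3.
apply: (cancel_factor (l := X2) (U := pt3 X1 0 X3) (k := k)); [by eexists; apply: n1| | | |].
- by calc.
- by apply: (all3 (Q := fun j x => exists t, x - pt3 X1 0 X3 j = X2 * t)); [div0|div1|div0].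
- apply: (RM); apply: (RM); apply: (RM); apply: (RM); exact: R2.
apply: (cancel_factor (l := X1) (U := pt3 0 X2 X3) (k := k)) F; [by eexists; apply: n0| | |].
- by calc.
- by apply: (all3 (Q := fun j x => exists t, x - pt3 0 X2 X3 j = X1 * t)); [div1|div0|div0].
- apply: (RM); apply: (RM); apply: (RM); apply: (RM); apply: (RM); exact: R1.
Qed.
End Three.

(** * The equations and the power series property *)
Section Evaluation.
Variable n : nat.

Lemma xvarE j : xvar n j.+1 = tofrac (coord n j.+1).
Proof. by rewrite /xvar /coord; case: insub => //; rewrite tofrac0. Qed.

Lemma hsubst_eval r (f : hsum r) T (v : seq (rfun n)) : evaluates f T ->
  indep r (fun j => v`_j) -> hsubst f v = lcoef (T (nth 0 (0 :: v))).
Proof.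
move=> [_ fT] vi; apply/funext => d.
have zi : indep r (dif (nth 0 (0 :: v))).
  rewrite (_ : dif _ = (fun j => v`_j)) //.
  by apply/funext => j; rewrite /dif /= subr0.
have := fT _ 1 zi (oner_neq0 _) d; rewrite rmorph1 exp1rz mul1r.
rewrite (_ : (fun j => 1 * _) = nth 0 (0 :: v)); last by apply/funext => j; rewrite mul1r.
move=> <-; rewrite /hsubst /tinv; congr fsubst.
by apply/funext => j; rewrite /= subr0.
Qed.

(** Homogeneity comes for free from evaluation: doubling the arguments multiplies the
component of degree d by 2^d, hence all its monomials have degree d. *)
Lemma is_pseries_poly (f : hsum n) (T : (nat -> rfun n) -> laurent (rfun n)) :
  evaluates f T -> (forall d, ispoly (f d)) -> is_pseries f.
Proof.
move=> [_ fT] fp.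
have sub1 : forall p, psubst (fun j : 'I_n => dif (xvar n) j) p = tofrac p.
  move=> p; rewrite -[p in RHS]sub_id -psubst_tofrac; congr psubst.
  by apply/funext => j; rewrite /dif subr0 xvarE coordS valK.
pose z j := ratc n 2 * xvar n j.
have zE : (fun j : 'I_n => dif z j) = (fun j : 'I_n => tofrac (2%:MP * coord n j.+1)).
  by apply/funext => j; rewrite /dif /z mulr0 subr0 xvarE tofracM.
have zi : indep n (dif z).
  move=> p; rewrite zE (psubst_tofrac (fun j => 2%:MP * coord n j.+1)) => /eqP.
  rewrite tofrac_eq0 => /eqP /(congr1 (sub (fun j => (2^-1)%:MP * coord n j.+1))).
  rewrite sub_sub [RHS]rmorph0 => <-; rewrite -[LHS]sub_id; apply: sub_ext => k.
  by rewrite subM subC coordS subX coordS valK mulrA -mpolyCM mulfV // mul1r.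
suff H d (p : {mpoly rat[n]}) : f d = tofrac p -> forall m, m \in msupp p -> d = (mdeg m)%:Z.
  case=> k; [have [p E] := fp (Posz k) | have [p E] := fp (Negz k)].
    by exists p => //; apply/dhomogP => m /(H _ _ E) [->].
  rewrite E; suff -> : p = 0 by rewrite tofrac0.
  apply/eqP; rewrite -msupp_eq0; have {H} := H _ _ E; case: (msupp p) => // m s H.
  by have := H m (mem_head _ _).
move=> fdp m mp.
have E : ratc n 2 ^ d * tofrac p = tofrac (sub (fun j => 2%:MP * coord n j.+1) p).
  have := fT (xvar n) 2 (indep_xvar (n := n)) (isT : 2 != 0 :> rat) d.
  have := fT z 1 zi (oner_neq0 _) d; rewrite rmorph1 exp1rz mul1r.
  rewrite (_ : (fun j => 1 * z j) = z); last by apply/funext => j; rewrite mul1r.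
  rewrite -[(fun j => ratc n 2 * xvar n j)]/z => <-.
  have tE (y : nat -> rfun n) : indep n (dif y) ->
    tinv (tofrac p) y = psubst (fun j : 'I_n => dif y j) p.
    by move=> yi; exact: fsubst_tofrac.
  rewrite fdp (tE z zi) (tE (xvar n) (@indep_xvar n)) sub1 zE.
  by rewrite (psubst_tofrac (fun j => 2%:MP * coord n j.+1)).
have {}E : ((2 : rat) ^ d)%:MP * p = sub (fun j => 2%:MP * coord n j.+1) p.
  by apply/eqP; rewrite -tofrac_eq tofracM -E -fmorphXz.
have {E} := congr1 (mcoeff m) E; rewrite mcoeffCM.
have -> : sub (fun j => 2%:MP * coord n j.+1) p =
   \sum_(m' <- msupp p) (p@_m' * 2 ^+ mdeg m') *: 'X_[m'].
  apply: eq_bigr => m' _; rewrite -mul_mpolyC mpolyCM -mulrA; congr (_ * _).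
  rewrite mdegE -prodrXr rmorph_prod mpolyXE_id -big_split; apply: eq_bigr => k _.
  by rewrite coordS exprMn rmorphXn.
rewrite raddf_sum (bigD1_seq m) //= mcoeffZ mcoeffX eqxx mulr1.
rewrite big1 ?addr0 => [|m' m'm]; last by rewrite mcoeffZ mcoeffX (negPf m'm) mulr0.
rewrite mulrC; move: mp; rewrite mcoeff_msupp => pm /(mulfI pm).
by rewrite -[2 ^+ _]/(2 ^ (mdeg m)%:Z); apply: ieexprIz.
Qed.
End Evaluation.

Section Values.
Variable n : nat.
Local Notation K := (laurent (rfun n)).
Local Notation b := (bser (@ratc n)).
Local Notation i := (@inv_lin (rfun n)).
Local Notation L := (logser (@ratc n)).

Definition fs2 : hsum 2 := tau2 + hpure 0 (ratc 2 48^-1).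
Definition fs3 : hsum 3 :=
  tau3 - 96^-1 *: (hsubst b1 [:: xvar 3 1] - hpure (-1) (xvar 3 1)^-1).
(** The constant of the addition formula of b. *)
Definition kappa : K := 4^-1.

Lemma evaluates_const r c : evaluates (hpure 0 (ratc r c) : hsum r) (fun=> lconst (ratc n c)).
Proof.
split; first by exists 0 => d d0; rewrite /hpure lt_eqF.
move=> z l zi l0 d; have [phi [phiE phic _]] := fsubst_hom zi.
rewrite /tinv phiE /hpure /= /pure; case: eqP => [->|_].
  by rewrite expr0z mul1r phic.
by rewrite rmorph0 mulr0.
Qed.

Lemma evaluates_fs2 : (2 <= n)%N -> evaluates fs2 (inv2 (tau2s_of b i L kappa)).
Proof.
move=> n2; apply: evaluates_eq (evaluatesD (evaluates_tau2 n2) (evaluates_const 2 48^-1)) _.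
move=> z; rewrite /inv2 /tau2s_of /kappa -(const48 (@ratc n)).
by rewrite fmorphV rmorph_nat lconstV lconst_nat.
Qed.

Lemma evaluates_fs3 : (3 <= n)%N -> evaluates fs3 (inv3 (tau3s_of b i L kappa)).
Proof.
move=> n3.
have e1 : evaluates (hsubst b1 [:: xvar 3 1]) (fun z => b (z 1%N - z 0%N)).
  have := evaluates_sub (m := 3) (h := id) _ _ (evaluates_b1 n).
  move=> /(_ _ _)/evaluates_eq => /(_ (fun z => b (z 1%N - z 0%N))) H.
  rewrite (_ : hsubst _ _ = (fun d => tinv (b1 d) (fun j => xvar 3 j))).
    apply: H => // j; lia.
  apply/funext => d; rewrite /hsubst /tinv; congr fsubst.
  by apply/funext => j; rewrite ord1 /= subr0.
have e2 : evaluates (hpure (-1) (xvar 3 1)^-1 : hsum 3) (fun z => i (z 1%N - z 0%N)).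
  split; first by exists (-1) => d d0; rewrite /hpure lt_eqF.
  move=> z l zi l0 d; have [phi [phiE phic phiX]] := fsubst_hom zi.
  rewrite /tinv phiE /hpure /= /pure; case: eqP => [->|_]; last by rewrite rmorph0 mulr0.
  by rewrite -mulrBr invfM fmorphV /= (insubT (fun x => x < 3)%N (isT : 0 < 3)%N) phiX.
apply: evaluates_eq (evaluatesB (evaluates_tau3 n3) (evaluatesV 96 (evaluatesB e1 e2))) _.
by move=> z; rewrite /inv3 /tau3s_of /kappa -(const96 (@ratc n)).
Qed.

Lemma inv1_nth F u : @inv1 n F (nth 0 [:: 0; u]) = F u.
Proof. by rewrite /inv1 /= !subr0. Qed.
Lemma inv2_nth F u v : @inv2 n F (nth 0 [:: 0; u; v]) = F u v.
Proof. by rewrite /inv2 /= !subr0. Qed.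
Lemma inv3_nth F u v w : @inv3 n F (nth 0 [:: 0; u; v; w]) = F u v w.
Proof. by rewrite /inv3 /= !subr0. Qed.

Lemma hsubst_tau1 u : (1 <= n)%N -> indep 1 (fun j => [:: u]`_j) ->
  hsubst tau1 [:: u] = lcoef (tau1_of b i u).
Proof.
move=> n1 ui; rewrite (hsubst_eval (evaluates_tau1 n) ui).
by rewrite inv1_nth.
Qed.
Lemma hsubst_tau2 u v : (2 <= n)%N -> indep 2 (fun j => [:: u; v]`_j) ->
  hsubst tau2 [:: u; v] = lcoef (tau2_of b i L u v).
Proof.
move=> n2 ui; rewrite (hsubst_eval (evaluates_tau2 n2) ui).
by rewrite inv2_nth.
Qed.
Lemma hsubst_fs2 u v : (2 <= n)%N -> indep 2 (fun j => [:: u; v]`_j) ->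
  hsubst fs2 [:: u; v] = lcoef (tau2s_of b i L kappa u v).
Proof.
move=> n2 ui; rewrite (hsubst_eval (evaluates_fs2 n2) ui).
by rewrite inv2_nth.
Qed.
Lemma hsubst_tau3 u v w : (3 <= n)%N -> indep 3 (fun j => [:: u; v; w]`_j) ->
  hsubst tau3 [:: u; v; w] = lcoef (tau3_of b i L u v w).
Proof.
move=> n3 ui; rewrite (hsubst_eval (evaluates_tau3 n3) ui).
by rewrite inv3_nth.
Qed.
Lemma hsubst_fs3 u v w : (3 <= n)%N -> indep 3 (fun j => [:: u; v; w]`_j) ->
  hsubst fs3 [:: u; v; w] = lcoef (tau3s_of b i L kappa u v w).
Proof.
move=> n3 ui; rewrite (hsubst_eval (evaluates_fs3 n3) ui).
by rewrite inv3_nth.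
Qed.

Local Notation Pl := (coefwise (@ispoly n)).
Lemma PlD f g : Pl f -> Pl g -> Pl (f + g).
Proof. by apply: coefwiseD; exact: ispolyD. Qed.
Lemma PlM f g : Pl f -> Pl g -> Pl (f * g).
Proof. by apply: coefwiseM; [exact: ispolyD|exact: ispolyM|exact: ispoly0]. Qed.
Lemma PlC c : Pl (lconst (ratc n c)).
Proof. by apply: coefwise_pure; [exact: ispoly0|exact: ispolyC]. Qed.
Lemma PlN f : Pl f -> Pl (- f).
Proof. by move=> fp d; rewrite lcoefN; apply: ispolyN. Qed.
Lemma PlV k : Pl k%:R^-1.
Proof. by have := PlC k%:R^-1; rewrite fmorphV rmorph_nat lconstV lconst_nat. Qed.
Lemma Pl_bser_sub (u : rfun n) : ispoly u -> Pl (b u - i u).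
Proof.
move=> up d; rewrite lcoefD lcoefN serE /b_coefs lcoefD bern_coefsE /= /pure.
case: d => [k|[|k]] /=.
- rewrite subr0; apply: ispolyM; last exact: ispolyX.
  exact: ispolyC.
- rewrite addr0 /bcoef /psinv /= big_ord0 subr0 invr1 divr1 rmorph1 mul1r.
  by rewrite -[X in X - _]/(u^-1) subrr; apply: ispoly0.
- by rewrite addr0 rmorph0 mul0r subr0; apply: ispoly0.
Qed.

Lemma Pl_tau1 (u : rfun n) : ispoly u -> Pl (tau1_of b i u).
Proof.
move=> up; rewrite (_ : tau1_of b i u = 2^-1 * - (b u - i u)); last exact: Phi1E.
by apply: PlM; [exact: PlV|apply: PlN; exact: Pl_bser_sub].
Qed.

Lemma quot_poly r (p : {mpoly rat[r]}) (U V : nat -> {mpoly rat[n]}) (l : {mpoly rat[n]}) :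
  (forall k : 'I_r, exists t, U k - V k = l * t) -> l != 0 ->
  ispoly ((tofrac (sub U p) - tofrac (sub V p)) * (tofrac l)^-1).
Proof.
move=> UV l0; have [q E] := sub_cong p UV; exists q.
by rewrite -tofracB E tofracM mulrAC divff ?mul1r // tofrac_eq0.
Qed.

Lemma Pl_quot r (f : hsum r) (U V : nat -> {mpoly rat[n]}) (l : {mpoly rat[n]}) (f1 f2 : K) :
  (forall d, ispoly (f d)) -> indep r (fun j => tofrac (U j)) -> indep r (fun j => tofrac (V j)) ->
  (forall d, f1 d = fsubst (f d) (fun j : 'I_r => tofrac (U j))) ->
  (forall d, f2 d = fsubst (f d) (fun j : 'I_r => tofrac (V j))) ->
  (forall k : 'I_r, exists t, U k - V k = l * t) -> l != 0 ->
  Pl ((f1 - f2) * i (tofrac l)).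
Proof.
move=> fp Ui Vi E1 E2 UV l0 d; rewrite mulrC lcoefM conv_pure lcoefD lcoefN E1 E2.
have [p ->] := fp (d - -1); rewrite (fsubst_tofrac Ui) (fsubst_tofrac Vi).
by rewrite (psubst_tofrac U) (psubst_tofrac V) mulrC; apply: quot_poly.
Qed.
End Values.

Lemma ispoly_tau1 d : ispoly (tau1 d).
Proof.
have xi : indep 1 (fun j => [:: xvar 1 1]`_j).
  by apply: indep_ext (indep_xvar (n := 1)) => -[|//] _; rewrite /dif subr0.
rewrite -[tau1 d](@fsubst_id _ _ (fun j => [:: xvar 1 1]`_j)); last first.
  by move=> k; rewrite ord1 -coordS -xvarE.
rewrite -[fsubst _ _]/(hsubst tau1 [:: xvar 1 1] d) hsubst_tau1 //.
by apply: Pl_tau1; rewrite xvarE; eexists.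
Qed.

Section DepthTwo.
Local Notation X1 := (coord 2 1).
Local Notation X2 := (coord 2 2).
Local Notation b := (bser (@ratc 2)).
Local Notation i := (@inv_lin (rfun 2)).
Local Notation L := (logser (@ratc 2)).
Local Notation x1 := (tofrac X1).
Local Notation x2 := (tofrac X2).
Let K0 := lchar0 (@ratc 2).
Let b_odd := bser_odd (@ratc 2).
Let i_odd := @inv_lin_odd (rfun 2).
Let logser_even := logser_even (@ratc 2).

Let seq2 (u v : {mpoly rat[2]}) j : [:: tofrac u; tofrac v]`_j = tofrac (pt2 u v j).
Proof. by case: j => [|[|j]] //=; rewrite /pt2 /= !nth_nil tofrac0. Qed.

Let ind2 u v u' v' : undo2 u v u' v' -> indep 2 (fun j => [:: tofrac u; tofrac v]`_j).
Proof. by move=> /indep2; apply: indep_ext => j _; rewrite seq2. Qed.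
Let ind1 u v u' v' : undo2 u v u' v' -> indep 1 (fun j => [:: tofrac u]`_j).
Proof.
move=> /ind2 /(indep_le (isT : (1 <= 2)%N)).
by apply: indep_ext => -[].
Qed.

Lemma shuffle2_tau : shuffle2 tau1 tau2.
Proof.
rewrite /shuffle2 !xvarE -!tofracD (@hsubst_tau2 2 _ _ isT (ind2 undo2_s1)).
rewrite (@hsubst_tau2 2 _ _ isT (ind2 undo2_s2)).
rewrite (@hsubst_tau1 2 _ isT (ind1 undo2_12)) (@hsubst_tau1 2 _ isT (ind1 undo2_21)) !tofracD.
have E := sh2_tau K0 L b_odd i_odd x1 x2.
by apply/funext => d; apply: (congr1 (fun f : laurent _ => f d) E).
Qed.

Let x1_0 : x1 != 0.
Proof. by rewrite tofrac_eq0; apply: (sub_neq0 (U := pt2 1 1)); rewrite sub2E oner_neq0. Qed.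
Let x2_0 : x2 != 0.
Proof. by rewrite tofrac_eq0; apply: (sub_neq0 (U := pt2 1 1)); rewrite sub2E oner_neq0. Qed.
Let x12_0 : x1 - x2 != 0.
Proof. by apply: (sub_neq0_diff (V := pt2 1 0)); rewrite subB !sub2E subr0 oner_neq0. Qed.

Let st2E := st2_tau K0 b_odd i_odd logser_even (@bser_add _ (@ratc 2))
  (@inv_lin_add (rfun 2)) x1_0 x2_0 x12_0.

Lemma stuffle2_tau : stuffle2 tau1 fs2.
Proof.
rewrite /stuffle2 !xvarE (@hsubst_fs2 2 _ _ isT (ind2 undo2_12)).
rewrite (@hsubst_fs2 2 _ _ isT (ind2 undo2_21)).
rewrite (@hsubst_tau1 2 _ isT (ind1 undo2_12)) (@hsubst_tau1 2 _ isT (ind1 undo2_21)).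
by apply/funext => d; apply: (congr1 (fun f : laurent _ => f d) st2E).
Qed.

Let at2E u v u' v' d : undo2 u v u' v' -> at2 (tau2 d) u v = tau2_of b i L (tofrac u) (tofrac v) d.
Proof.
move=> w; rewrite -(@hsubst_tau2 2 _ _ isT (ind2 w)).
rewrite /at2 /hsubst; congr fsubst; apply/funext => j; by rewrite seq2.
Qed.

Let tau2E d : tau2 d = tau2_of b i L x1 x2 d.
Proof.
rewrite -(at2E d undo2_12) /at2 fsubst_id // => k; move: k.
exact: (all2 (Q := fun j x => tofrac (pt2 X1 X2 j) = tofrac x :> rfun 2)).
Qed.

(** The residue along x2 = 0 vanishes, and the sums of tau2 on the left of the two
equations are polynomial because the right sides only contain tau1; this gives
regularity along the three lines where tau2 may have poles. *)
Lemma ispoly_tau2 d : ispoly (tau2 d).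
Proof.
have X2_0 : X2 != 0 by rewrite -tofrac_eq0.
have R2 : regular (pt2 X1 0) (tau2 d).
  have S1 : place (pt2 X1 0) x1 x1 by have := place_poly (pt2 X1 0) X1; rewrite sub2E.
  have S2 : place (pt2 X1 0) x2 0 by have := place_poly (pt2 X1 0) X2; rewrite sub2E tofrac0.
  have := res_tau2 (rho := @ratc 2) (@placeD _ (pt2 X1 0)) (@placeM _ _) (@placeC _ _) (@placeV _ _)
    S2 x2_0 S1 x1_0 (d + 1).
  rewrite lcoefM conv_pure addrK -tau2E; apply: place0_regular => //.
    by rewrite sub2E.
  apply: ker_sub.
  apply: (all2 (Q := fun j x => exists t, x - pt2 X1 0 j = X2 * t)).
    by exists 0; rewrite mulr0 subrr.
  by exists 1; rewrite mulr1 subr0.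
have [R1 R12] : regular (pt2 0 X2) (tau2 d) /\ regular (pt2 X1 X1) (tau2 d).
  apply: regular_all2 => //.
    rewrite (at2E d undo2_21) tau2E -lcoefD.
    suff : coefwise (@ispoly 2) (tau2_of b i L x1 x2 + tau2_of b i L x2 x1) by apply.
    have Pk : coefwise (@ispoly 2) (kappa 2 / 12) by apply: PlM; apply: PlV.
    have -> : tau2_of b i L x1 x2 + tau2_of b i L x2 x1 =
      quot2 i (tau1_of b i) x1 x2 + tau1_of b i x1 * tau1_of b i x2 - (kappa 2 / 12 + kappa 2 / 12).
      by rewrite -st2E; exact: st2_tau2E.
    have P1 : coefwise (@ispoly 2) (tau1_of b i x1) by apply: Pl_tau1; eexists.
    have P2 : coefwise (@ispoly 2) (tau1_of b i x2) by apply: Pl_tau1; eexists.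
    apply: PlD; last by apply: PlN; apply: PlD.
    apply: PlD; last by apply: PlM.
    rewrite /quot2 -tofracB; have hE u u' v v' e : undo2 u v u' v' ->
      tau1_of b i (tofrac u) e = fsubst (tau1 e) (fun j : 'I_1 => tofrac u).
      move=> w; rewrite -(@hsubst_tau1 2 _ isT (ind1 w)).
      by rewrite /hsubst; congr fsubst; apply/funext => j; rewrite ord1.
    have i1 u u' v v' : undo2 u v u' v' -> indep 1 (fun=> tofrac u).
      by move=> w; apply: indep_ext (ind1 w) => -[].
    apply: (Pl_quot (U := fun=> X1) (V := fun=> X2) ispoly_tau1).
    - exact: i1 undo2_12.
    - exact: i1 undo2_21.
    - by move=> e; apply: hE undo2_12.
    - by move=> e; apply: hE undo2_21.
    - by move=> k; exists (-1); rewrite mulrN1 opprB.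
    - by rewrite -tofrac_eq0 tofracB -opprB oppr_eq0.
  rewrite (at2E d undo2_s1) (at2E d undo2_s2) !tofracD -lcoefD.
  have := sh2_tau K0 L b_odd i_odd x1 x2; rewrite /sh2 => ->.
  by apply: PlM; apply: Pl_tau1; eexists.
apply: ispoly_all2 => //; rewrite tau2E; apply: den_tau2.
  apply: mulf_neq0; first by apply: mulf_neq0 X2_0; rewrite -tofrac_eq0.
  by apply: (sub_neq0 (U := pt2 0 1)); rewrite subB !sub2E subr0 oner_neq0.
split.
- by exists X1, (X2 * (X2 - X1)); rewrite mulrA.
- by exists X2, (X1 * (X2 - X1)); split=> //; rewrite mulrA (mulrC X2).
- by exists (X2 - X1), (X1 * X2); rewrite tofracB mulrC.
Qed.
End DepthTwo.

Section DepthThree.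
Local Notation X1 := (coord 3 1).
Local Notation X2 := (coord 3 2).
Local Notation X3 := (coord 3 3).
Local Notation b := (bser (@ratc 3)).
Local Notation i := (@inv_lin (rfun 3)).
Local Notation L := (logser (@ratc 3)).
Local Notation x1 := (tofrac X1).
Local Notation x2 := (tofrac X2).
Local Notation x3 := (tofrac X3).
Let K0 := lchar0 (@ratc 3).
Let b_odd := bser_odd (@ratc 3).
Let i_odd := @inv_lin_odd (rfun 3).
Let logser_even := logser_even (@ratc 3).

Let seq3 (u v w : {mpoly rat[3]}) j : [:: tofrac u; tofrac v; tofrac w]`_j = tofrac (pt3 u v w j).
Proof. by case: j => [|[|[|j]]] //=; rewrite /pt3 /= !nth_nil tofrac0. Qed.

Let ind3 u v w u' v' w' : undo3 u v w u' v' w' ->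
  indep 3 (fun j => [:: tofrac u; tofrac v; tofrac w]`_j).
Proof. by case=> A B C; apply: indep_ext (indep3 A B C) => j _; rewrite seq3. Qed.
Let ind2 u v w u' v' w' : undo3 u v w u' v' w' -> indep 2 (fun j => [:: tofrac u; tofrac v]`_j).
Proof.
move=> /ind3 /(indep_le (isT : (2 <= 3)%N)).
by apply: indep_ext => -[|[]].
Qed.
Let ind1 u v w u' v' w' : undo3 u v w u' v' w' -> indep 1 (fun j => [:: tofrac u]`_j).
Proof.
move=> /ind3 /(indep_le (isT : (1 <= 3)%N)).
by apply: indep_ext => -[].
Qed.

Let sh3E := sh3_tau K0 b_odd i_odd logser_even x1 x2 x3.

Lemma shuffle3_tau : shuffle3 tau1 tau2 tau3.
Proof.
rewrite /shuffle3 !xvarE -!tofracD (@hsubst_tau3 3 _ _ _ isT (ind3 undo3_s1)).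
rewrite (@hsubst_tau3 3 _ _ _ isT (ind3 undo3_s2)) (@hsubst_tau3 3 _ _ _ isT (ind3 undo3_s3)).
rewrite (@hsubst_tau1 3 _ isT (ind1 undo3_123)) (@hsubst_tau2 3 _ _ isT (ind2 undo3_s3)) !tofracD.
by apply/funext => d; apply: (congr1 (fun f : laurent _ => f d) sh3E).
Qed.

Let X1_0 : X1 != 0.
Proof. by apply: (sub_neq0 (U := pt3 1 1 1)); rewrite sub3E oner_neq0. Qed.
Let X2_0 : X2 != 0.
Proof. by apply: (sub_neq0 (U := pt3 1 1 1)); rewrite sub3E oner_neq0. Qed.
Let X3_0 : X3 != 0.
Proof. by apply: (sub_neq0 (U := pt3 1 1 1)); rewrite sub3E oner_neq0. Qed.
Let X21_0 : X2 - X1 != 0.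
Proof. by apply: (sub_neq0 (U := pt3 0 1 1)); rewrite subB !sub3E subr0 oner_neq0. Qed.
Let X32_0 : X3 - X2 != 0.
Proof. by apply: (sub_neq0 (U := pt3 0 0 1)); rewrite subB !sub3E subr0 oner_neq0. Qed.
Let X31_0 : X3 - X1 != 0.
Proof. by apply: (sub_neq0 (U := pt3 0 0 1)); rewrite subB !sub3E subr0 oner_neq0. Qed.
Let x1_0 : x1 != 0. Proof. by rewrite tofrac_eq0. Qed.
Let x2_0 : x2 != 0. Proof. by rewrite tofrac_eq0. Qed.
Let x3_0 : x3 != 0. Proof. by rewrite tofrac_eq0. Qed.
Let x21_0 : x2 - x1 != 0. Proof. by rewrite -tofracB tofrac_eq0. Qed.
Let x12_0 : x1 - x2 != 0. Proof. by rewrite -opprB oppr_eq0. Qed.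
Let x13_0 : x1 - x3 != 0. Proof. by rewrite -opprB oppr_eq0 -tofracB tofrac_eq0. Qed.
Let x23_0 : x2 - x3 != 0. Proof. by rewrite -opprB oppr_eq0 -tofracB tofrac_eq0. Qed.

Let st3E := st3_tau K0 b_odd i_odd logser_even (@bser_add _ (@ratc 3)) (@inv_lin_add (rfun 3))
  x1_0 x2_0 x3_0 x12_0 x13_0 x23_0.

Lemma stuffle3_tau : stuffle3 tau1 fs2 fs3.
Proof.
rewrite /stuffle3 !xvarE (@hsubst_fs3 3 _ _ _ isT (ind3 undo3_123)).
rewrite (@hsubst_fs3 3 _ _ _ isT (ind3 undo3_213)) (@hsubst_fs3 3 _ _ _ isT (ind3 undo3_231)).
rewrite (@hsubst_tau1 3 _ isT (ind1 undo3_123)) (@hsubst_fs2 3 _ _ isT (ind2 undo3_213)).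
rewrite (@hsubst_fs2 3 _ _ isT (ind2 undo3_231)) (@hsubst_fs2 3 _ _ isT (ind2 undo3_132)).
by apply/funext => d; apply: (congr1 (fun f : laurent _ => f d) st3E).
Qed.

Let at3E u v w u' v' w' d : undo3 u v w u' v' w' ->
  at3 (tau3 d) u v w = tau3_of b i L (tofrac u) (tofrac v) (tofrac w) d.
Proof.
move=> wfu; rewrite -(@hsubst_tau3 3 _ _ _ isT (ind3 wfu)).
by rewrite /at3 /hsubst; congr fsubst; apply/funext => j; rewrite seq3.
Qed.

Let tau3E d : tau3 d = tau3_of b i L x1 x2 x3 d.
Proof.
rewrite -(at3E d undo3_123) /at3 fsubst_id // => k; move: k.
exact: (all3 (Q := fun j x => tofrac (pt3 X1 X2 X3 j) = tofrac x :> rfun 3)).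
Qed.

Local Notation Pl := (coefwise (@ispoly 3)).

Let ispoly_fs2 d : ispoly (fs2 d).
Proof.
apply: ispolyD; first exact: ispoly_tau2.
by rewrite /hpure; case: eqP => _; [exact: ispolyC|exact: ispoly0].
Qed.

Let tau2sE u v w u' v' w' d : undo3 u v w u' v' w' ->
  tau2s_of b i L (kappa 3) (tofrac u) (tofrac v) d =
  fsubst (fs2 d) (fun j : 'I_2 => tofrac (nth 0 [:: u; v] j)).
Proof.
move=> wfu; rewrite -(@hsubst_fs2 3 _ _ isT (ind2 wfu)) /hsubst; congr fsubst.
by apply/funext => -[[|[|]]].
Qed.

Let i2 u v w u' v' w' : undo3 u v w u' v' w' ->
  indep 2 (fun j => tofrac (nth 0 [:: u; v] j)).
Proof. by move=> wfu; apply: indep_ext (ind2 wfu) => -[|[|]]. Qed.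

Let Pl_tau2s u v w u' v' w' : undo3 u v w u' v' w' ->
  Pl (tau2s_of b i L (kappa 3) (tofrac u) (tofrac v)).
Proof.
move=> wfu d; rewrite (tau2sE d wfu); have [p ->] := ispoly_fs2 d.
rewrite (fsubst_tofrac (i2 wfu)) (psubst_tofrac (nth 0 [:: u; v])).
by eexists.
Qed.

Let Pl_quot_tau2s u v w u' v' w' y z t y' z' t' (l : {mpoly rat[3]}) :
  undo3 u v w u' v' w' -> undo3 y z t y' z' t' -> l != 0 ->
  (exists s, u - y = l * s) -> (exists s, v - z = l * s) ->
  Pl ((tau2s_of b i L (kappa 3) (tofrac u) (tofrac v)
    - tau2s_of b i L (kappa 3) (tofrac y) (tofrac z)) * i (tofrac l)).
Proof.
move=> wfu wfy l0 uy vz.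
apply: (Pl_quot (U := nth 0 [:: u; v]) (V := nth 0 [:: y; z]) ispoly_fs2) => //.
- exact: i2 wfu.
- exact: i2 wfy.
- by move=> d; apply: tau2sE wfu.
- by move=> d; apply: tau2sE wfy.
- by case=> -[|[|]].
Qed.

Let Pl_st3 : Pl (tau3_of b i L x1 x2 x3 + tau3_of b i L x2 x1 x3 + tau3_of b i L x2 x3 x1).
Proof.
rewrite (st3_tau3E _ _ _ (kappa 3)) st3E.
have p1 : ispoly x1 by eexists.
have p2 : ispoly x2 by eexists.
apply: PlD; first apply: PlD; first apply: PlD.
- rewrite -tofracB; apply: (Pl_quot_tau2s undo3_213 undo3_231 X31_0).
    by exists 0; rewrite mulr0 subrr.
  by exists (-1); rewrite mulrN1 opprB.
- rewrite -tofracB; apply: (Pl_quot_tau2s undo3_132 undo3_231 X21_0).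
    by exists (-1); rewrite mulrN1 opprB.
  by exists 0; rewrite mulr0 subrr.
- by apply: PlM (Pl_tau1 p1) (Pl_tau2s undo3_231).
have Pk : Pl (kappa 3 / 24) by apply: PlM; apply: PlV.
by apply: PlM => //; apply: PlD; [apply: PlD|]; apply: Pl_bser_sub.
Qed.

Let regular_x3 d : regular (pt3 X1 X2 0) (tau3 d).
Proof.
have S1 : place (pt3 X1 X2 0) x1 x1 by have := place_poly (pt3 X1 X2 0) X1; rewrite sub3E.
have S2 : place (pt3 X1 X2 0) x2 x2 by have := place_poly (pt3 X1 X2 0) X2; rewrite sub3E.
have S3 : place (pt3 X1 X2 0) x3 0.
  by have := place_poly (pt3 X1 X2 0) X3; rewrite sub3E tofrac0.
have := res_tau3 (rho := @ratc 3) (@placeD _ (pt3 X1 X2 0)) (@placeM _ _) (@placeC _ _)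
  (@placeV _ _) S3 x3_0 S1 S2 x1_0 x2_0 x21_0 (d + 1).
rewrite lcoefM conv_pure addrK -tau3E; apply: place0_regular => //.
  by rewrite sub3E.
apply: ker_sub; apply: (all3 (Q := fun j x => exists t, x - pt3 X1 X2 0 j = X3 * t)).
- by exists 0; rewrite mulr0 subrr.
- by exists 0; rewrite mulr0 subrr.
- by exists 1; rewrite mulr1 subr0.
Qed.

(** As in depth two, with the polynomiality of tau1 and tau2 for the right sides. *)
Lemma ispoly_tau3 d : ispoly (tau3 d).
Proof.
have R3 := regular_x3 d; apply: ispoly_all3 R3 _.
  rewrite tau3E; apply: den_tau3.
    by apply: mulf_neq0 X31_0; apply: mulf_neq0 X32_0; apply: mulf_neq0 X21_0;
       apply: mulf_neq0 X3_0; apply: mulf_neq0 X2_0.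
  have dv (u t : {mpoly rat[3]}) D : u * t = D -> divisor D (tofrac u) by exists u, t.
  have d1 := dv X1 (X2 * X3 * (X2 - X1) * (X3 - X2) * (X3 - X1)).
  have d2 := dv X2 (X1 * X3 * (X2 - X1) * (X3 - X2) * (X3 - X1)).
  have d3 := dv X3 (X1 * X2 * (X2 - X1) * (X3 - X2) * (X3 - X1)).
  have d21 := dv (X2 - X1) (X1 * X2 * X3 * (X3 - X2) * (X3 - X1)).
  have d32 := dv (X3 - X2) (X1 * X2 * X3 * (X2 - X1) * (X3 - X1)).
  have d31 := dv (X3 - X1) (X1 * X2 * X3 * (X2 - X1) * (X3 - X2)).
  split; split; rewrite -?tofracB;
    [apply: d1|apply: d2|apply: d21|apply: d2|apply: d3|apply: d32
    |apply: d1|apply: d3|apply: d31]; ring.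
apply: regular_all3 => //.
  rewrite (at3E d undo3_213) (at3E d undo3_231) tau3E -!lcoefD; exact: Pl_st3.
rewrite (at3E d undo3_s1) (at3E d undo3_s2) (at3E d undo3_s3) !tofracD -!lcoefD.
have := sh3E; rewrite /sh3 => ->.
suff : Pl (tau1_of b i x1 * tau2_of b i L x2 (x2 + x3)) by apply.
apply: PlM; first by apply: Pl_tau1; eexists.
move=> e; rewrite -tofracD -(@hsubst_tau2 3 _ _ isT (ind2 undo3_s3)) /hsubst.
have [p ->] := ispoly_tau2 e; rewrite (fsubst_tofrac (ind2 undo3_s3)).
exists (sub (nth 0 [:: X2; X2 + X3]) p); apply: ispoly_psubst.
by case=> -[|[|]].
Qed.
End DepthThree.

Theorem theorem7p1 :
  let fs1 : hsum 1 := tau1 in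
  let fs2 : hsum 2 := tau2 + hpure 0 (ratc 2 48^-1) in
  let fs3 : hsum 3 :=
    let x1 := xvar 3 1 in
    tau3 - 96^-1 *: (hsubst b1 [:: x1] - hpure (-1) x1^-1) in
  [/\ is_pseries tau1, is_pseries tau2 & is_pseries tau3] /\
  [/\ shuffle2 tau1 tau2, shuffle3 tau1 tau2 tau3,
      stuffle2 fs1 fs2 & stuffle3 fs1 fs2 fs3].
Proof.
split; split.
- exact: is_pseries_poly (evaluates_tau1 1) ispoly_tau1.
- exact: is_pseries_poly (@evaluates_tau2 2 isT) ispoly_tau2.
- exact: is_pseries_poly (@evaluates_tau3 3 isT) ispoly_tau3.
- exact: shuffle2_tau.
- exact: shuffle3_tau.
- exact: stuffle2_tau.
- exact: stuffle3_tau.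
Qed.
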